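(* Let $A:\mathbb{R}\to\mathbb{R}$ be smooth and strictly convex, with $A'(0)=0$, and such that for every real-valued polynomial $P$ there exists $x\in\mathbb{R}_-$ with $P(x)>A'(x)$. Fix $\tilde a\in W^{2,\infty}([0,1])$ taking values in $(0,\infty)$. Let $u_-=0$. Then there exists a sequence of positive numbers $(K_n)_{n\in\mathbb{N}}$ going to $\infty$ such that, for every $n\in\mathbb{N}$, if $u_+=-K_n$, the following holds. Let $S$ be a viscous shock connecting $u_-$ to $u_+$ and let $a(x):=\tilde a\left(\frac{u_--S(x)}{u_--u_+}\right)$. There exists smooth initial data $u_0$ with $u_0-S\in C_0^\infty(\mathbb{R})$ such that for any Lipschitz shift $X:[0,\infty)\to\mathbb{R}$ with $X(0)=0$ there exists $T^*=T^*(\tilde a,\|\dot X\|_\infty)>0$ such that for every $t\in(0,T^* )$ $$\int_{\mathbb{R}}a(x)\,|u(x+X(t),t)-S(x)|^2\,dx>\int_{\mathbb{R}}a(x)\,|u_0(x)-S(x)|^2\,dx,$$ where $u$ is the solution of $u_t+(A(u))_x=u_{xx}$ on $\mathbb{R}\times(0,\infty)$ with $u(\cdot,0)=u_0$.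
   Context: $\mathbb{R}_-=(-\infty,0]$. $C_0^\infty$ denotes smooth compactly supported functions. For $u_->u_+$, a viscous shock connecting $u_-$ to $u_+$ is a smooth function $S:\mathbb{R}\to\mathbb{R}$ with $\lim_{\xi\to\pm\infty}S(\xi)=u_\pm$ satisfying $-\sigma S'+(A(S))'=S''$, where $\sigma=\frac{A(u_+)-A(u_-)}{u_+-u_-}$ (it exists, is strictly decreasing and is unique up to translation; it satisfies $-\sigma(S-u_\pm)+A(S)-A(u_\pm)=S'$). For bounded initial data the Cauchy problem $u_t+(A(u))_x=u_{xx}$ has a unique global bounded solution, and ''the solution'' refers to it. The dependence $T^*=T^*(\tilde a,\|\dot X\|_\infty)$ means that, the flux, the shock and $u_0$ being fixed, $T^*$ depends on the shift $X$ only through $\|\dot X\|_\infty$. *)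

(* Defs.v *)
From HB Require Import structures.
From mathcomp Require Import all_boot all_order all_algebra.
From mathcomp Require Import all_classical all_reals all_analysis.

Set Implicit Arguments.
Unset Strict Implicit.
Unset Printing Implicit Defensive.
Import Order.TTheory GRing.Theory Num.Theory.
Import numFieldNormedType.Exports.

Local Open Scope classical_set_scope.
Local Open Scope ring_scope.

Section Functions.
Context {R : realType}.
Local Notation mu := (@lebesgue_measure R).
Implicit Types (D : set R) (f g A : R -> R).

Definition smooth f := forall (n : nat) (x : R), derivable (derive1n n f) x 1.

Definition strictly_convex f := forall x y t : R,
  x != y -> 0 < t < 1 -> f (t * x + (1 - t) * y) < t * f x + (1 - t) * f y.

Definition tsupport f : set R := closure [set x | f x != 0].

(* C_0^oo(D) for an open set D *)
Definition test_function D f :=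
  [/\ smooth f, compact (tsupport f) & tsupport f `<=` D].

(* The norm of L^oo(D): f is extended by 0 outside D, so that only the values
   of f on D matter. *)
Definition Linfty_norm D f : \bar R := ('N[mu]_+oo [EFin \o (f \_ D)])%E.

Definition Linfty D f := measurable_fun D f /\ (Linfty_norm D f < +oo)%E.

Definition weak_derivative D f g := forall phi : R -> R,
  test_function D phi ->
  \int[mu]_(x in D) (f x * derive1 phi x) = - \int[mu]_(x in D) (g x * phi x).

(* W^{2,oo}([0,1]). A class in W^{2,oo}(]0,1[) has a unique representative that
   is continuous on [0,1]; f is required to be that representative, so that its
   pointwise values on [0,1] are meaningful. Values outside [0,1] are
   irrelevant. *)
Definition W2infty01 f :=
  {within `[0, 1], continuous f} /\
  exists f1 f2 : R -> R,
    [/\ Linfty `]0, 1[ f, Linfty `]0, 1[ f1, Linfty `]0, 1[ f2,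
        weak_derivative `]0, 1[ f f1 & weak_derivative `]0, 1[ f1 f2].

Definition shock_speed A (um up : R) : R := (A up - A um) / (up - um).

Definition viscous_shock A (um up : R) (S : R -> R) :=
  [/\ smooth S,
      S x @[x --> -oo] --> um,
      S x @[x --> +oo] --> up &
      forall xi : R, - shock_speed A um up * derive1 S xi
                       + derive1 (A \o S) xi = derive1n 2 S xi].

(* u x t is the value at position x and time t; values at t < 0 are
   irrelevant. *)
Section Cauchy.
Context (u : R -> R -> R).

Definition dt (x t : R) : R := derive1 (u x) t.
Definition dx (x t : R) : R := derive1 (u ^~ t) x.
Definition dxx (x t : R) : R := derive1n 2 (u ^~ t) x.

(* Bounded classical solutions of u_t + (A(u))_x = u_xx with datum u0:
   continuous up to t = 0 and of class C^{2,1} for t > 0. Bounded data that are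
   continuous admit exactly one of them. *)
Definition bounded_solution A (u0 : R -> R) :=
  [/\ exists M : R, forall x t : R, 0 <= t -> `|u x t| <= M,
      {within [set p : R * R | 0 <= p.2], continuous (fun p => u p.1 p.2)},
      forall x : R, u x 0 = u0 x,
      forall x t : R, 0 < t ->
        [/\ derivable (u x) t 1, derivable (u ^~ t) x 1,
            derivable (dx ^~ t) x 1,
            {for (x, t), continuous (fun p : R * R => dt p.1 p.2)} &
            {for (x, t), continuous (fun p : R * R => dx p.1 p.2)} /\
            {for (x, t), continuous (fun p : R * R => dxx p.1 p.2)}] &
      forall x t : R, 0 < t ->
        dt x t + derive1 (fun y => A (u y t)) x = dxx x t].

End Cauchy.

(* || dX/dt ||_{L^oo(0, +oo)}; finite for a Lipschitz X, whose derivative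
   exists almost everywhere. *)
Definition speed_norm (X : R -> R) : R := fine (Linfty_norm `]0, +oo[ (derive1 X)).

Definition weight (a : R -> R) (um up : R) (S : R -> R) (x : R) : R :=
  a ((um - S x) / (um - up)).

End Functions.

(* Main.v *)
Require Import Defs.
From HB Require Import structures.
From mathcomp Require Import all_boot all_order all_algebra.
From mathcomp Require Import all_classical all_reals all_analysis.
From mathcomp Require Import measurable_realfun ring lra.

Set Implicit Arguments.
Unset Strict Implicit.
Unset Printing Implicit Defensive.
Import Order.TTheory GRing.Theory Num.Theory.
Import numFieldNormedType.Exports.

Local Open Scope classical_set_scope.
Local Open Scope ring_scope.

(** The functional int a |u(. + X) - S|^2 is expanded around S. For a datum
    u0 = S + w0 with w0 small, its derivative at time 0 is, when int a w0 u0' =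
    0, twice a quadratic form Q(w0) = int a w0 (L w0) up to cubic terms, where
    L is the linearization of the equation at S in the frame of the shock. The
    orthogonality condition says that a translation has no effect at first
    order. It is therefore enough to find w0 orthogonal in this sense with
    Q(w0) > 0, and to control the errors.

    Positivity of Q. In the variable y = -S/K, which runs from 0 to 1, put
    b = (A(-K) - A(0))/K, the opposite of the shock speed, beta = -A'(S) >= 0
    and p = y' <= b. Then L w = w'' + (beta - b) w' + beta' w, and for w = f(y)
    the first-order terms cancel: L w = f''(y) p^2 + beta' w, so that
    Q(w) >= - C b + int a beta' w^2. If w is 1 near y = 1, the last integral
    collects at least alo (M - b - b/d) with M = -A'(-K), where alo and ahi are
    bounds of the weight for y >= 1 - 2 d. Cutting w off slowly at x = +oo costs
    - int a (beta - b) w w', at most ahi M / 2. By continuity of the weight at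
    y = 1, alo - ahi / 2 > 0 for small d, hence Q(w) > 0 as soon as M/b exceeds
    a constant depending on the weight alone ([end_layer],
    [positive_perturbation]). Such K exist because A' is not controlled by
    polynomials: if K |A'(-K)| <= N (A(-K) - A(0)) held for all large K, then
    A(-K) and A'(-K) would be O(K^N) by Gronwall's inequality
    ([derive_dominates_speed]).
    Subtracting a multiple of a bump located at intermediate values of y costs
    O(b) and provides the parameter with which the orthogonality condition is
    solved exactly ([good_datum]).

    Control of the errors. The functional increases by
    2 int a w0 delta + int a delta^2, where delta = u(. + X, t) - u0, and the
    first integrand has compact support. By the maximum principle,
    u(x, t) = u0(x) + t g(x) + O(t^2) uniformly in x and over all solutions with
    datum u0, where g = u0'' - (A(u0))' ([short_time_expansion]). The
    linear term is then 2 t int a w0 g + O(t |X| + t^2) plus O(X^2) times the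
    size of w0, while int a delta^2, taken where w0 vanishes and S is strictly
    decreasing, is at least of order min(|X|, 1)^2 up to O(t^2). Translations,
    small or large, thus only add to the distance, and one time serves for all
    shifts ([datum_increases]). *)

(** * Derivatives *)

Section Calculus.
Context {R : realType}.
Implicit Types f g : R -> R.

(** Derivation rules in pointwise form, with which a derivative is computed by
    following the syntax of an explicit expression; see the tactic [dv]. *)
Lemma dv_cst (c x : R) : is_derive x 1 (fun=> c) (0 : R).
Proof. exact: is_derive_cst. Qed.

Lemma dv_id (x : R) : is_derive x 1 (fun y : R => y) (1 : R).
Proof. exact: is_derive_id. Qed.

Lemma dvD f g (x df dg : R) : is_derive x 1 f df -> is_derive x 1 g dg ->
  is_derive x 1 (fun y => f y + g y) (df + dg).
Proof. exact: is_deriveD. Qed.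

Lemma dvN f (x df : R) : is_derive x 1 f df ->
  is_derive x 1 (fun y => - f y) (- df).
Proof. exact: is_deriveN. Qed.

Lemma dvM f g (x df dg : R) : is_derive x 1 f df -> is_derive x 1 g dg ->
  is_derive x 1 (fun y => f y * g y) (df * g x + f x * dg).
Proof.
move=> hf hg; have := is_deriveM hf hg => h.
by apply: (is_derive_eq h); rewrite /GRing.scale /= addrC mulrC [f x * _]mulrC.
Qed.

Lemma dvX f n (x df : R) : is_derive x 1 f df ->
  is_derive x 1 (fun y => f y ^+ n) (n%:R * f x ^+ n.-1 * df).
Proof. by move=> hf; have := is_deriveX n hf; rewrite exprfctE. Qed.

Lemma dvV f (x df : R) : f x != 0 -> is_derive x 1 f df ->
  is_derive x 1 (fun y => (f y)^-1) (- (f x) ^- 2 * df).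
Proof. by move=> f0 hf; have := is_deriveV f0 hf. Qed.

Lemma dv_comp f g (x df dg : R) : is_derive (g x) 1 f df ->
  is_derive x 1 g dg -> is_derive x 1 (fun y => f (g y)) (df * dg).
Proof. exact: is_derive1_comp. Qed.

Lemma dv_rev f (x df : R) : is_derive x 1 f df ->
  is_derive (- x) 1 (fun y => f (- y)) (- df).
Proof.
rewrite -{1}[x]opprK => hf; have := dv_comp hf (dvN (dv_id (- x))).
by rewrite mulrN1.
Qed.

Lemma dv_expR f (x df : R) : is_derive x 1 f df ->
  is_derive x 1 (fun y => expR (f y)) (expR (f x) * df).
Proof. by move=> hf; apply: dv_comp. Qed.

Lemma dvE f (x df : R) : is_derive x 1 f df -> derive1 f x = df.
Proof. by move=> h; rewrite derive1E; case: h. Qed.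

Lemma derivable_dv f (x : R) : derivable f x 1 -> is_derive x 1 f (derive1 f x).
Proof. by move=> h; rewrite derive1E; exact: derivableP. Qed.

Lemma dv_continuous f (x df : R) : is_derive x 1 f df ->
  {for x, continuous f}.
Proof.
by case=> h _; apply: differentiable_continuous; apply/derivable1_diffP.
Qed.

End Calculus.

Ltac dv_leaf :=
  match goal with
  | H : forall x, is_derive x _ ?f _ |- is_derive _ _ ?f _ => apply H
  | H : is_derive ?x _ ?f _ |- is_derive ?x _ ?f _ => apply H
  end.

Ltac dv_core := first
  [ dv_leaf | apply: dv_cst | apply: dv_id | eapply dvD | eapply dvN
  | eapply dvM | eapply dvX | eapply dv_expR ].

(* leaves the equality between the computed and the expected derivative *)
Ltac dv := eapply is_derive_eq; [repeat dv_core | cbv beta iota delta [predn Nat.pred]].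

(** * Smooth functions and a smooth step *)

Section Smooth.
Context {R : realType}.
Implicit Types f g : R -> R.

(** Differentiability to a finite order, in the recursive form on which the
    closure properties of [smooth] are proved by induction. *)
Fixpoint ndiff (n : nat) f : Prop :=
  if n is m.+1 then (forall x, derivable f x 1) /\ ndiff m (derive1 f) else True.

Lemma smoothP f : smooth f <-> forall n, ndiff n f.
Proof.
split.
- move=> sf n; elim: n f sf => [//|n ih] f sf /=; split; first exact: (sf 0%N).
  by apply: ih => m x; have := sf m.+1 x; rewrite derive1Sn.
- move=> h n; have := h n.+1; move=> {h}; elim: n f => [|n ih] f [h1 h2] x; first exact: h1.
  by rewrite derive1Sn; apply: ih.
Qed.

Lemma ndiffS n f : ndiff n.+1 f -> ndiff n f.
Proof. by elim: n f => [//|n ih] f /= [h1 h2]; split => //; apply: ih. Qed.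

Lemma ndiff_cst n (c : R) : ndiff n (fun=> c).
Proof.
elim: n c => [//|n ih] c /=; split; first by move=> x; exact: derivable_cst.
by rewrite (_ : derive1 _ = fun=> (0 : R))//; apply/funext => x; apply: dvE; exact: dv_cst.
Qed.

Lemma ndiff_id n : ndiff n (fun x : R => x).
Proof.
case: n => [//|n] /=; split; first by move=> x; exact: derivable_id.
rewrite (_ : derive1 _ = fun=> (1 : R)); first exact: ndiff_cst.
by apply/funext => x; apply: dvE; exact: dv_id.
Qed.

Lemma ndiffD n f g : ndiff n f -> ndiff n g -> ndiff n (fun x => f x + g x).
Proof.
elim: n f g => [//|n ih] f g /= [f1 f2] [g1 g2].
have d x := dvD (derivable_dv (f1 x)) (derivable_dv (g1 x)).
split; first by move=> x; have [] := d x.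
rewrite (_ : derive1 _ = fun x => derive1 f x + (derive1 g) x); first exact: ih.
by apply/funext => x; apply: dvE.
Qed.

Lemma ndiffM n f g : ndiff n f -> ndiff n g -> ndiff n (fun x => f x * g x).
Proof.
elim: n f g => [//|n ih] f g fn gn.
have [/= f1 f2] := fn; have [/= g1 g2] := gn.
have d x := dvM (derivable_dv (f1 x)) (derivable_dv (g1 x)).
split; first by move=> x; have [] := d x.
rewrite (_ : derive1 _ = fun x => derive1 f x * g x + f x * (derive1 g) x); last first.
  by apply/funext => x; apply: dvE.
by apply: ndiffD; apply: ih => //; exact: ndiffS.
Qed.

Lemma ndiff_comp n f g : ndiff n f -> ndiff n g -> ndiff n (fun x => f (g x)).
Proof.
elim: n f g => [//|n ih] f g fn gn.
have [/= f1 f2] := fn; have [/= g1 g2] := gn.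
have d x := dv_comp (derivable_dv (f1 (g x))) (derivable_dv (g1 x)).
split; first by move=> x; have [] := d x.
rewrite (_ : derive1 _ = fun x => (derive1 f) (g x) * (derive1 g) x); last first.
  by apply/funext => x; apply: dvE.
by apply: ndiffM => //; apply: ih => //; exact: ndiffS.
Qed.

Lemma ndiffV n f : (forall x, f x != 0) -> ndiff n f ->
  ndiff n (fun x => (f x)^-1).
Proof.
move=> f0; elim: n => [//|n ih] fn.
have [/= f1 f2] := fn.
have d x := dvV (f0 x) (derivable_dv (f1 x)).
split; first by move=> x; have [] := d x.
rewrite (_ : derive1 _ = fun x => -1 * ((f x)^-1 * (f x)^-1) * derive1 f x); last first.
  apply/funext => x; rewrite (dvE (d x)) mulN1r -exprVn expr2 //.
have fV : ndiff n (fun x => (f x)^-1) by apply: ih; exact: ndiffS.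
apply: ndiffM => //; apply: ndiffM; [exact: ndiff_cst|exact: ndiffM].
Qed.

Lemma smooth_cst (c : R) : smooth (fun _ : R => c).
Proof. by apply/smoothP => n; exact: ndiff_cst. Qed.

Lemma smooth_id : smooth (fun x : R => x).
Proof. by apply/smoothP => n; exact: ndiff_id. Qed.

Lemma smoothD f g : smooth f -> smooth g -> smooth (fun x => f x + g x).
Proof. by move=> /smoothP hf /smoothP hg; apply/smoothP => n; exact: ndiffD. Qed.

Lemma smoothM f g : smooth f -> smooth g -> smooth (fun x => f x * g x).
Proof. by move=> /smoothP hf /smoothP hg; apply/smoothP => n; exact: ndiffM. Qed.

Lemma smooth_comp f g : smooth f -> smooth g -> smooth (fun x => f (g x)).
Proof.
by move=> /smoothP hf /smoothP hg; apply/smoothP => n; exact: ndiff_comp.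
Qed.

Lemma smoothV f : (forall x, f x != 0) -> smooth f -> smooth (fun x => (f x)^-1).
Proof. by move=> f0 /smoothP hf; apply/smoothP => n; exact: ndiffV. Qed.

Lemma smoothN f : smooth f -> smooth (fun x => - f x).
Proof.
move=> sf; rewrite (_ : (fun _ => _) = fun x => -1 * f x).
  by apply: smoothM => //; exact: smooth_cst.
by apply/funext => x; rewrite mulN1r.
Qed.

Lemma smoothB f g : smooth f -> smooth g -> smooth (fun x => f x - g x).
Proof. by move=> sf sg; apply: smoothD => //; exact: smoothN. Qed.

Lemma smooth_derive f : smooth f -> smooth (derive1 f).
Proof. by move=> sf n x; have := sf n.+1 x; rewrite derive1Sn. Qed.

Lemma smooth_dv f : smooth f -> forall x : R, is_derive x 1 f (derive1 f x).
Proof. by move=> sf x; apply: derivable_dv; exact: (sf 0%N). Qed.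

Lemma smooth_continuous f : smooth f -> continuous f.
Proof. by move=> sf x; apply: dv_continuous; exact: smooth_dv. Qed.

End Smooth.

Section SmoothStep.
Context {R : realType}.

(** The functions x^(-n) exp(-1/x), extended by 0 to x <= 0. Only n = 0 is
    wanted; the others are what makes the family closed under derivation. *)
Definition flat (n : nat) (x : R) : R :=
  if 0 < x then (x^-1) ^+ n * expR (- x^-1) else 0.

(** The quadratic bound is what makes the derivative at 0 exist and vanish. It
    follows from (1/x)^(n+2) <= (n+2)! exp(1/x). *)
Lemma flat_le n : exists C : R, forall x, `|flat n x| <= C * x ^+ 2.
Proof.
exists (((n.+2)`!)%:R) => x; rewrite /flat; case: ifPn => x0; last first.
  by rewrite normr0 mulr_ge0// sqr_ge0.
have z0 : 0 < x^-1 by rewrite invr_gt0.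
rewrite ger0_norm; last by rewrite mulr_ge0 ?expR_ge0// exprn_ge0// ltW.
rewrite expRN ler_pdivrMr ?expR_gt0//.
have := @expR_ge1Dxn R x^-1 n.+1 (ltW z0) => h.
have {h} : x^-1 ^+ n.+2 / (n.+2)`!%:R <= expR x^-1.
  by apply: le_trans h; rewrite lerDr.
rewrite ler_pdivrMr ?ltr0n ?fact_gt0// => h.
have -> : x^-1 ^+ n = x^-1 ^+ n.+2 * x ^+ 2.
  by rewrite -[n.+2]addn2 exprD -mulrA -exprMn mulVf ?gt_eqF// expr1n mulr1.
have x2 : 0 < x ^+ 2 by rewrite exprn_gt0.
by rewrite [leRHS]mulrAC ler_pM2r// mulrC.
Qed.

Lemma dv_flat n (x : R) :
  is_derive x 1 (flat n) (flat n.+2 x - n%:R * flat n.+1 x).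
Proof.
case: (ltgtP x 0) => x0.
- rewrite /flat !ltNge (ltW x0) /= mulr0 subr0.
  apply: (near_eq_is_derive (f := fun=> (0 : R))).
  near=> y; rewrite ifF//; apply/negbTE; rewrite -leNgt.
  by apply/ltW; near: y; exact: lt_nbhsl.
- have x00 : x != 0 by rewrite gt_eqF.
  rewrite /flat x0.
  refine (@near_eq_is_derive _ _ _ (fun x : R => (x^-1) ^+ n * expR (- x^-1)) _ x 1 _ _ _).
    near=> y; rewrite ifT//; near: y; exact: lt_nbhsr.
  have := @dvV R id x 1 x00 (dv_id x) => /= h.
  dv; move: h => _.
  rewrite -!exprVn !mulr1; move: (expR _) => e.
  case: n => [|n] /=; first by rewrite !expr0; ring.
  rewrite !exprS; ring.
- have f0 m : flat m 0 = 0 by rewrite /flat ltxx.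
  subst x; rewrite !f0 mulr0 subr0.
  have [C hC] := flat_le n.
  apply/is_derive1_caratheodory.
  exists (fun z => flat n z / z); split.
  + move=> z; rewrite f0 !subr0.
    have [->|z0] := eqVneq z 0; first by rewrite mulr0 f0.
    by rewrite divfK.
  + suff : (flat n z / z) @[z --> (0 : R)] --> (0 : R).
      move=> h; change ((flat n z / z) @[z --> (0 : R)] --> (flat n 0 / 0)).
      by rewrite f0 mul0r.
    apply/cvgr0Pnorm_le => e e0.
    have C0 : 0 <= C by have := hC 1; rewrite expr1n mulr1; exact: le_trans.
    near=> z.
    rewrite normrM normfV.
    have [->|z0] := eqVneq z 0; first by rewrite normr0 invr0 mulr0 ltW.
    rewrite ler_pdivrMr ?normr_gt0//; apply: (le_trans (hC z)).
    rewrite -[z ^+ 2]real_normK ?num_real// expr2 mulrA ler_wpM2r//.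
    have : `|z| <= e / (C + 1).
      apply/ltW; near: z; apply: (@nbhs0_lt R R); rewrite divr_gt0//; lra.
    rewrite ler_pdivlMr; last by lra.
    by move=> h; have := normr_ge0 z; nra.
  + by rewrite f0 mul0r.
Unshelve. all: by end_near. Qed.

Lemma flat_ndiff k n : ndiff k (flat n).
Proof.
elim: k n => [//|k ih] n /=; split; first by move=> x; have [] := dv_flat n x.
rewrite (_ : derive1 _ = fun x => flat n.+2 x + - n%:R * flat n.+1 x); last first.
  by apply/funext => x; rewrite (dvE (dv_flat n x)) mulNr.
by apply: ndiffD => //; apply: ndiffM => //; exact: ndiff_cst.
Qed.

Lemma flat_ge0 n (x : R) : 0 <= flat n x.
Proof.
rewrite /flat; case: ifPn => // x0.
by rewrite mulr_ge0 ?expR_ge0// exprn_ge0// invr_ge0 ltW.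
Qed.

(** With e = exp(-1/x) extended by 0, the quotient e(x)/(e(x) + e(1 - x)): its
    denominator never vanishes. *)
Lemma smooth_step : exists h : R -> R,
  [/\ smooth h, forall x, 0 <= h x <= 1, forall x, x <= 0 -> h x = 0,
      forall x, 1 <= x -> h x = 1 & forall x, 0 <= (derive1 h) x].
Proof.
pose e := flat 0; pose d x := e x + e (1 - x).
have se : smooth e by apply/smoothP => n; exact: flat_ndiff.
have e1 : smooth (fun x : R => 1 - x).
  by apply: smoothB; [exact: smooth_cst|exact: smooth_id].
have sd : smooth d by apply: smoothD => //; exact: smooth_comp.
have epos x : 0 < x -> 0 < e x.
  by move=> x0; rewrite /e /flat x0 expr0 mul1r expR_gt0.
have e0 x : x <= 0 -> e x = 0 by rewrite leNgt /e /flat => /negbTE ->.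
have dpos x : 0 < d x.
  rewrite /d; have [x0|x0] := ltP 0 x.
    by rewrite ltr_pwDl ?epos ?flat_ge0.
  by rewrite ltr_wpDl ?flat_ge0// epos//; lra.
have d0 x : d x != 0 by rewrite gt_eqF.
exists (fun x => e x * (d x)^-1); split.
- by apply: smoothM => //; exact: smoothV.
- move=> x; rewrite divr_ge0 ?flat_ge0 ?(ltW (dpos x))//=.
  by rewrite ler_pdivrMr// mul1r lerDl flat_ge0.
- by move=> x x0; rewrite e0// mul0r.
- by move=> x x1; rewrite /d (e0 (1 - x)) ?addr0 ?mulfV ?gt_eqF ?epos//; lra.
- move=> x.
  have de (z : R) : is_derive z 1 e (flat 2 z).
    by have := dv_flat 0 z; rewrite mul0r subr0.
  have de1 : is_derive x 1 (fun y : R => e (1 - y)) (flat 2 (1 - x) * -1).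
    refine (@dv_comp _ e (fun y : R => 1 - y) x _ _ (de _) _).
    by dv; rewrite add0r.
  have dd : is_derive x 1 d (flat 2 x - flat 2 (1 - x)).
    by rewrite /d; dv; rewrite mulrN1.
  have dV := dvV (d0 x) dd.
  have := dvM (de x) dV => /dvE ->.
  rewrite -exprVn.
  have -> : flat 2 x * (d x)^-1 + e x * (- (d x)^-1 ^+ 2 * (flat 2 x - flat 2 (1 - x))) = (d
      x)^-1 ^+ 2 * (flat 2 x * e (1 - x) + e x * flat 2 (1 - x)).
    have -> : flat 2 x * (d x)^-1 = (d x)^-1 ^+ 2 * (flat 2 x * d x).
      by rewrite expr2; field.
    by rewrite /d; ring.
  by rewrite mulr_ge0 ?exprn_ge0 ?invr_ge0 ?(ltW (dpos x))// addr_ge0// mulr_ge0 ?flat_ge0.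
Qed.

End SmoothStep.

(** * The maximum principle and short-time asymptotics *)

Section MaximumPrinciple.
Context {R : realType}.
Implicit Types f : R -> R.

Lemma dv_gt0_incr_right f (x d : R) : is_derive x 1 f d -> 0 < d ->
  exists2 e : R, 0 < e & forall h, 0 < h < e -> f x < f (x + h).
Proof.
move=> [df dE] d0.
have /cvgr_gt : h^-1 *: (f (h *: 1 + x) - f x) @[h --> (0 : R)^'] --> d.
  by rewrite -dE; exact: df.
move=> /(_ 0 d0) [e /= e0 he].
exists e => // h /andP[h0 hle].
have := he h; rewrite /ball /= sub0r normrN gtr0_norm// => /(_ hle).
rewrite gt_eqF// => /(_ isT).
rewrite /GRing.scale /= mulr1 pmulr_rgt0 ?invr_gt0// subr_gt0.
by rewrite addrC.
Qed.

Lemma max_first_derivative f (x d : R) : is_derive x 1 f d ->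
  (forall y, y <= x -> f y <= f x) -> 0 <= d.
Proof.
move=> df fm; rewrite leNgt; apply/negP => d0.
have dg := dv_rev df.
have [|e e0 he] := dv_gt0_incr_right dg; first by rewrite oppr_gt0.
have := he (e / 2); rewrite opprD !opprK => /(_ _)/wrap[]; first lra.
by rewrite ltNge fm//; lra.
Qed.

Lemma max_second_derivative f f1 (x d : R) :
  (forall y : R, is_derive y 1 f (f1 y)) -> is_derive x 1 f1 d ->
  (forall y, f y <= f x) -> f1 x = 0 /\ d <= 0.
Proof.
move=> df df1 fm.
have f1x : f1 x = 0.
  have h : is_derive x 1 f 0.
    apply: (@derive1_at_max R f (x - 1) (x + 1) x); first lra.
    - by move=> t _; have [] := df t.
    - by rewrite in_itv /=; apply/andP; split; lra.
    - by move=> t _; exact: fm.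
  by rewrite -(dvE (df x)) (dvE h).
split=> //; rewrite leNgt; apply/negP => d0.
have [e e0 he] := dv_gt0_incr_right df1 d0.
have e2 : 0 < e / 2 by lra.
have [||c /andP[]] := @MVT R f f1 x (x + e / 2); first by lra.
- by apply: continuous_subspaceT => y; exact: dv_continuous (df y).
rewrite !bnd_simp => c1 c2 E.
have f1c : 0 < f1 c.
  by have := he (c - x); rewrite f1x subrKC; apply; lra.
have := fm (x + e / 2); rewrite leNgt => /negP; apply.
by rewrite -subr_gt0 E mulr_gt0// addrC addKr.
Qed.

(** Subtracting a small multiple of exp(k t)(1 + x^2), a strict supersolution
    once k is large compared with the bound on the drift, forces a positive
    maximum of a bounded subsolution to be attained at a finite point, where the
    signs of the derivatives contradict the equation. *)
Lemma maximum_principle (T B M : R) (w wt wx wxx b : R -> R -> R) :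
  (forall x t : R, 0 < t -> is_derive t 1 (w x) (wt x t)) ->
  (forall x t : R, 0 < t -> is_derive x 1 (w ^~ t) (wx x t)) ->
  (forall x t : R, 0 < t -> is_derive x 1 (wx ^~ t) (wxx x t)) ->
  {within [set p : R * R | 0 <= p.2], continuous (fun p => w p.1 p.2)} ->
  (forall x t, 0 < t <= T -> `|b x t| <= B) ->
  (forall x t, 0 <= t <= T -> w x t <= M) ->
  (forall x, w x 0 <= 0) ->
  (forall x t, 0 < t <= T -> wt x t + b x t * wx x t - wxx x t <= 0) ->
  forall x t, 0 <= t <= T -> w x t <= 0.
Proof.
move=> dt dx dxx cw bB wM w0 sub x1 t1 t1T.
rewrite leNgt; apply/negP => w1.
pose k := `|B| + 3.
pose h (x t : R) := expR (k * t) * (1 + x ^+ 2).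
have hpos x t : 0 < h x t.
  by rewrite mulr_gt0 ?expR_gt0//; have := sqr_ge0 x; lra.
pose e := w x1 t1 / (2 * h x1 t1).
have e0 : 0 < e by rewrite divr_gt0// mulr_gt0.
have w1e : 0 < w x1 t1 - e * h x1 t1.
  have -> : e * h x1 t1 = w x1 t1 / 2.
    by rewrite /e; have := hpos x1 t1; move: (h _ _) => H H0; field; lra.
  by lra.
pose z x t := w x t - e * h x t.
(* beyond L the barrier e (1 + x^2) exceeds the bound M on w *)
pose L := `|x1| + 1 + `|M| / e.
have Me0 : 0 <= `|M| / e by rewrite divr_ge0// ltW.
have zout x t : 0 <= t <= T -> L <= `|x| -> z x t < 0.
  move=> tT Lx; rewrite subr_lt0; apply: (le_lt_trans (wM x t tT)).
  have : `|M| / e < 1 + x ^+ 2.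
    have := normr_ge0 x1; have : x ^+ 2 = `|x| ^+ 2 by rewrite real_normK ?num_real.
    by rewrite /L in Lx; nra.
  rewrite ltr_pdivrMr// => hM; apply: (le_lt_trans (ler_norm M)).
  apply: (lt_le_trans hM); rewrite mulrC ler_pM2l// /h.
  have E : 1 <= expR (k * t).
    apply: le_trans (expR_ge1Dx _); rewrite lerDl mulr_ge0//; last by case/andP: tT.
    by rewrite /k; have := normr_ge0 B; lra.
  by rewrite ler_peMl//; have := sqr_ge0 x; lra.
pose A : set (R * R) := `[- L, L]%classic `*` `[0, T]%classic.
have [//|//||] := @compact_EVT_max _ R (fun p => z p.1 p.2) A.
- exists (x1, t1); split => /=; rewrite in_itv /=//.
  by rewrite -ler_norml /L; lra.
- by apply: compact_setX; exact: segment_compact.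
- have cw' : {within A, continuous (fun p => w p.1 p.2)}.
    apply: continuous_subspaceW cw => p [_] /=.
    by rewrite in_itv /= => /andP[].
  have ch : continuous (fun p : R * R => e * h p.1 p.2).
    move=> p; apply: cvgM; first exact: cvg_cst.
    apply: cvgM.
      apply: continuous_cvg; first exact: continuous_expR.
      by apply: cvgM; [exact: cvg_cst|exact: cvg_snd].
    apply: cvgD; first exact: cvg_cst.
    have := @cvgM _ _ (nbhs p) _ _ _ _ _ cvg_fst cvg_fst; exact.
  have ch' : {within A, continuous (fun p : R * R => e * h p.1 p.2)}.
    exact: continuous_subspaceT.
  move=> p; apply: cvgB; first exact: cw'.
  exact: ch'.
move=> [x0 t0]; rewrite inE => -[/=].
rewrite !in_itv /= => x0L t0T zmax.
have z0 : 0 < z x0 t0.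
  apply: (lt_le_trans w1e); apply: (zmax (x1, t1)); rewrite inE; split => /=; rewrite in_itv /=//.
  by rewrite -ler_norml /L; lra.
have t00 : 0 < t0.
  rewrite lt_neqAle; case/andP: (t0T) => -> _; rewrite andbT; apply/eqP => t0E.
  move: z0; rewrite /z -t0E; have := w0 x0; have := mulr_gt0 e0 (hpos x0 0); lra.
have zx x : z x t0 <= z x0 t0.
  have [Lx|Lx] := leP L `|x|; first by apply/ltW/(lt_trans _ z0); exact: zout.
  apply: (zmax (x, t0)); rewrite inE; split => /=; rewrite in_itv /=//.
  by rewrite -ler_norml ltW.
have zt t : 0 <= t <= t0 -> z x0 t <= z x0 t0.
  move=> tt; apply: (zmax (x0, t)); rewrite inE; split => /=; rewrite in_itv /=//.
  by case/andP: t0T => _ ?; apply/andP; split; lra.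
pose E := expR (k * t0).
have dzt : is_derive t0 1 (z x0) (wt x0 t0 - e * (E * k * (1 + x0 ^+ 2))).
  have dw := dt x0 t0 t00.
  by rewrite /z /h; dv; rewrite /E; ring.
have dzx (x : R) : is_derive x 1 (z ^~ t0) (wx x t0 - e * (E * (2 * x))).
  have dw := dx x t0 t00.
  by rewrite /z /h; dv; rewrite /E/=; ring.
have dzxx : is_derive x0 1 (fun x => wx x t0 - e * (E * (2 * x)))
    (wxx x0 t0 - e * (E * 2)).
  have dw := dxx x0 t0 t00.
  by dv; ring.
(* the derivatives of z at its maximum contradict the choice of k *)
have [zx0 zxx0] := max_second_derivative dzx dzxx zx.
have zt0 : 0 <= wt x0 t0 - e * (E * k * (1 + x0 ^+ 2)).
  rewrite leNgt; apply/negP => neg.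
  have dg := dv_rev dzt.
  have [|d d0 hd] := dv_gt0_incr_right dg; first by rewrite oppr_gt0.
  pose s := Num.min (d / 2) t0.
  have s0 : 0 < s by rewrite lt_min t00 andbT; lra.
  have sd : s <= d / 2 by rewrite ge_min lexx.
  have st : s <= t0 by rewrite ge_min lexx orbT.
  have := hd s; rewrite opprD !opprK => /(_ _)/wrap[]; first lra.
  by rewrite ltNge zt//; lra.
have t0T' : 0 < t0 <= T by case/andP: t0T => _ ->; rewrite t00.
have := sub x0 t0 t0T'; have := bB x0 t0 t0T'.
have E0 : 0 < e * E by rewrite mulr_gt0// expR_gt0.
have -> : wx x0 t0 = e * E * (2 * x0) by lra.
rewrite ler_norml => /andP[b1 b2].
have Bn := ler_norm B.
have : 0 < e * E * (k * (1 + x0 ^+ 2) + b x0 t0 * (2 * x0) - 2).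
  rewrite mulr_gt0// /k.
  have -> : (`|B| + 3) * (1 + x0 ^+ 2) + b x0 t0 * (2 * x0) - 2 =
     (`|B| - `|b x0 t0|) * (1 + x0 ^+ 2) + (`|b x0 t0| * (1 + x0 ^+ 2) + b x0 t0 * (2 * x0)) +
         (3 * x0 ^+ 2 + 1) by ring.
  have h1 : 0 <= (`|B| - `|b x0 t0|) * (1 + x0 ^+ 2).
    rewrite mulr_ge0//; last by have := sqr_ge0 x0; lra.
    rewrite subr_ge0 ler_norml; apply/andP; split; lra.
  have h2 : 0 <= `|b x0 t0| * (1 + x0 ^+ 2) + b x0 t0 * (2 * x0).
    have [bp|bn] := ger0P (b x0 t0).
      have -> : b x0 t0 * (1 + x0 ^+ 2) + b x0 t0 * (2 * x0) = b x0 t0 * (1 + x0) ^+ 2 by ring.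
      by rewrite mulr_ge0// sqr_ge0.
    have -> : - b x0 t0 * (1 + x0 ^+ 2) + b x0 t0 * (2 * x0) = - b x0 t0 * (1 - x0) ^+ 2 by ring.
    by rewrite mulr_ge0 ?sqr_ge0// oppr_ge0 ltW.
  by have := sqr_ge0 x0; lra.
lra.
Qed.

End MaximumPrinciple.

Section MeanValue.
Context {R : realType}.
Implicit Types f : R -> R.

Lemma mean_value f f1 (x y : R) : (forall z : R, is_derive z 1 f (f1 z)) ->
  x < y -> exists2 c, x < c < y & f y - f x = f1 c * (y - x).
Proof.
move=> df xy.
have [|c] := @MVT R f f1 x y xy.
- by apply: continuous_subspaceT => z; exact: dv_continuous (df z).
- by rewrite in_itv /= => ? ?; exists c.
Qed.

Lemma derivative_lipschitz f f1 (a b L : R) :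
  (forall z : R, is_derive z 1 f (f1 z)) ->
  (forall z, a <= z <= b -> `|f1 z| <= L) ->
  forall x y, a <= x <= b -> a <= y <= b -> `|f y - f x| <= L * `|y - x|.
Proof.
move=> df fL.
suff H x y : a <= x <= b -> a <= y <= b -> x < y ->
    `|f y - f x| <= L * `|y - x|.
  move=> x y xab yab; case: (ltgtP x y) => [xy|yx|->]; first exact: H.
    by rewrite distrC (distrC y x); exact: H.
  by rewrite !subrr !normr0 mulr0.
move=> xab yab xy; have [c cxy ->] := mean_value df xy.
by rewrite normrM ler_wpM2r// fL//; apply/andP; split; lra.
Qed.

Lemma taylor1 f f1 f2 (a b L : R) :
  (forall z : R, is_derive z 1 f (f1 z)) ->
  (forall z : R, is_derive z 1 f1 (f2 z)) ->
  (forall z, a <= z <= b -> `|f2 z| <= L) ->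
  forall x y, a <= x <= b -> a <= y <= b ->
    `|f y - f x - f1 x * (y - x)| <= L * (y - x) ^+ 2.
Proof.
move=> df df1 fL x y xab yab.
have L0 : 0 <= L by apply: le_trans (fL x xab).
have dg (z : R) : is_derive z 1 (fun z => f z - f1 x * z) (f1 z - f1 x).
  by dv; ring.
pose m := Num.min x y; pose M := Num.max x y.
have [mx my] : m <= x /\ m <= y by rewrite !ge_min !lexx orbT.
have [xM yM] : x <= M /\ y <= M by rewrite !le_max !lexx orbT.
have Mm : M - m = `|y - x|.
  rewrite /M /m; have [xy|yx] := leP x y; first by rewrite ger0_norm ?subr_ge0.
  by rewrite distrC gtr0_norm ?subr_gt0.
have [am Mb] : a <= m /\ M <= b by rewrite le_min ge_max; split; lra.
have H : forall z, m <= z <= M -> `|f1 z - f1 x| <= L * `|y - x|.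
  move=> z zm; apply: (le_trans (derivative_lipschitz df1 fL xab _)).
    by apply/andP; split; lra.
  by rewrite ler_wpM2l// -Mm ler_norml; apply/andP; split; lra.
have := @derivative_lipschitz _ _ _ _ _ dg H x y.
rewrite mx my xM yM => /(_ isT isT).
rewrite -mulrA -expr2 real_normK ?num_real//.
by congr (`|_| <= _); ring.
Qed.

Lemma continuous_itv_bounded f : continuous f ->
  forall a b, exists2 M, 0 <= M & forall x, a <= x <= b -> `|f x| <= M.
Proof.
move=> cf a b; have [ab|ba] := leP a b; last first.
  by exists 0 => // x xab; exfalso; lra.
have [|c _ cm] := @EVT_max R (fun x => `|f x|) a b ab.
  apply: continuous_subspaceT => x; apply: cvg_norm; exact: cf.
by exists `|f c| => // x xab; apply: cm; rewrite in_itv.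
Qed.

End MeanValue.

Section ShortTime.
Context {R : realType}.

(** A bounded solution of u_t + b u_x = u_xx whose drift is bounded by B up to
    time T. Regarding the drift as given makes the equation linear, so that
    lower bounds follow from upper bounds for -u. *)
Definition drift_solution (T B : R) (u b : R -> R -> R) :=
  (exists ut ux uxx : R -> R -> R,
    [/\ forall x t : R, 0 < t -> is_derive t 1 (u x) (ut x t),
        forall x t : R, 0 < t -> is_derive x 1 (u ^~ t) (ux x t),
        forall x t : R, 0 < t -> is_derive x 1 (ux ^~ t) (uxx x t) &
        forall x t, 0 < t -> ut x t + b x t * ux x t = uxx x t]) /\
  [/\ {within [set p : R * R | 0 <= p.2], continuous (fun p => u p.1 p.2)},
      exists M, forall x t, 0 <= t -> `|u x t| <= M &
      forall x t, 0 < t <= T -> `|b x t| <= B].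

Lemma drift_solutionN T B u b : drift_solution T B u b ->
  drift_solution T B (fun x t => - u x t) b.
Proof.
move=> [[ut [ux [uxx [ht hx hxx E]]]] [cu [M uM] bB]]; split.
  exists (fun x t => - ut x t), (fun x t => - ux x t), (fun x t => - uxx x t).
  split=> x t t0.
  - by have h := ht x t t0; dv.
  - by have h := hx x t t0; dv.
  - by have h := hxx x t t0; dv.
  - by rewrite -E//; ring.
split=> //; last by exists M => x t t0; rewrite normrN uM.
by move=> p; apply: cvgN; exact: cu.
Qed.

(** Comparison with a supersolution of the form f + t g + c t^2, the only shape
    needed for an expansion of second order in time. *)
Lemma drift_comparison (T B c Mf Mg : R) (u b : R -> R -> R)
    (f f1 f2 g g1 g2 : R -> R) :
  drift_solution T B u b ->
  (forall x : R, is_derive x 1 f (f1 x)) ->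
  (forall x : R, is_derive x 1 f1 (f2 x)) ->
  (forall x : R, is_derive x 1 g (g1 x)) ->
  (forall x : R, is_derive x 1 g1 (g2 x)) ->
  (forall x, `|f x| <= Mf) -> (forall x, `|g x| <= Mg) ->
  (forall x, u x 0 <= f x) ->
  (forall x t, 0 < t <= T ->
    0 <= g x + 2 * c * t + b x t * (f1 x + t * g1 x) - (f2 x + t * g2 x)) ->
  forall x t, 0 <= t <= T -> u x t <= f x + t * g x + c * t ^+ 2.
Proof.
move=> [[ut [ux [uxx [ht hx hxx E]]]] [cu [M uM] bB]] df df1 dg dg1 fM gM u0 sup.
move=> x t tT; rewrite -subr_le0.
pose w x t := u x t - (f x + t * g x + c * t ^+ 2).
pose wt x t := ut x t - (g x + 2 * c * t).
pose wx x t := ux x t - (f1 x + t * g1 x).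
pose wxx x t := uxx x t - (f2 x + t * g2 x).
apply: (@maximum_principle R T B (M + Mf + T * Mg + `|c| * T ^+ 2) w wt wx wxx b).
- move=> y s s0; have h := ht y s s0; rewrite /w /wt; dv; ring.
- move=> y s s0; have h := hx y s s0; rewrite /w /wx; dv; ring.
- move=> y s s0; have h := hxx y s s0; rewrite /wx /wxx; dv; ring.
- have cf : continuous f by move=> z; exact: dv_continuous (df z).
  have cg : continuous g by move=> z; exact: dv_continuous (dg z).
  have ch : continuous (fun p : R * R => f p.1 + p.2 * g p.1 + c * p.2 ^+ 2).
    move=> p; apply: cvgD; first apply: cvgD.
    - by apply: (@continuous_cvg _ _ _ _ _ _ f); [exact: cf|exact: cvg_fst].
    - by apply: cvgM; [exact: cvg_snd|apply: (@continuous_cvg _ _ _ _ _ _ g); [exact: cg|exact: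
        cvg_fst]].
    - apply: cvgM; first exact: cvg_cst.
      by have := @cvgM _ _ (nbhs p) _ _ _ _ _ cvg_snd cvg_snd; exact.
  have ch' : {within [set p : R * R | 0 <= p.2],
      continuous (fun p : R * R => f p.1 + p.2 * g p.1 + c * p.2 ^+ 2)}.
    exact: continuous_subspaceT.
  by move=> p; apply: cvgB; [exact: cu|exact: ch'].
- exact: bB.
- move: tT => _; move=> {}x {}t tT; rewrite /w.
  have t0 : 0 <= t by case/andP: tT.
  have := uM x t t0; have := fM x; have := gM x.
  rewrite !ler_norml => /andP[h1 _] /andP[h2 _] /andP[_ h3].
  have tg : - (T * Mg) <= t * g x.
    have : t * - Mg <= t * g x by rewrite ler_wpM2l.
    have : t * Mg <= T * Mg.
      rewrite ler_wpM2r//; last by case/andP: tT.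
      by have := gM x; apply: le_trans.
    by lra.
  have tc : - (`|c| * T ^+ 2) <= c * t ^+ 2.
    have : - `|c| * t ^+ 2 <= c * t ^+ 2.
      by rewrite ler_wpM2r ?sqr_ge0// lerNl -normrN ler_norm.
    have : `|c| * t ^+ 2 <= `|c| * T ^+ 2.
      by rewrite ler_wpM2l//; case/andP: tT => ? ?; nra.
    by lra.
  by lra.
- by move=> {}x; rewrite /w expr0n /= mul0r mulr0 !addr0 subr_le0.
- move: tT => _; move=> {}x {}t tT; have := sup x t tT; have := E x t.
  have -> : 0 < t by case/andP: tT.
  by move=> /(_ isT); rewrite /wt /wx /wxx; lra.
- exact: tT.
Qed.

Lemma bounded_solution_drift (A u0 : R -> R) (M B T : R) (u : R -> R -> R) :
  smooth A -> bounded_solution u A u0 ->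
  (forall x t, 0 < t <= T -> `|u x t| <= M) ->
  (forall s, - M <= s <= M -> `|derive1 A s| <= B) ->
  drift_solution T B u (fun x t => derive1 A (u x t)).
Proof.
move=> sA [[M' uM'] cu _ du equ] uM AB; split; last first.
  split => //; first by exists M'.
  by move=> x t tT; apply: AB; rewrite -ler_norml uM.
have hx (x t : R) : 0 < t -> is_derive x 1 (u ^~ t) (Defs.dx u x t).
  by move=> /(du x t)[_ h _ _ _]; exact: derivable_dv.
exists (dt u), (Defs.dx u), (dxx u); split.
- by move=> x t t0; have [h _ _ _ _] := du x t t0; exact: derivable_dv.
- exact: hx.
- by move=> x t t0; have [_ _ h _ _] := du x t t0; exact: derivable_dv.
- move=> x t t0; rewrite -(equ x t t0); congr (_ + _).
  by have /dvE -> := dv_comp (smooth_dv sA (u x t)) (hx x t t0).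
Qed.

Lemma residual_ge0 (a b p q C s : R) : 0 <= C * s ->
  `|a + b * p - q| <= C * s -> 0 <= a + 2 * C * s + b * p - q.
Proof. by move=> Cs; rewrite ler_norml => /andP[]; lra. Qed.

Lemma residual_ge0N (a b p p' q q' C s : R) : 0 <= C * s ->
  `|a + b * (p + s * p') - (q + s * q')| <= C * s ->
  0 <= - a + 2 * C * s + b * (- p + s * - p') - (- q + s * - q').
Proof. by move=> Cs; rewrite ler_norml => /andP[]; lra. Qed.

(** Second-order expansion in time at t = 0, uniform in space and over all
    solutions with datum u0. Three comparisons: with constants for the sup
    bound, with u0 +- C t, and, knowing that |u - u0| = O(t) makes the
    residual of u0 + t g an O(t), with u0 + t g +- C t^2. *)
Lemma short_time_expansion (A u0 g : R -> R) (M0 M1 M2 G0 G1 G2 : R) :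
  smooth A -> smooth u0 -> smooth g ->
  (forall x, g x = derive1 (derive1 u0) x - derive1 A (u0 x) * derive1 u0 x) ->
  (forall x, `|u0 x| <= M0) -> (forall x, `|derive1 u0 x| <= M1) ->
  (forall x, `|derive1 (derive1 u0) x| <= M2) ->
  (forall x, `|g x| <= G0) -> (forall x, `|derive1 g x| <= G1) ->
  (forall x, `|derive1 (derive1 g) x| <= G2) ->
  exists2 C, 0 <= C & forall u, bounded_solution u A u0 ->
    forall x t, 0 <= t <= 1 ->
      `|u x t| <= M0 /\ `|u x t - u0 x - t * g x| <= C * t ^+ 2.
Proof.
move=> sA su0 sg gE u0M u1M u2M gG0 gG1 gG2.
have sA1 := smooth_derive sA; have sA2 := smooth_derive sA1.
have M00 : 0 <= M0 by apply: le_trans (u0M 0).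
have M10 : 0 <= M1 by apply: le_trans (u1M 0).
have [B B0 AB] := continuous_itv_bounded (smooth_continuous sA1) (- M0) M0.
have [L L0 AL] := continuous_itv_bounded (smooth_continuous sA2) (- M0) M0.
pose C1 := M2 + B * M1.
have C10 : 0 <= C1 by rewrite addr_ge0 ?mulr_ge0//; apply: le_trans (u2M 0).
pose C := L * C1 * M1 + B * G1 + G2.
have C0 : 0 <= C.
  by rewrite !addr_ge0 ?mulr_ge0//; [apply: le_trans (gG1 0)|apply: le_trans (gG2 0)].
exists C => // u su.
have uu0 : forall x, u x 0 = u0 x by case: su.
have Nd (f f' : R -> R) : (forall x : R, is_derive x 1 f (f' x)) ->
  forall x : R, is_derive x 1 (fun x => - f x) (- f' x).
  by move=> h x; dv.
have d0 (c x : R) : is_derive x 1 (fun=> c) 0 by exact: dv_cst.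
have u_le_M0 x t : 0 <= t <= 1 -> `|u x t| <= M0.
  move=> t01; have [[M uM] _ _ _ _] := su.
  have [B' B'0 AB'] := continuous_itv_bounded (smooth_continuous sA1) (- M) M.
  have ds : drift_solution 1 B' u (fun x t => derive1 A (u x t)).
    by apply: (bounded_solution_drift sA su _ AB') => y s /andP[/ltW s0 _]; exact: uM.
  have h v b : drift_solution 1 B' v b -> (forall x, v x 0 <= M0) -> v x t <= M0.
    move=> dsv v0.
    have -> : M0 = M0 + t * 0 + 0 * t ^+ 2 by ring.
    apply: (@drift_comparison 1 B' 0 `|M0| `|0| v b (fun=> M0) (fun=> 0) (fun=> 0) (fun=> 0)
        (fun=> 0) (fun=> 0) dsv (d0 _) (d0 _) (d0 _) (d0 _) (fun=> lexx _) (fun=> lexx _) v0 _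
        x t t01) => y s _.
    by rewrite !mulr0 !addr0 !mulr0 !mul0r !addr0 subr0.
  rewrite ler_norml; apply/andP; split.
    rewrite lerNl; apply: (h _ _ (drift_solutionN ds)) => y; rewrite uu0.
    by have := u0M y; rewrite ler_norml => /andP[]; lra.
  apply: (h _ _ ds) => y; rewrite uu0.
  by have := u0M y; rewrite ler_norml => /andP[].
have ds : drift_solution 1 B u (fun x t => derive1 A (u x t)).
  by apply: (bounded_solution_drift sA su _ AB) => y s /andP[/ltW s0 s1]; apply: u_le_M0;
      rewrite s0.
have bB y s : 0 < s <= 1 -> `|derive1 A (u y s)| <= B.
  by move=> /andP[/ltW s0 s1]; apply: AB; rewrite -ler_norml u_le_M0// s0.
have step1 x t : 0 <= t <= 1 -> `|u x t - u0 x| <= C1 * t.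
  move=> t01.
  have key y s : 0 < s <= 1 ->
     `|derive1 A (u y s) * derive1 u0 y - derive1 (derive1 u0) y| <= C1.
    move=> s01; apply: (le_trans (ler_normB _ _)).
    by rewrite /C1 addrC normrM lerD// ler_pM// bB.
  have up : u x t <= u0 x + t * C1 + 0 * t ^+ 2.
    apply: (@drift_comparison 1 B 0 M0 `|C1| u _ u0 _ _ (fun=> C1) (fun=> 0) (fun=> 0) ds
        (smooth_dv su0) (smooth_dv (smooth_derive su0)) (d0 _) (d0 _) u0M (fun=> lexx _) _ _ x
        t t01).
      by move=> y; rewrite uu0.
    move=> y s s01; have := key y s s01; rewrite ler_norml => /andP[]; lra.
  have lo : - u x t <= - u0 x + t * C1 + 0 * t ^+ 2.
    apply: (@drift_comparison 1 B 0 M0 `|C1| _ _ (fun x => - u0 x) _ _ (fun=> C1) (fun=> 0)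
        (fun=> 0) (drift_solutionN ds) (Nd _ _ (smooth_dv su0)) (Nd _ _ (smooth_dv
        (smooth_derive su0))) (d0 _) (d0 _) _ (fun=> lexx _) _ _ x t t01).
    - by move=> y; rewrite normrN.
    - by move=> y; rewrite uu0.
    move=> y s s01; have := key y s s01; rewrite ler_norml => /andP[]; lra.
  rewrite ler_norml; apply/andP; split; lra.
have step2 y s : 0 < s <= 1 ->
    `|g y + derive1 A (u y s) * (derive1 u0 y + s * derive1 g y) -
      (derive1 (derive1 u0) y + s * derive1 (derive1 g) y)| <= C * s.
  move=> s01; have /andP[s0 s1] := s01.
  have s01' : 0 <= s <= 1 by rewrite ltW.
  have -> : g y + derive1 A (u y s) * (derive1 u0 y + s * derive1 g y) -
      (derive1 (derive1 u0) y + s * derive1 (derive1 g) y) =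
      (derive1 A (u y s) - derive1 A (u0 y)) * derive1 u0 y +
      (s * (derive1 A (u y s) * derive1 g y) - s * derive1 (derive1 g) y).
    rewrite gE; move: (derive1 A (u y s)) (derive1 A (u0 y)) (derive1 u0 y) (derive1 g y)
      (derive1 (derive1 u0) y) (derive1 (derive1 g) y) => a1 a2 a3 a4 a5 a6.
    by ring.
  have h1 : `|(derive1 A (u y s) - derive1 A (u0 y)) * derive1 u0 y| <= L * (C1 * s) * M1.
    rewrite normrM ler_pM//.
    apply: (le_trans (derivative_lipschitz (smooth_dv sA1) AL _ _)).
    - by rewrite -ler_norml.
    - by rewrite -ler_norml u_le_M0.
    - by rewrite ler_wpM2l// step1.
  have h2 : `|s * (derive1 A (u y s) * derive1 g y)| <= s * (B * G1).
    by rewrite normrM gtr0_norm// ler_wpM2l ?(ltW s0)// normrM ler_pM// bB.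
  have h3 : `|s * derive1 (derive1 g) y| <= s * G2.
    by rewrite normrM gtr0_norm// ler_wpM2l ?(ltW s0).
  apply: (le_trans (ler_normD _ _)).
  have := ler_normB (s * (derive1 A (u y s) * derive1 g y)) (s * derive1 (derive1 g) y).
  by rewrite /C; lra.
have sg1 := smooth_derive sg; have su1 := smooth_derive su0.
move=> x t t01; split; first exact: u_le_M0.
have up : u x t <= u0 x + t * g x + C * t ^+ 2.
  apply: (@drift_comparison 1 B C M0 G0 u _ u0 _ _ g _ _ ds (smooth_dv su0) (smooth_dv su1)
      (smooth_dv sg) (smooth_dv sg1) u0M gG0 _ _ x t t01).
    by move=> y; rewrite uu0.
  move=> y s s01; apply: (residual_ge0 _ (step2 y s s01)).
  by rewrite mulr_ge0//; case/andP: s01 => /ltW.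
have lo : - u x t <= - u0 x + t * - g x + C * t ^+ 2.
  apply: (@drift_comparison 1 B C M0 G0 _ _ (fun x => - u0 x) _ _ (fun x => - g x) _ _
      (drift_solutionN ds) (Nd _ _ (smooth_dv su0)) (Nd _ _ (smooth_dv su1)) (Nd _ _ (smooth_dv
      sg)) (Nd _ _ (smooth_dv sg1)) _ _ _ _ x t t01).
  - by move=> y; rewrite normrN.
  - by move=> y; rewrite normrN.
  - by move=> y; rewrite uu0.
  move=> y s s01; apply: (residual_ge0N _ (step2 y s s01)).
  by rewrite mulr_ge0//; case/andP: s01 => /ltW.
rewrite ler_norml; apply/andP; split; lra.
Qed.

End ShortTime.

(** * Integrals of continuous functions over intervals *)

Section IntervalIntegral.
Context {R : realType}.
Local Notation mu := (@lebesgue_measure R).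
Implicit Types f g F : R -> R.

Definition itv_integral (a b : R) f : R := \int[mu]_(x in `[a, b]) f x.

Lemma itv_integrable a b f : continuous f -> mu.-integrable `[a, b] (EFin \o f).
Proof.
move=> cf; apply: continuous_compact_integrable; first exact: segment_compact.
exact: continuous_subspaceT.
Qed.

Lemma itv_integralE a b f : continuous f ->
  (\int[mu]_(x in `[a, b]) (f x)%:E = (itv_integral a b f)%:E)%E.
Proof.
by move=> cf; rewrite fineK// integrable_fin_num//; exact: itv_integrable.
Qed.

Lemma itv_integralD a b f g : continuous f -> continuous g ->
  itv_integral a b (fun x => f x + g x) = itv_integral a b f + itv_integral a b g.
Proof. by move=> cf cg; rewrite /itv_integral RintegralD//; exact: itv_integrable. Qed.

Lemma itv_integralZ a b c f : continuous f ->
  itv_integral a b (fun x => c * f x) = c * itv_integral a b f.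
Proof. by move=> cf; rewrite /itv_integral RintegralZl//; exact: itv_integrable. Qed.

Lemma itv_integral_le a b f g : continuous f -> continuous g ->
  (forall x, a <= x <= b -> f x <= g x) ->
  itv_integral a b f <= itv_integral a b g.
Proof.
move=> cf cg fg; by apply: le_Rintegral => //; exact: itv_integrable.
Qed.

Lemma itv_integral_ge0 a b f : (forall x, a <= x <= b -> 0 <= f x) ->
  0 <= itv_integral a b f.
Proof.
by move=> f0; apply: Rintegral_ge0 => x /=; rewrite in_itv; exact: f0.
Qed.

Lemma eq_itv_integral a b f g : (forall x, a <= x <= b -> f x = g x) ->
  itv_integral a b f = itv_integral a b g.
Proof.
by move=> fg; apply: eq_Rintegral => x; rewrite inE /= in_itv; exact: fg.
Qed.

Lemma itv_integral_FTC a b f F : a <= b -> continuous f ->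
  (forall x : R, is_derive x 1 F (f x)) -> itv_integral a b f = F b - F a.
Proof.
move=> ab cf dF; move: ab; rewrite le_eqVlt => /predU1P[->|ab].
  by rewrite /itv_integral set_itv1 Rintegral_set1 subrr.
have cF : continuous F by move=> x; exact: dv_continuous (dF x).
apply: EFin_inj; rewrite -itv_integralE// (@continuous_FTC2 _ f F)//.
- exact: continuous_subspaceT.
- split.
  + by move=> x _; have [] := dF x.
  + by apply: cvg_at_right_filter; exact: cF.
  + by apply: cvg_at_left_filter; exact: cF.
- by move=> x _; exact: dvE (dF x).
Qed.

Lemma itv_integral_split a b c f : a <= b -> b <= c -> continuous f ->
  itv_integral a c f = itv_integral a b f + itv_integral b c f.
Proof.
move=> ab bc cf; have := @Rintegral_itvB R f (BLeft a) (BRight c) b (itv_integrable _ _ cf).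
rewrite !bnd_simp => /(_ ab bc).
rewrite Rintegral_itv_obnd_cbnd; last first.
  apply: integrableS (itv_integrable b c cf) => //.
  by apply: subset_itvr; rewrite bnd_simp.
by rewrite /itv_integral => <-; rewrite addrC subrK.
Qed.

Lemma itv_integral_cst a b (c : R) : a <= b ->
  itv_integral a b (fun=> c) = c * (b - a).
Proof.
move=> ab.
have dF (x : R) : is_derive x 1 (fun x => c * x) c by dv; ring.
rewrite (itv_integral_FTC ab _ dF) ?mulrBr//; exact: cst_continuous.
Qed.

Lemma line_integral_ge a b f : continuous f -> (forall x, 0 <= f x) ->
  ((itv_integral a b f)%:E <= \int[mu]_x (f x)%:E)%E.
Proof.
move=> cf f0; rewrite -itv_integralE//; apply: ge0_subset_integral => //.
- by apply/measurable_EFinP; exact: continuous_measurable_fun.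
- by move=> x _; rewrite lee_fin.
Qed.

Lemma line_integral_compact a b f : continuous f ->
  (forall x, ~~ (a <= x <= b) -> f x = 0) ->
  (\int[mu]_x (f x)%:E = (itv_integral a b f)%:E)%E.
Proof.
move=> cf f0; rewrite -itv_integralE// [RHS]integral_mkcond.
apply: eq_integral => x _; rewrite patchE; case: ifPn => //.
by rewrite notin_setE /= in_itv /= => /negP /f0 ->.
Qed.

End IntervalIntegral.

(** * Convex fluxes and viscous shocks *)

Section Convexity.
Context {R : realType} (A : R -> R).
Context (A_smooth : smooth A) (A_convex : strictly_convex A).

(** If A(y) lay below the tangent at x, the difference between A and the chord
    from x to y would be increasing at x, hence positive just after it. *)
Lemma convex_tangent (x y : R) : A x + derive1 A x * (y - x) <= A y.
Proof.
have [->|xy] := eqVneq x y; first by rewrite subrr mulr0 addr0.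
have := smooth_dv A_smooth x; move: (derive1 A x) => d dA.
pose g s := A (x + s * (y - x)) - s * (A y - A x).
have dg : is_derive (0 : R) 1 g (d * (y - x) - (A y - A x)).
  have h1 : is_derive (0 : R) 1 (fun s : R => x + s * (y - x)) (y - x) by dv; ring.
  have h2 : is_derive (x + 0 * (y - x)) 1 A d by rewrite mul0r addr0.
  have h3 := dv_comp (g := fun s : R => x + s * (y - x)) h2 h1.
  by rewrite /g; dv; ring.
rewrite addrC -lerBrDr -subr_le0 leNgt; apply/negP => d0.
have [e e0 he] := dv_gt0_incr_right dg d0.
pose s := Num.min (e / 2) 2^-1.
have s0 : 0 < s by rewrite lt_min; apply/andP; split; lra.
have se : s <= e / 2 by rewrite ge_min lexx.
have s1 : s <= 2^-1 by rewrite ge_min lexx orbT.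
have s01 : 0 < s < 1 by apply/andP; split; lra.
have H : g 0 < g s by rewrite -[s]add0r; apply: he; apply/andP; split; lra.
have := A_convex (x := y) (y := x) (t := s); rewrite eq_sym xy s01 => /(_ isT isT).
move: H; rewrite /g !mul0r addr0 subr0.
have -> : s * y + (1 - s) * x = x + s * (y - x) by ring.
by move: (A _) (A x) (A y) => a1 a2 a3; lra.
Qed.

Lemma convex_derive_le (x y : R) : x <= y -> derive1 A x <= derive1 A y.
Proof.
rewrite le_eqVlt => /predU1P[->//|xy].
have := convex_tangent x y; have := convex_tangent y x.
move: (A _) (A y) (derive1 A _) (derive1 A y) => a1 a2 d1 d2.
by move=> h1 h2; rewrite -(ler_pM2r (x := y - x)) ?subr_gt0//; lra.
Qed.

Lemma convex_derive2_ge0 (x : R) : 0 <= derive1 (derive1 A) x.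
Proof.
apply: (max_first_derivative (smooth_dv (smooth_derive A_smooth) x)) => y.
exact: convex_derive_le.
Qed.

Context (A'0 : derive1 A 0 = 0).

Lemma convex_min (x : R) : A 0 <= A x.
Proof. by have := convex_tangent 0 x; rewrite A'0 mul0r addr0. Qed.

Lemma convex_min_strict (x : R) : x != 0 -> A 0 < A x.
Proof.
move=> x0; have h01 : 0 < (2^-1 : R) < 1 by apply/andP; split; lra.
have := A_convex x0 h01; rewrite mulr0 addr0.
have := convex_min (2^-1 * x); have := convex_min x.
by move: (A _) (A x) (A 0) => a1 a2 a3; lra.
Qed.

End Convexity.

Section Shock.
Context {R : realType} (A : R -> R).
Context (A_smooth : smooth A) (A_convex : strictly_convex A).
Context (A'0 : derive1 A 0 = 0).
Context (K : R) (K0 : 0 < K) (S : R -> R) (S_shock : viscous_shock A 0 (- K) S).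

(** Minus the slope of the chord of the flux over [-K, 0]: the shock moves to the
    left at this speed. *)
Definition leftward_speed (A : R -> R) (K : R) : R := (A (- K) - A 0) / K.

Local Notation b := (leftward_speed A K).

Lemma leftward_speedK : b * K = A (- K) - A 0.
Proof. by rewrite /leftward_speed divfK// gt_eqF. Qed.

Lemma leftward_speed_gt0 : 0 < b.
Proof.
by rewrite divr_gt0// subr_gt0 convex_min_strict// oppr_eq0 gt_eqF.
Qed.

Lemma shock_smooth : smooth S. Proof. by case: S_shock. Qed.

Lemma shock_dv (x : R) : is_derive x 1 S (derive1 S x).
Proof. exact: smooth_dv shock_smooth x. Qed.

Lemma flux_shock_dv (x : R) :
  is_derive x 1 (fun x => A (S x)) (derive1 A (S x) * derive1 S x).
Proof. exact: dv_comp (smooth_dv A_smooth _) (shock_dv x). Qed.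

(** Otherwise f would vary by more than 2 over intervals of length 8/|l|
    arbitrarily close to -oo, where it stays within 1 of its limit. *)
Lemma derivative_limit0 (f f1 : R -> R) (l m : R) :
  (forall x : R, is_derive x 1 f (f1 x)) ->
  f x @[x --> -oo] --> m -> f1 x @[x --> -oo] --> l -> l = 0.
Proof.
move=> df fm f1l; apply/eqP/negPn/negP => l0.
have l2 : 0 < `|l| / 2 by rewrite divr_gt0 ?normr_gt0.
have : \forall x \near -oo, `|m - f x| < 1 /\ `|l - f1 x| < `|l| / 2.
  near=> x; split; near: x.
    by move/cvgrPdist_lt: fm; apply.
  by move/cvgrPdist_lt: f1l; apply.
case=> N [_ hN].
pose y := N - 1; pose x := y - 8 / `|l|.
have xy : x < y by rewrite /x gtrBl divr_gt0 ?normr_gt0.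
have [|hx _] := hN x; first by rewrite (lt_trans xy)// /y ltrBlDr ltrDl.
have [|hy _] := hN y; first by rewrite /y ltrBlDr ltrDl.
have [c /andP[xc cy] E] := mean_value df xy.
have [|_ hc] := hN c; first by rewrite (lt_trans cy)// /y ltrBlDr ltrDl.
have : `|f y - f x| < 2.
  have -> : f y - f x = (m - f x) - (m - f y) by ring.
  by apply: (le_lt_trans (ler_normB _ _)); lra.
rewrite E normrM.
have -> : `|y - x| = 8 / `|l|.
  by rewrite /x opprB addrCA subrr addr0 ger0_norm// divr_ge0.
have hc' : `|l| / 2 < `|f1 c|.
  have := ler_normD (l - f1 c) (f1 c); rewrite subrK.
  by move: hc; move: (`|l - _|) (`|f1 c|) (`|l|) => ? ? ?; lra.
have n0 : 0 < `|l| by rewrite normr_gt0.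
rewrite mulrA ltr_pdivrMr//; lra.
Unshelve. all: by end_near. Qed.

(** The profile equation, integrated once; the constant is read off at -oo. *)
Lemma shock_ode (x : R) : derive1 S x = A (S x) - A 0 + b * S x.
Proof.
have [sS Sm _ ode] := S_shock.
pose h z := derive1 S z - A (S z) - b * S z.
have dS := shock_dv; have dA := flux_shock_dv.
have dS1 := smooth_dv (smooth_derive sS).
have dh (z : R) : is_derive z 1 h 0.
  have := ode z; rewrite /shock_speed subr0 invrN mulrN opprK -/(leftward_speed A K).
  rewrite (_ : derive1 (A \o S) z = derive1 A (S z) * derive1 S z); last exact: dvE (dA z).
  rewrite (_ : derive1n 2 S z = derive1 (derive1 S) z)//.
  rewrite /h => E; dv; rewrite -E.
  by move: (derive1 S z) (derive1 A _) b => ? ? ?; ring.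
pose c := h 0.
have hc z : derive1 S z = A (S z) + b * S z + c.
  have := is_derive_0_is_cst (f := h) z 0 dh.
  by rewrite -/c /h; move: (derive1 S z) (A _) => ? ? <-; ring.
have Sl : derive1 S z @[z --> -oo] --> A 0 + b * 0 + c.
  rewrite (_ : derive1 S = fun z => A (S z) + b * S z + c); last first.
    by apply/funext => z; exact: hc.
  apply: cvgD; last exact: cvg_cst.
  apply: cvgD; last by apply: cvgM => //; exact: cvg_cst.
  by apply: (@continuous_cvg _ _ _ _ _ _ A) => //; exact: smooth_continuous.
have := derivative_limit0 dS Sm Sl.
by rewrite hc mulr0 addr0 => /eqP; rewrite addrC addr_eq0 => /eqP ->; ring.
Qed.

(** Gronwall's inequality in differential form. *)
Lemma exp_weighted_ndecr (f f1 : R -> R) (m : R) :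
  (forall x : R, is_derive x 1 f (f1 x)) -> (forall x, m * f x <= f1 x) ->
  forall x y, x <= y -> f x * expR (- m * x) <= f y * expR (- m * y).
Proof.
move=> df fm x y; rewrite le_eqVlt => /predU1P[->//|xy].
have dg (z : R) : is_derive z 1 (fun z => f z * expR (- m * z))
    ((f1 z - m * f z) * expR (- m * z)).
  by dv; ring.
have [c _ E] := mean_value dg xy.
by rewrite -subr_ge0 E !mulr_ge0 ?subr_ge0 ?(ltW xy)// expR_ge0.
Qed.

(** S exp(-b x) is nondecreasing because A is minimal at 0: once nonnegative, S
    would stay so, against its limit at +oo. *)
Lemma shock_lt0 (x : R) : S x < 0.
Proof.
rewrite ltNge; apply/negP => Sx.
have [_ _ Sp _] := S_shock.
have H := exp_weighted_ndecr (m := b) shock_dv _.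
have {}H z y : z <= y -> S z * expR (- b * z) <= S y * expR (- b * y).
  apply: H => w; rewrite shock_ode lerDr subr_ge0; exact: convex_min.
have : \forall y \near +oo, S y < 0.
  by move/cvgr_lt: Sp; apply; rewrite oppr_lt0.
case=> N [_ hN]; pose y := Num.max (N + 1) x.
have Ny : N < y by rewrite lt_max; apply/orP; left; lra.
have xy : x <= y by rewrite le_max lexx orbT.
have := H _ _ xy; rewrite leNgt => /negP; apply.
rewrite (@lt_le_trans _ _ 0)//; first by rewrite nmulr_rlt0 ?expR_gt0 ?hN.
by rewrite mulr_ge0 ?expR_ge0.
Qed.

(** The tangent to A at -K gives m such that (S + K) exp(-m x) is nondecreasing:
    if S + K were nonpositive at x, it would be so at all points to the left. *)
Lemma shock_gtNK (x : R) : - K < S x.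
Proof.
rewrite ltNge; apply/negP => Sx.
have [_ Sm _ _] := S_shock.
have dS := shock_dv.
have dSK (z : R) : is_derive z 1 (fun z => S z + K) (derive1 S z) by dv; ring.
have H := exp_weighted_ndecr (m := b + derive1 A (- K)) dSK _.
have {}H z y : z <= y -> (S z + K) * expR (- (b + derive1 A (- K)) * z) <=
     (S y + K) * expR (- (b + derive1 A (- K)) * y).
  apply: H => w; rewrite shock_ode.
  have := convex_tangent A_smooth A_convex (- K) (S w); rewrite opprK.
  have := leftward_speedK; move: (derive1 A _) b (A _) (A (S w)) (A 0) => d1 b1 a1 a2 a3;
      rewrite !mulrDl !mulrDr => -> h; lra.
have : \forall y \near -oo, - K < S y.
  by move/cvgr_gt: Sm; apply; rewrite oppr_lt0.
case=> N [_ hN]; pose y := Num.min (N - 1) x.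
have Ny : y < N by rewrite gt_min; apply/orP; left; lra.
have yx : y <= x by rewrite ge_min lexx orbT.
have := H _ _ yx; rewrite leNgt => /negP; apply.
rewrite (@le_lt_trans _ _ 0)//; first by rewrite pmulr_lle0 ?expR_gt0//; lra.
by rewrite mulr_gt0 ?expR_gt0//; have := hN _ Ny; lra.
Qed.

(** S lies in ]-K, 0[, where the graph of A is strictly below its chord. *)
Lemma shock_derive_lt0 (x : R) : derive1 S x < 0.
Proof.
rewrite shock_ode.
have S0 := shock_lt0 x; have SK := shock_gtNK x.
have t01 : 0 < - S x / K < 1.
  by rewrite divr_gt0 ?oppr_gt0//= ltr_pdivrMr// mul1r ltrNl.
have nK : - K != 0 :> R by rewrite oppr_eq0 gt_eqF.
have := A_convex nK t01; rewrite mulr0 addr0.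
have -> : - S x / K * - K = S x by rewrite mulNr mulrNN divfK// gt_eqF.
rewrite /leftward_speed; have -> : (A (- K) - A 0) / K * S x = - (- S x / K) * (A (- K) - A 0).
  by ring.
by move: (A _) (A _) (A 0) (- S x / K) => ? ? ? ?; lra.
Qed.

Lemma shock_decr (x y : R) : x < y -> S y < S x.
Proof.
move=> xy; have [c _ E] := mean_value shock_dv xy.
by rewrite -subr_lt0 E nmulr_rlt0 ?shock_derive_lt0 ?subr_gt0.
Qed.

Lemma shock_derive2 (x : R) :
  is_derive x 1 (derive1 S) ((derive1 A (S x) + b) * derive1 S x).
Proof.
have -> : derive1 S = fun x => A (S x) - A 0 + b * S x.
  by apply/funext => z; exact: shock_ode.
have dS := shock_dv x; have dA := flux_shock_dv x.
dv; rewrite -shock_ode; move: (derive1 S x) (derive1 A _) => ? ?; ring.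
Qed.

(** The profile equation expresses the derivatives of S as continuous functions
    of S, which stays in a compact interval. *)
Lemma shock_derivatives_bounded : exists C,
  [/\ forall x, `|derive1 S x| <= C,
      forall x, `|derive1 (derive1 S) x| <= C &
      forall x, `|derive1 (derive1 (derive1 S)) x| <= C].
Proof.
have sA1 := smooth_derive A_smooth; have sA2 := smooth_derive sA1.
have Sin x : - K <= S x <= 0 by rewrite !ltW ?shock_lt0 ?shock_gtNK.
have [B0 B00 hB0] := continuous_itv_bounded (smooth_continuous A_smooth) (- K) 0.
have [B1 B10 hB1] := continuous_itv_bounded (smooth_continuous sA1) (- K) 0.
have [B2 B20 hB2] := continuous_itv_bounded (smooth_continuous sA2) (- K) 0.
have b0 := ltW leftward_speed_gt0.
pose C1 := B0 + `|A 0| + b * K; pose C2 := (B1 + b) * C1.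
pose C3 := B2 * C1 * C1 + (B1 + b) * C2.
have h1 x : `|derive1 S x| <= C1.
  rewrite shock_ode (le_trans (ler_normD _ _))// lerD//.
    by rewrite (le_trans (ler_normB _ _))// lerD// hB0.
  rewrite normrM ger0_norm// ler_wpM2l// ler_norml.
  by have /andP[? ?] := Sin x; apply/andP; split; lra.
have C10 : 0 <= C1 by apply: le_trans (h1 0).
have hAb x : `|derive1 A (S x) + b| <= B1 + b.
  by rewrite (le_trans (ler_normD _ _))// (ger0_norm b0) lerD2r hB1.
have dS2 := shock_derive2.
have E2 : derive1 (derive1 S) = fun x => (derive1 A (S x) + b) * derive1 S x.
  by apply/funext => x; exact: dvE (dS2 x).
have h2 x : `|derive1 (derive1 S) x| <= C2 by rewrite E2 normrM ler_pM.
have C20 : 0 <= C2 by apply: le_trans (h2 0).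
have dA1 (x : R) := dv_comp (smooth_dv sA1 (S x)) (shock_dv x).
have dS3 (x : R) : is_derive x 1 (derive1 (derive1 S))
    (derive1 (derive1 A) (S x) * derive1 S x * derive1 S x +
     (derive1 A (S x) + b) * derive1 (derive1 S) x).
  rewrite E2; dv.
  by move: (derive1 (derive1 A) (S x)) (derive1 S x) (derive1 A (S x)) => p q r; ring.
have h3 x : `|derive1 (derive1 (derive1 S)) x| <= C3.
  rewrite (dvE (dS3 x)) (le_trans (ler_normD _ _))// lerD//.
    by rewrite !normrM !ler_pM ?mulr_ge0// hB2.
  by rewrite normrM ler_pM.
exists (C1 + C2 + C3).
have C30 : 0 <= C3 by apply: le_trans (h3 0).
split=> x.
- by apply: (le_trans (h1 x)); rewrite -addrA lerDl addr_ge0.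
- by apply: (le_trans (h2 x)); rewrite addrAC lerDr addr_ge0.
- by apply: (le_trans (h3 x)); rewrite lerDr addr_ge0.
Qed.

End Shock.

(** * Choice of the end state *)

Section SuperpolynomialGrowth.
Context {R : realType} (A : R -> R).
Context (A_smooth : smooth A) (A_convex : strictly_convex A).
Context (A'0 : derive1 A 0 = 0).

(** If K |A'(-K)| < N (A(-K) - A(0)) held for all large K, then in the variable
    ln K Gronwall's inequality would give A(-K) - A(0) = O(K^N), hence a
    polynomial lower bound for A' on the negative half-line. *)
Lemma derive_dominates_speed :
  (forall P : {poly R}, exists x : R, x <= 0 /\ P.[x] > derive1 A x) ->
  forall (N : nat) (L : R), exists K, [/\ 0 < K, L <= K &
    N%:R * leftward_speed A K <= - derive1 A (- K)].
Proof.
move=> superpoly N L; apply: contrapT => noK.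
pose L1 := Num.max L 1.
have L11 : 1 <= L1 by rewrite le_max lexx orbT.
have L1L : L <= L1 by rewrite le_max lexx.
have lt_speed K : L1 <= K -> - derive1 A (- K) < N%:R * leftward_speed A K.
  move=> LK; rewrite ltNge; apply/negP => H; apply: noK; exists K.
  by split=> //; [lra|exact: le_trans LK].
pose f K := A (- K) - A 0.
have f0 K : 0 <= f K by rewrite subr_ge0 convex_min.
have lt_f K : L1 <= K -> K * - derive1 A (- K) <= N%:R * f K.
  move=> LK; have K0 : 0 < K by lra.
  apply/ltW; rewrite mulrC -ltr_pdivlMr// -mulrA; exact: lt_speed.
pose s0 := ln L1.
pose F s := f (expR s).
have dF (s : R) : is_derive s 1 F (expR s * - derive1 A (- expR s)).
  have h1 : is_derive s 1 (fun s : R => - expR s) (- expR s) by dv; ring.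
  have h2 := dv_comp (g := fun s : R => - expR s) (smooth_dv A_smooth (- expR s)) h1.
  by rewrite /F /f; dv; ring.
pose C := F s0 * expR (- N%:R * s0).
have C0 : 0 <= C by rewrite mulr_ge0 ?expR_ge0// f0.
have Fle s : s0 <= s -> F s * expR (- N%:R * s) <= C.
  rewrite le_eqVlt => /predU1P[<-//|ss].
  have dG (z : R) : is_derive z 1 (fun z => F z * expR (- N%:R * z))
    ((expR z * - derive1 A (- expR z) - N%:R * F z) * expR (- N%:R * z)).
    by dv; move: (derive1 A _) (F z) => d1 Fz; ring.
  have [c /andP[c1 _] E] := mean_value dG ss.
  rewrite -subr_le0 E !mulr_le0_ge0 ?subr_ge0 ?(ltW ss) ?expR_ge0//.
  rewrite subr_le0; apply: lt_f.
  have -> : L1 = expR s0 by rewrite lnK// posrE; lra.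
  by rewrite ler_expR ltW.
have fle K : L1 <= K -> f K <= C * K ^+ N.
  move=> LK; have K0 : 0 < K by lra.
  have EK : expR (ln K) = K by rewrite lnK.
  have : s0 <= ln K by rewrite ler_ln ?posrE//; lra.
  move=> /Fle; rewrite /F EK mulNr expRN ler_pdivrMr ?expR_gt0//.
  by rewrite [_%:R * _]mulrC expRM_natr EK.
pose M := `|derive1 A (- L1)|.
have A'le K : 0 <= K -> - derive1 A (- K) <= N%:R * C * (K ^+ 2 + 1) ^+ N + M.
  move=> K0; have K1 : 0 <= K ^+ 2 by exact: sqr_ge0.
  have P0 : 0 <= N%:R * C * (K ^+ 2 + 1) ^+ N.
    by apply: mulr_ge0; [exact: mulr_ge0|apply: exprn_ge0; lra].
  have [KL|LK] := leP K L1.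
    have h1 : derive1 A (- L1) <= derive1 A (- K).
      by apply: convex_derive_le => //; rewrite lerN2.
    have h2 := ler_norm (- derive1 A (- L1)); rewrite normrN -/M in h2.
    by move: h1 h2 P0; move: (derive1 _ _) (derive1 _ _) (_ * _ ^+ _) => ? ? ?; lra.
  have KN : K ^+ N <= (K ^+ 2 + 1) ^+ N.
    by rewrite lerXn2r ?nnegrE//; [lra|nra].
  have h : - derive1 A (- K) <= N%:R * f K.
    have := lt_f K (ltW LK); apply: le_trans.
    rewrite ler_peMl//; last lra.
    rewrite oppr_ge0 -A'0; apply: convex_derive_le => //; lra.
  apply: (le_trans h); rewrite -[leLHS]addr0 lerD ?normr_ge0//.
  rewrite -mulrA ler_wpM2l// (le_trans (fle K (ltW LK)))//.
  by rewrite ler_wpM2l.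
pose P : {poly R} := - ((N%:R * C) *: (('X^2 + 1) ^+ N) + M%:P).
have [x [x0]] := superpoly P.
have := A'le (- x); rewrite oppr_ge0 opprK sqrrN => /(_ x0).
rewrite /P !hornerE => h; rewrite ltNge => /negP; apply.
by rewrite lerNl.
Qed.

End SuperpolynomialGrowth.

(** * The quadratic form at the shock *)

Section ConstantSide.
Context {R : realType}.
Implicit Types f : R -> R.

Lemma derive0_right f f1 (c k : R) : (forall x : R, is_derive x 1 f (f1 x)) ->
  (forall x, c <= x -> f x = k) -> forall x, c <= x -> f1 x = 0.
Proof.
move=> df fk x cx; have [n0|p0|//] := ltgtP (f1 x) 0; exfalso.
- have dNf := dvN (df x).
  have [|e e0 he] := dv_gt0_incr_right dNf; first by rewrite oppr_gt0.
  have : - f x < - f (x + e / 2) by apply: he; lra.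
  by rewrite !fk ?ltxx//; lra.
- have [e e0 he] := dv_gt0_incr_right (df x) p0.
  have : f x < f (x + e / 2) by apply: he; lra.
  by rewrite !fk ?ltxx//; lra.
Qed.

Lemma derive0_left f f1 (c k : R) : (forall x : R, is_derive x 1 f (f1 x)) ->
  (forall x, x <= c -> f x = k) -> forall x, x <= c -> f1 x = 0.
Proof.
move=> df fk x xc.
have dg (z : R) : is_derive z 1 (fun z => f (- z)) (- f1 (- z)).
  by have := dv_rev (df (- z)); rewrite opprK.
apply/eqP; rewrite -oppr_eq0; apply/eqP.
rewrite -[x]opprK; apply: (derive0_right (c := - c) (k := k) dg); last by rewrite lerN2.
by move=> z cz; apply: fk; rewrite lerNl.
Qed.

Lemma smooth_step_derivatives : exists h : R -> R,
  [/\ smooth h, forall x, 0 <= h x <= 1, forall x, 0 <= derive1 h x,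
      forall x, x <= 0 -> [/\ h x = 0, derive1 h x = 0 & derive1 (derive1 h) x = 0] &
      forall x, 1 <= x -> [/\ h x = 1, derive1 h x = 0 & derive1 (derive1 h) x = 0]].
Proof.
have [h [sh h01 h0 h1 h'0]] := @smooth_step R.
have d1 := smooth_dv sh; have d2 := smooth_dv (smooth_derive sh).
have l1 := derive0_left d1 h0; have r1 := derive0_right d1 h1.
have l2 := derive0_left d2 l1; have r2 := derive0_right d2 r1.
by exists h; split=> // x hx; split; [exact: h0|exact: l1|exact: l2|exact: h1|exact: r1|exact:
    r2].
Qed.

End ConstantSide.

Section Profile.
Context {R : realType}.

(** The shock in the rescaled variable y = (u_- - S)/(u_- - u_+), with
    p = y', and with beta = -A'(S), which grows from 0 to M = -A'(u_+); b is
    the opposite of the shock speed. *)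
Record wave_profile (b M : R) (y p beta beta1 : R -> R) : Prop := WaveProfile {
  profile_b_gt0 : 0 < b;
  profile_smooth : smooth y;
  profile_y01 : forall x, 0 < y x < 1;
  profile_dy : forall x : R, is_derive x 1 y (p x);
  profile_dp : forall x : R, is_derive x 1 p ((b - beta x) * p x);
  profile_dbeta : forall x : R, is_derive x 1 beta (beta1 x);
  profile_p : forall x, 0 < p x <= b;
  profile_beta : forall x, 0 <= beta x <= M;
  profile_beta1 : forall x, 0 <= beta1 x;
  profile_beta1_continuous : continuous beta1;
  profile_beta_le : forall x, beta x * (1 - y x) <= b;
  profile_y_Ny : y x @[x --> -oo] --> (0 : R);
  profile_y_y : y x @[x --> +oo] --> (1 : R);
  profile_beta_y : beta x @[x --> +oo] --> M }.

(** The density of the quadratic form w |-> int a w (L w), where L is the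
    linearization of the equation at the shock, in the moving frame. *)
Definition energy (b : R) (a beta beta1 w : R -> R) (x : R) : R :=
  a x * w x * (derive1 (derive1 w) x + (beta x - b) * derive1 w x + beta1 x * w x).

Context (b M : R) (y p beta beta1 : R -> R).
Context (prof : wave_profile b M y p beta beta1).

Lemma profile_incr (x z : R) : x < z -> y x < y z.
Proof.
move=> xz; have [c _ E] := mean_value (profile_dy prof) xz.
rewrite -subr_gt0 E mulr_gt0 ?subr_gt0//.
by have /andP[] := profile_p prof c.
Qed.

Lemma profile_ndecr (x z : R) : x <= z -> y x <= y z.
Proof. by rewrite le_eqVlt => /predU1P[->//|/profile_incr/ltW]. Qed.

Lemma profile_lt (x z : R) : y x < y z -> x < z.
Proof. by rewrite !ltNge; apply: contra => /profile_ndecr. Qed.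

Lemma profile_level (s : R) : 0 < s < 1 -> exists x, y x = s.
Proof.
move=> /andP[s0 s1].
have : \forall x \near -oo, y x < s.
  by move/cvgr_lt: (profile_y_Ny prof); apply.
case=> N1 [_ hN1].
have : \forall x \near +oo, s < y x.
  by move/cvgr_gt: (profile_y_y prof); apply.
case=> N2 [_ hN2].
have h1 : y (N1 - 1) < s by apply: hN1; lra.
have h2 : s < y (N2 + 1) by apply: hN2; lra.
have h12 : N1 - 1 <= N2 + 1 by apply/ltW/profile_lt; exact: lt_trans h1 h2.
have [||x _ E] := @IVT R y (N1 - 1) (N2 + 1) s h12.
- by apply: continuous_subspaceT => x; exact: dv_continuous (profile_dy prof x).
- rewrite min_l ?max_r ?(ltW (lt_trans h1 h2))//.
  by rewrite !ltW.
- by exists x.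
Qed.

Context (a : R -> R) (am aM : R).
Context (a_continuous : continuous a) (am_gt0 : 0 < am).
Context (a_bounds : forall x, am <= a x <= aM).

Lemma energy_continuous (w : R -> R) : smooth w ->
  continuous (energy b a beta beta1 w).
Proof.
move=> sw x; apply: cvgM; first apply: cvgM.
- exact: a_continuous.
- exact: smooth_continuous.
- apply: cvgD; first apply: cvgD.
  + exact: smooth_continuous (smooth_derive (smooth_derive sw)) x.
  + apply: cvgM; last exact: smooth_continuous (smooth_derive sw) x.
    by apply: cvgB; [exact: dv_continuous (profile_dbeta prof x)|exact: cvg_cst].
  + apply: cvgM; first exact: profile_beta1_continuous prof x.
    exact: smooth_continuous.
Qed.

Lemma profile_p_continuous : continuous p.
Proof. by move=> x; exact: dv_continuous (profile_dp prof x). Qed.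

Lemma itv_integral_p (l r : R) : l <= r -> itv_integral l r p = y r - y l.
Proof.
by move=> lr; rewrite (itv_integral_FTC lr profile_p_continuous (profile_dy prof)).
Qed.

(** The first-order terms cancel because y'' = (b - beta) y'. *)
Lemma derive_profile_comp (f : R -> R) : smooth f ->
  (forall x, derive1 (fun x => f (y x)) x = derive1 f (y x) * p x) /\
  (forall x, derive1 (derive1 (fun x => f (y x))) x + (beta x - b) * (derive1 f (y x) * p x)
     = derive1 (derive1 f) (y x) * p x ^+ 2).
Proof.
move=> sf.
have d1 (x : R) := dv_comp (smooth_dv sf (y x)) (profile_dy prof x).
have E1 : derive1 (fun x => f (y x)) = fun x => derive1 f (y x) * p x.
  by apply/funext => x; exact: dvE.
split=> x; first by rewrite E1.
have h1 := dv_comp (smooth_dv (smooth_derive sf) (y x)) (profile_dy prof x).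
have h2 := profile_dp prof x.
rewrite E1 (dvE (dvM h1 h2)).
by move: (derive1 f _) (derive1 _ _) => d e; ring.
Qed.

(** The density is a f f''(y) p^2 + a beta' f^2; the second term is nonnegative,
    and in the first one p^2 <= b p, so that its integral is at most of order
    b int y' <= b. *)
Lemma energy_comp_ge (f : R -> R) (C : R) : smooth f ->
  (forall s, 0 <= s <= 1 -> `|f s * derive1 (derive1 f) s| <= C) ->
  forall x, - (aM * C * b) * p x <= energy b a beta beta1 (fun x => f (y x)) x.
Proof.
move=> sf fC x; have [E1 E2] := derive_profile_comp sf.
rewrite /energy E1 E2.
have /andP[y0 y1] := profile_y01 prof x.
have /andP[p0 pb] := profile_p prof x.
have /andP[a0 a1] := a_bounds x.
have ax0 : 0 <= a x by apply: le_trans a0; exact: ltW.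
have aM0 : 0 <= aM by exact: le_trans a1.
have b1 := profile_beta1 prof x.
have := fC (y x); rewrite (ltW y0) (ltW y1) => /(_ isT) {}fC.
have C0 : 0 <= C by apply: le_trans fC.
move: fC; move: (f (y x)) (derive1 (derive1 f) (y x)) => c d cd.
rewrite [leRHS](_ : _ = a x * (c * d) * p x * p x + a x * beta1 x * c ^+ 2); last by ring.
have h1 : 0 <= a x * beta1 x * c ^+ 2.
  apply: mulr_ge0; last exact: sqr_ge0.
  by apply: mulr_ge0.
have h2 : - (aM * C) <= a x * (c * d).
  have : `|a x * (c * d)| <= aM * C.
    by rewrite normrM ler_pM// ger0_norm.
  by rewrite ler_norml => /andP[].
have h3 : - (aM * C) * b <= a x * (c * d) * p x.
  have : - (aM * C) * p x <= a x * (c * d) * p x by rewrite ler_pM2r.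
  apply: le_trans; by rewrite ler_wnM2l// oppr_le0 mulr_ge0.
have h4 : - (aM * C) * b * p x <= a x * (c * d) * p x * p x by rewrite ler_pM2r.
by rewrite -mulNr; lra.
Qed.

End Profile.

Section EndLayer.
Context {R : realType} (b M : R) (y p beta beta1 : R -> R).
Context (prof : wave_profile b M y p beta beta1).
Context (a : R -> R) (am aM : R).
Context (a_continuous : continuous a) (am_gt0 : 0 < am).
Context (a_bounds : forall x, am <= a x <= aM).
Context (d alo ahi : R) (d_gt0 : 0 < d) (d_lt : 2 * d < 1) (alo_ge0 : 0 <= alo).
Context (a_end : forall x, 1 - 2 * d <= y x -> alo <= a x <= ahi).
Context (phi : R -> R) (C : R) (phi_smooth : smooth phi).
Context (phi01 : forall s, 0 <= phi s <= 1).
Context (phi_left : forall s, s <= 1 - 2 * d ->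
  [/\ phi s = 0, derive1 phi s = 0 & derive1 (derive1 phi) s = 0]).
Context (phi_right : forall s, 1 - d <= s ->
  [/\ phi s = 1, derive1 phi s = 0 & derive1 (derive1 phi) s = 0]).
Context (phi_C : forall s, 0 <= s <= 1 -> `|phi s * derive1 (derive1 phi) s| <= C).

Let a_ge0 x : 0 <= a x.
Proof. by have /andP[+ _] := a_bounds x; apply: le_trans; exact: ltW. Qed.

Let aM_ge0 : 0 <= aM.
Proof. by have /andP[_] := a_bounds 0; apply: le_trans. Qed.

(** The duration T is chosen before the starting point x2, so that the cost of
    the second derivative, at most T times e / T, is fixed in advance. *)
Lemma slow_cutoff (e : R) : 0 < e -> exists2 T, 0 < T & forall x2 : R,
  exists chi, [/\ smooth chi, forall x, 0 <= chi x <= 1,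
    forall x, derive1 chi x <= 0,
    forall x, x <= x2 -> [/\ chi x = 1, derive1 chi x = 0 & derive1 (derive1 chi) x = 0] &
    (forall x, x2 + T <= x -> [/\ chi x = 0, derive1 chi x = 0 & derive1 (derive1 chi) x = 0]) /\
    (forall x, `|derive1 (derive1 chi) x| <= e / T)].
Proof.
move=> e0.
have [h [sh h01 h'0 hl hr]] := @smooth_step_derivatives R.
have sh2 := smooth_derive (smooth_derive sh).
have [H H0 hH] := continuous_itv_bounded (smooth_continuous sh2) 0 1.
have {}hH x : `|derive1 (derive1 h) x| <= H.
  have [x0|x0] := leP x 0; first by have [_ _ ->] := hl x x0; rewrite normr0.
  have [x1|x1] := leP 1 x; first by have [_ _ ->] := hr x x1; rewrite normr0.
  by apply: hH; rewrite !ltW.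
pose T := H / e + 1.
have T0 : 0 < T by rewrite ltr_wpDl// divr_ge0// ltW.
exists T => // x2.
pose k x := (x2 + T - x) / T.
have sk : smooth k.
  apply: smoothM; last exact: smooth_cst.
  by apply: smoothB; [exact: smooth_cst|exact: smooth_id].
have dk (x : R) : is_derive x 1 k (- T^-1).
  by rewrite /k; dv; ring.
have E1 : derive1 (fun x => h (k x)) = fun x => derive1 h (k x) * - T^-1.
  by apply/funext => x; exact: dvE (dv_comp (smooth_dv sh (k x)) (dk x)).
have E2 : derive1 (derive1 (fun x => h (k x))) = fun x => derive1 (derive1 h) (k x) * (T^-1 ^+ 2).
  rewrite E1; apply/funext => x.
  have h2 := dv_comp (smooth_dv (smooth_derive sh) (k x)) (dk x).
  rewrite (dvE (dvM h2 (dv_cst (- T^-1) x))).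
  by move: (derive1 (derive1 _) _) => z; ring.
exists (fun x => h (k x)); split.
- exact: smooth_comp.
- by move=> x.
- by move=> x; rewrite E1 mulrN oppr_le0 mulr_ge0// invr_ge0 ltW.
- move=> x xx2; rewrite E2 E1.
  have [|-> -> ->] := hr (k x); first by rewrite /k ler_pdivlMr// mul1r; lra.
  by rewrite !mul0r.
split.
- move=> x xx2; rewrite E2 E1.
  have [|-> -> ->] := hl (k x); first by rewrite /k pmulr_lle0 ?invr_gt0//; lra.
  by rewrite !mul0r.
- move=> x; have iT : 0 <= T^-1 by rewrite invr_ge0 ltW.
  rewrite E2 expr2 mulrA normrM [X in _ * X]ger0_norm// ler_wpM2r//.
  rewrite normrM [X in _ * X]ger0_norm// ler_pdivrMr//; apply: le_trans (hH _) _.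
  by rewrite /T mulrDr mulr1 mulrCA divff ?mulr1 ?gt_eqF// lerDl ltW.
Qed.

(** The growth of beta in the region where w = 1 is collected at the rate of
    the weight near the end state; truncating w at +oo costs only half of it,
    because there the form reduces to (beta - b) a w w' to leading order. *)
Lemma end_layer : exists w r0, [/\ smooth w,
  forall x, r0 <= `|x| -> w x = 0,
  forall x, 0 <= w x <= 1,
  forall x, y x <= 1 - 2 * d ->
    [/\ w x = 0, derive1 w x = 0 & derive1 (derive1 w) x = 0] &
  forall r, r0 <= r ->
    0 < itv_integral (- r) r (fun x => a x * w x * p x) /\
    alo * (M - b - b / d) - ahi * M / 2 - aM * b - aM * C * b <=
    itv_integral (- r) r (energy b a beta beta1 w)].
Proof.
have b0 := profile_b_gt0 prof; have d0 := d_gt0; have d2 := d_lt.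
have [T T0 cutoff] := slow_cutoff b0.
have [x1 yx1] : exists x, y x = 1 - d by apply: (profile_level prof); apply/andP; split; lra.
have [x0 yx0] : exists x, y x = 1 - 2 * d.
  by apply: (profile_level prof); apply/andP; split; lra.
have x01 : x0 < x1 by apply: (profile_lt prof); rewrite yx0 yx1; lra.
have [x2 x12 bx2] : exists2 x2, x1 < x2 & M - b <= beta x2.
  have : \forall x \near +oo, M - b < beta x.
    by move/cvgr_gt: (profile_beta_y prof); apply; lra.
  case=> N [_ hN]; exists (Num.max N x1 + 1).
    by rewrite (le_lt_trans (y := Num.max N x1)) ?le_max ?lexx ?orbT// ltrDl.
  apply/ltW/hN; rewrite (le_lt_trans (y := Num.max N x1)) ?le_max ?lexx ?orbT//.
  by rewrite ltrDl.
pose x3 := x2 + T.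
have x23 : x2 < x3 by rewrite /x3 ltrDl.
have [chi [schi chi01 chi'0 chil [chir chi2]]] := cutoff x2.
have [f'E f''E] := derive_profile_comp prof phi_smooth.
have fE x := energy_comp_ge prof am_gt0 a_bounds phi_smooth phi_C x.
have sf := smooth_comp phi_smooth (profile_smooth prof).
have [f fphi] : exists f, forall x, f x = phi (y x) by eexists.
have f_def : (fun x => phi (y x)) = f by apply/funext => x; rewrite fphi.
rewrite f_def in f'E f''E fE sf.
have [w wE] : exists w, forall x, w x = f x * chi x by eexists.
have w_def : w = fun x => f x * chi x by exact/funext.
have sw : smooth w by rewrite w_def; exact: smoothM.
have w'E x : derive1 w x = derive1 f x * chi x + f x * derive1 chi x.
  rewrite w_def; exact: dvE (dvM (smooth_dv sf x) (smooth_dv schi x)).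
have w''E x : derive1 (derive1 w) x = derive1 (derive1 f) x * chi x +
    derive1 f x * derive1 chi x + (derive1 f x * derive1 chi x + f x * derive1 (derive1 chi) x).
  rewrite (_ : derive1 w = fun x => derive1 f x * chi x + f x * derive1 chi x); last first.
    by apply/funext => z; exact: w'E.
  apply: dvE; apply: dvD.
    exact: (dvM (smooth_dv (smooth_derive sf) x) (smooth_dv schi x)).
  exact: (dvM (smooth_dv sf x) (smooth_dv (smooth_derive schi) x)).
have f_left x : y x <= 1 - 2 * d ->
    [/\ f x = 0, derive1 f x = 0 & derive1 (derive1 f) x = 0].
  move=> yx; have [E0 E1 E2] := phi_left yx.
  have F1 : derive1 f x = 0 by rewrite f'E E1 mul0r.
  have := f''E x; rewrite E1 E2 !mul0r mulr0 addr0 => F2.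
  by rewrite fphi E0.
have f_right x : x1 <= x -> [/\ f x = 1, derive1 f x = 0 & derive1 (derive1 f) x = 0].
  move=> xx1; have : 1 - d <= y x by rewrite -yx1; exact: (profile_ndecr prof xx1).
  move=> /phi_right[E0 E1 E2].
  have F1 : derive1 f x = 0 by rewrite f'E E1 mul0r.
  have := f''E x; rewrite E1 E2 !mul0r mulr0 addr0 => F2.
  by rewrite fphi E0.
have w01 x : 0 <= w x <= 1.
  have /andP[c0 c1] := chi01 x; have := phi01 (y x); rewrite -fphi => /andP[f0 f1].
  by rewrite wE mulr_ge0//= mulr_ile1.
have w_left x : y x <= 1 - 2 * d ->
    [/\ w x = 0, derive1 w x = 0 & derive1 (derive1 w) x = 0].
  by move=> /f_left[E0 E1 E2]; rewrite w'E w''E wE E0 E1 E2 !mul0r !addr0.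
have w_right x : x3 <= x -> w x = 0.
  by move=> /chir[E0 _ _]; rewrite wE E0 mulr0.
exists w, (Num.max `|x0| `|x3|); split => //.
  move=> x; rewrite ge_max => /andP[xx0 xx3].
  have [xpos|xneg] := leP 0 x.
    apply: w_right; apply: le_trans (ler_norm _) _; rewrite (le_trans xx3)//.
    by rewrite ger0_norm.
  have yx : y x <= 1 - 2 * d.
    rewrite -yx0; apply: (profile_ndecr prof).
    by move: xx0; rewrite (ltr0_norm xneg); have := ler_norm (- x0); rewrite normrN; lra.
  by have [-> _ _] := w_left x yx.
move=> r; rewrite ge_max => /andP[rx0 rx3].
have rx0' : - r <= x0 by have := ler_norm (- x0); rewrite normrN; lra.
have rx3' : x3 <= r by have := ler_norm x3; lra.
have rx1 : - r <= x1 by lra.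
have cp := profile_p_continuous prof.
have ppos x : 0 <= p x by have /andP[/ltW] := profile_p prof x.
have cE := energy_continuous prof a_continuous sw.
split.
  have caw : continuous (fun x => a x * w x * p x).
    move=> x; apply: cvgM; last exact: cp.
    by apply: cvgM; [exact: a_continuous|exact: smooth_continuous].
  rewrite (itv_integral_split rx1 _ caw); last by lra.
  rewrite ltr_wpDl//.
    apply: itv_integral_ge0 => x _; rewrite !mulr_ge0//.
    by have /andP[] := w01 x.
  have x2r : x2 <= r by lra.
  rewrite (itv_integral_split (ltW x12) x2r caw) ltr_pwDl//; last first.
    apply: itv_integral_ge0 => x _; rewrite !mulr_ge0//.
    by have /andP[] := w01 x.
  apply: (@lt_le_trans _ _ (itv_integral x1 x2 (fun x => am * p x))).
    rewrite itv_integralZ// (itv_integral_p prof (ltW x12)) mulr_gt0// subr_gt0.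
    exact: (profile_incr prof x12).
  apply: itv_integral_le => //.
    by move=> x; apply: cvgM; [exact: cvg_cst|exact: cp].
  move=> x /andP[xx1 xx2]; have [E0 _ _] := f_right x xx1; have [F0 _ _] := chil x xx2.
  rewrite wE E0 F0 !mulr1 ler_wpM2r//.
  by have /andP[] := a_bounds x.
rewrite (itv_integral_split rx1 _ cE); last by lra.
rewrite (itv_integral_split (ltW x12) _ cE); last by lra.
rewrite (itv_integral_split (ltW x23) _ cE); last by lra.
(* where w = phi(y), the density is bounded below by a multiple of b p *)
have I1 : - (aM * C * b) <= itv_integral (- r) x1 (energy b a beta beta1 w).
  have C0 : 0 <= C.
    by apply: le_trans (phi_C (s := 0) _); rewrite ?lexx ?ler01.
  apply: (@le_trans _ _ (itv_integral (- r) x1 (fun x => - (aM * C * b) * p x))).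
    rewrite itv_integralZ// (itv_integral_p prof rx1).
    have q0 : 0 <= aM * C * b by apply: mulr_ge0; [exact: mulr_ge0|exact: ltW].
    rewrite mulNr lerN2 ler_piMr//.
    have /andP[_ h1] := profile_y01 prof x1; have /andP[h2 _] := profile_y01 prof (- r); lra.
  apply: itv_integral_le => //.
    by move=> x; apply: cvgM; [exact: cvg_cst|exact: cp].
  move=> x /andP[_ xx1].
  have [F0 F1 F2] := chil x (le_trans xx1 (ltW x12)).
  apply: (le_trans (fE x)).
  rewrite /energy w'E w''E wE F0 F1 F2 !mulr0 !mulr1 !addr0.
  exact: lexx.
have I2 : alo * (M - b - b / d) <= itv_integral x1 x2 (energy b a beta beta1 w).
  have cb1 := profile_beta1_continuous prof.
  apply: (@le_trans _ _ (itv_integral x1 x2 (fun x => alo * beta1 x))).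
    rewrite itv_integralZ// (itv_integral_FTC (ltW x12) cb1 (profile_dbeta prof)).
    rewrite ler_wpM2l// lerB//.
    have := profile_beta_le prof x1; rewrite yx1 subKr.
    by rewrite ler_pdivlMr.
  apply: itv_integral_le => //.
    by move=> x; apply: cvgM; [exact: cvg_cst|exact: cb1].
  move=> x /andP[xx1 xx2]; have [E0 E1 E2] := f_right x xx1.
  have [F0 F1 F2] := chil x xx2.
  rewrite /energy w'E w''E wE E0 E1 E2 F0 F1 F2.
  rewrite [leRHS](_ : _ = a x * beta1 x); last by ring.
  rewrite ler_wpM2r ?(profile_beta1 prof)//.
  have /andP[] // : alo <= a x <= ahi.
  apply: a_end; rewrite -yx0; apply: (profile_ndecr prof).
  exact: le_trans (ltW x01) xx1.
have I3 : - (ahi * M / 2) - aM * b <= itv_integral x2 x3 (energy b a beta beta1 w).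
  pose H x := - (aM * (b / T)) * x + ahi * M / 2 * chi x ^+ 2.
  pose H1 x := - (aM * (b / T)) + ahi * M * (chi x * derive1 chi x).
  have dH (x : R) : is_derive x 1 H (H1 x).
    have dchi := smooth_dv schi x.
    rewrite /H /H1; dv; move: (derive1 chi x) => e; field.
    by rewrite gt_eqF.
  have cH1 : continuous H1.
    move=> x; apply: cvgD; first exact: cvg_cst.
    apply: cvgM; first exact: cvg_cst.
    by apply: cvgM; [exact: smooth_continuous schi x|exact: smooth_continuous (smooth_derive
        schi) x].
  apply: (@le_trans _ _ (itv_integral x2 x3 H1)).
    rewrite (itv_integral_FTC (ltW x23) cH1 dH) /H /x3.
    have [-> _ _] := chil x2 (lexx _); have [-> _ _] := chir (x2 + T) (lexx _).
    rewrite le_eqVlt; apply/orP; left; apply/eqP; rewrite expr0n expr1n /=.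
    by field; lra.
  apply: itv_integral_le => // x /andP[xx2 xx3].
  have [E0 E1 E2] := f_right x (le_trans (ltW x12) xx2).
  rewrite /energy w'E w''E wE E0 E1 E2 /H1 !mul0r !mul1r !add0r.
  have /andP[c0 c1] := chi01 x; have c'0 := chi'0 x; have := chi2 x.
  have /andP[_ ax] : alo <= a x <= ahi.
    apply: a_end; rewrite -yx0; apply: (profile_ndecr prof).
    exact: le_trans (ltW (lt_trans x01 x12)) xx2.
  have aMx : a x <= aM by have /andP[] := a_bounds x.
  have := profile_beta1 prof x; have /andP[] := profile_beta prof x; have := a_ge0 x.
  move: (chi x) (derive1 chi x) (derive1 (derive1 chi) x) (a x) (beta x) (beta1 x) c0 c1 c'0 ax
      aMx.
  move=> c c' c'' A B B1 c0 c1 c'0 Ah AM A0 B0 BM B10 c2.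
  rewrite [leRHS](_ : _ = A * c * c'' + A * c * ((B - b) * c') + A * c ^+ 2 * B1); last by ring.
  have h1 : - (aM * (b / T)) <= A * c * c''.
    have : `|A * c * c''| <= aM * (b / T).
      rewrite normrM ler_pM// ger0_norm ?mulr_ge0//.
      by rewrite -[aM]mulr1 ler_pM.
    by rewrite ler_norml => /andP[].
  have h2 : ahi * M * (c * c') <= A * c * ((B - b) * c').
    have M0 : 0 <= M by exact: le_trans BM.
    have cc : c * c' <= 0 by rewrite mulr_ge0_le0.
    rewrite [leRHS](_ : _ = A * (B - b) * (c * c')); last by ring.
    rewrite ler_wnM2r//.
    apply: (@le_trans _ _ (A * M)); first by rewrite ler_wpM2l//; lra.
    by rewrite ler_wpM2r.
  have h3 : 0 <= A * c ^+ 2 * B1 by rewrite !mulr_ge0 ?exprn_ge0.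
  by rewrite -[leLHS]addr0 !lerD.
have I4 : 0 <= itv_integral x3 r (energy b a beta beta1 w).
  rewrite (@eq_itv_integral _ _ _ _ (fun=> 0)).
    by rewrite itv_integral_cst// mul0r.
  by move=> x /andP[xx3 _]; rewrite /energy w_right// mulr0 mul0r.
move: I1 I2 I3 I4.
move: (itv_integral _ _ _) (itv_integral x1 _ _) (itv_integral x2 _ _) (itv_integral x3 _ _).
move=> i1 i2 i3 i4 h1 h2 h3 h4.
rewrite (_ : _ - _ - _ - _ = - (aM * C * b) + (alo * (M - b - b / d) + ((- (ahi * M / 2) - aM *
    b) + 0))); last by ring.
by rewrite !lerD.
Qed.

End EndLayer.

Section Weight.
Context {R : realType}.
Implicit Types (a : R -> R).

Lemma weight_bounds a : {within `[0, 1], continuous a} ->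
  (forall x, 0 <= x <= 1 -> 0 < a x) ->
  exists m M, 0 < m /\ forall x, 0 <= x <= 1 -> m <= a x <= M.
Proof.
move=> ca a0.
have [c c01 cm] := EVT_min (@ler01 R) ca.
have [d d01 dM] := EVT_max (@ler01 R) ca.
exists (a c), (a d); split; first by apply: a0; rewrite in_itv in c01.
by move=> x x01; rewrite cm ?dM// in_itv.
Qed.

(** 7/8 and 9/8 are chosen so that the gain in [end_layer] beats the cost of
    the cutoff: 7/8 - (9/8)/2 = 5/16 > 0. *)
Lemma weight_near1 a : {within `[0, 1], continuous a} -> 0 < a 1 ->
  exists d, [/\ 0 < d, 2 * d <= 4^-1 &
    forall s, 1 - 2 * d <= s <= 1 -> 7 / 8 * a 1 <= a s <= 9 / 8 * a 1].
Proof.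
move=> /(continuous_within_itvP a (@ltr01 R))[_ _ a1] a10.
have e0 : 0 < a 1 / 8 by rewrite divr_gt0.
move/cvgrPdist_lt : a1 => /(_ _ e0) [e /= e1 he].
pose d := Num.min (e / 4) 8^-1.
have d0 : 0 < d by rewrite lt_min; apply/andP; split; lra.
have de : d <= e / 4 by rewrite ge_min lexx.
have d8 : d <= 8^-1 by rewrite ge_min lexx orbT.
exists d; split=> //; first lra.
move=> s /andP[s1]; rewrite le_eqVlt => /predU1P[->|s2]; first by apply/andP; split; lra.
have := he s; rewrite /ball /= gtr0_norm ?subr_gt0// => /(_ _ s2) H.
have {}H : `|a 1 - a s| < a 1 / 8 by apply: H; lra.
by move: H; rewrite ltr_norml => /andP[]; move: (a 1) (a s) => p q ? ?; apply/andP; split; lra.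
Qed.

Lemma weight_comp_continuous a (y : R -> R) : {within `[0, 1], continuous a} ->
  (forall x, 0 < y x < 1) -> continuous y -> continuous (fun x => a (y x)).
Proof.
move=> /(continuous_within_itvP a (@ltr01 R))[ca _ _] y01 cy x.
apply: (@continuous_cvg _ _ _ _ _ _ a); last exact: cy.
by apply: ca; rewrite in_itv /= y01.
Qed.

End Weight.

Section Positivity.
Context {R : realType}.

Lemma itv_integral_outside (l r l' r' : R) (f : R -> R) : l' <= l -> l <= r -> r <= r' ->
  continuous f -> (forall x, x <= l -> f x = 0) -> (forall x, r <= x -> f x = 0) ->
  itv_integral l' r' f = itv_integral l r f.
Proof.
move=> ll lr rr cf fl fr.
rewrite (itv_integral_split ll (le_trans lr rr) cf) (itv_integral_split lr rr cf).
rewrite (@eq_itv_integral _ l' l _ (fun=> 0)); last by move=> x /andP[_]; exact: fl.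
rewrite (@eq_itv_integral _ r r' _ (fun=> 0)); last by move=> x /andP[+ _]; exact: fr.
by rewrite !itv_integral_cst// !mul0r add0r addr0.
Qed.

Lemma level_facts :
  [/\ 0 < (8^-1 : R) < 1, 0 < (5 / 8 : R) < 1, 0 < (4^-1 : R) < 1 & 0 < (2^-1 : R) < 1] /\
  [/\ (8^-1 : R) < 4^-1, (4^-1 : R) < 2^-1, (2^-1 : R) < 5 / 8 & (4^-1 : R) <= 2^-1 - 4^-1].
Proof. by split; split; lra. Qed.

Lemma large_radius (x0 xa xb : R) : exists r,
  [/\ 0 < r, x0 <= r, - r < xa, xb < r & - r <= r].
Proof.
exists (1 + `|x0| + `|xa| + `|xb|).
have := normr_ge0 x0; have := normr_ge0 xa; have := normr_ge0 xb.
have := ler_norm x0; have := ler_norm (- xa); have := ler_norm xb; rewrite normrN.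
by split; lra.
Qed.

Lemma ramps (d : R) : 0 < d -> 2 * d <= 4^-1 -> exists phi1 phi2 : R -> R,
  [/\ smooth phi1 /\ smooth phi2, forall s, 0 <= phi1 s <= 1,
      (forall s, s <= 1 - 2 * d ->
        [/\ phi1 s = 0, derive1 phi1 s = 0 & derive1 (derive1 phi1) s = 0]) /\
      (forall s, 1 - d <= s ->
        [/\ phi1 s = 1, derive1 phi1 s = 0 & derive1 (derive1 phi1) s = 0]),
      forall s, 0 <= phi2 s <= 1 &
      [/\ forall s, 4^-1 <= s <= 2^-1 -> phi2 s = 1,
          forall s, s <= 8^-1 ->
            [/\ phi2 s = 0, derive1 phi2 s = 0 & derive1 (derive1 phi2) s = 0] &
          forall s, 5 / 8 <= s ->
            [/\ phi2 s = 0, derive1 phi2 s = 0 & derive1 (derive1 phi2) s = 0]]].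
Proof.
move=> d0 d4; have [h [sh h01 h0 h1 _]] := @smooth_step R.
have saff (u v : R) : smooth (fun s => u * s + v).
  by apply: smoothD; [apply: smoothM; [exact: smooth_cst|exact: smooth_id]|exact: smooth_cst].
have sp1 : smooth (fun s => h (d^-1 * s + (2 * d - 1) / d)) by exact: smooth_comp sh (saff _ _).
have sp2 : smooth (fun s => h (8 * s + -1) * h (- 8 * s + 5)).
  exact: smoothM (smooth_comp sh (saff _ _)) (smooth_comp sh (saff _ _)).
have left f k c : smooth f -> (forall s : R, s <= c -> f s = k) ->
    forall s, s <= c -> [/\ f s = k, derive1 f s = 0 & derive1 (derive1 f) s = 0].
  move=> sf fk; have E1 := derive0_left (smooth_dv sf) fk.
  have E2 := derive0_left (smooth_dv (smooth_derive sf)) E1.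
  by move=> s sc; rewrite fk// E1// E2.
have right f k c : smooth f -> (forall s : R, c <= s -> f s = k) ->
    forall s, c <= s -> [/\ f s = k, derive1 f s = 0 & derive1 (derive1 f) s = 0].
  move=> sf fk; have E1 := derive0_right (smooth_dv sf) fk.
  have E2 := derive0_right (smooth_dv (smooth_derive sf)) E1.
  by move=> s sc; rewrite fk// E1// E2.
exists (fun s => h (d^-1 * s + (2 * d - 1) / d)), (fun s => h (8 * s + -1) * h (- 8 * s + 5)).
split; [exact: conj sp1 sp2| |split| |split].
- by move=> s; exact: h01.
  + apply: (left _ _ _ sp1) => s s1; apply: h0.
    by rewrite [d^-1 * _]mulrC -mulrDl pmulr_lle0 ?invr_gt0//; lra.
  + apply: (right _ _ _ sp1) => s s1; apply: h1.
    by rewrite [d^-1 * _]mulrC -mulrDl ler_pdivlMr//; lra.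
- move=> s; have /andP[p0 p1] := h01 (8 * s + -1); have /andP[q0 q1] := h01 (- 8 * s + 5).
  by rewrite mulr_ge0//= mulr_ile1.
  + by move=> s /andP[s1 s2]; rewrite !h1 ?mulr1//; lra.
  + by apply: (left _ _ _ sp2) => s s1; rewrite h0 ?mul0r//; lra.
  + by apply: (right _ _ _ sp2) => s s1; rewrite (h0 (- 8 * s + 5)) ?mulr0//; lra.
Qed.

(** The form is of order M on w1 and at worst of order -b on lambda w2, for
    lambda in [0, Lam]. The number lambda is left free to meet an orthogonality
    condition later, which is possible because the sign of
    int a (w1 - lambda w2) p changes between 0 and Lam. *)
Lemma positive_perturbation (atilde : R -> R) :
  {within `[0, 1], continuous atilde} -> (forall x, 0 <= x <= 1 -> 0 < atilde x) ->
  exists (N : nat) (Lam : R), 0 < Lam /\ forall b M y p beta beta1,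
    wave_profile b M y p beta beta1 -> N%:R * b <= M ->
    exists w1 w2 r q0, let a x := atilde (y x) in
    [/\ 0 < r /\ 0 < q0, smooth w1 /\ smooth w2,
        forall x, r <= `|x| -> w1 x = 0 /\ w2 x = 0,
        0 < itv_integral (- r) r (fun x => a x * w1 x * p x) <
          Lam * itv_integral (- r) r (fun x => a x * w2 x * p x) &
        forall lam, 0 <= lam <= Lam ->
          q0 <= itv_integral (- r) r (energy b a beta beta1 (fun x => w1 x - lam * w2 x))].
Proof.
move=> ca apos.
have [am [aM [am0 aB]]] := weight_bounds ca apos.
have A10 : 0 < atilde 1 by apply: apos; rewrite ler01 lexx.
have [d [d0 d4 ad]] := weight_near1 ca A10.
have [f1 [f2 [[sf1 sf2] f1_01 [f1l f1r] f2_01 [f2_1 f2l f2r]]]] := ramps d0 d4.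
have bound (f : R -> R) : smooth f -> exists2 C, 0 <= C & forall s, 0 <= s <= 1 ->
    `|f s * derive1 (derive1 f) s| <= C.
  move=> sf; apply: (@continuous_itv_bounded _ (fun s => f s * derive1 (derive1 f) s)).
  exact: smooth_continuous (smoothM sf (smooth_derive (smooth_derive sf))).
have [C1 C10 hC1] := bound _ sf1; have [C2 C20 hC2] := bound _ sf2.
have aM0 : 0 < aM.
  by have := aB 1; rewrite ler01 lexx => /(_ isT)/andP[h1 h2]; exact: lt_le_trans am0 (le_trans
      h1 h2).
have aM0' := ltW aM0.
(* int a w1 p <= aM, and int a w2 p >= am / 4 as w2 = 1 for y in [1/4, 1/2] *)
pose Lam := 4 * aM / am + 1.
have Lam0 : 0 < Lam by rewrite ltr_wpDl// divr_ge0 ?mulr_ge0 ?(ltW aM0) ?(ltW am0).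
pose A1 := atilde 1.
(* b Z bounds all the negative contributions *)
pose Z := 7 / 8 * A1 * (1 + d^-1) + aM + aM * C1 + Lam ^+ 2 * (aM * C2).
pose N := Num.bound ((Z + 1) / (5 / 16 * A1)).
have Z0 : 0 <= Z.
  have d'0 : 0 <= d^-1 by rewrite invr_ge0 ltW.
  rewrite /Z !addr_ge0//.
  - by rewrite mulr_ge0 ?addr_ge0// mulr_ge0 ?divr_ge0 ?(ltW A10).
  - exact: mulr_ge0.
  - by apply: mulr_ge0; [exact: sqr_ge0|exact: mulr_ge0].
have ZN : Z + 1 <= 5 / 16 * A1 * N%:R.
  have q0 : 0 < 5 / 16 * A1 by rewrite mulr_gt0 ?divr_gt0.
  rewrite mulrC -ler_pdivrMr//; apply/ltW/archi_boundP.
  by rewrite divr_ge0 ?(ltW q0)// addr_ge0.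
exists N, Lam; split=> // b M y p beta beta1 prof NbM.
have b0 := profile_b_gt0 prof.
pose a x := atilde (y x).
have y01 x : 0 <= y x <= 1 by have /andP[/ltW -> /ltW ->] := profile_y01 prof x.
have a_b x : am <= a x <= aM by exact: aB.
have c_a : continuous a.
  apply: weight_comp_continuous => //; first exact: profile_y01 prof.
  exact: smooth_continuous (profile_smooth prof).
have a_pos x : 0 < a x by have /andP[h _] := a_b x; exact: lt_le_trans h.
have d2 : 2 * d < 1 by lra.
have d58 : 5 / 8 <= 1 - 2 * d by lra.
have alo0 : 0 <= 7 / 8 * A1 by rewrite mulr_ge0 ?divr_ge0 ?(ltW A10).
have a_end x : 1 - 2 * d <= y x -> 7 / 8 * A1 <= a x <= 9 / 8 * A1.
  by move=> yx; apply: ad; rewrite yx; have /andP[] := y01 x.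
have [w1 [r0 [sw1 w1r w1_01 w1l w1Q]]] :=
  end_layer prof c_a am0 a_b d0 d2 alo0 a_end sf1 f1_01 f1l f1r hC1.
have [[l8 l58 l4 l2] [l84 l42 l25 l422]] := level_facts.
have [xa yxa] := profile_level prof l8; have [xb yxb] := profile_level prof l58.
have [xc yxc] := profile_level prof l4; have [xd yxd] := profile_level prof l2.
have xac : xa < xc by apply: (profile_lt prof); rewrite yxa yxc.
have xcd : xc < xd by apply: (profile_lt prof); rewrite yxc yxd.
have xdb : xd < xb by apply: (profile_lt prof); rewrite yxd yxb.
have [w2'E w2''E] := derive_profile_comp prof sf2.
have w2Q := energy_comp_ge prof am0 a_b sf2 hC2.
have sw2 := smooth_comp sf2 (profile_smooth prof).
have [w2 w2E] : exists w2, forall x, w2 x = f2 (y x) by eexists.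
have w2_def : (fun x => f2 (y x)) = w2 by apply/funext => x; rewrite w2E.
rewrite w2_def in w2'E w2''E w2Q sw2.
have w2out x : y x <= 8^-1 \/ 5 / 8 <= y x ->
    [/\ w2 x = 0, derive1 w2 x = 0 & derive1 (derive1 w2) x = 0].
  move=> yx; have [E0 E1 E2] : [/\ f2 (y x) = 0, derive1 f2 (y x) = 0 & derive1 (derive1 f2) (y
      x) = 0].
    by case: yx; [exact: f2l|exact: f2r].
  have := w2''E x; rewrite E1 E2 !mul0r mulr0 addr0 => F2.
  by rewrite w2E E0 w2'E E1 mul0r.
have [r [r_gt0 rr0 rxa rxb lr]] := large_radius r0 xa xb.
have [I1 Q1] := w1Q r rr0.
have cp := profile_p_continuous prof.
have p0 x : 0 < p x by have /andP[] := profile_p prof x.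
have cwp (w : R -> R) : smooth w -> continuous (fun x => a x * w x * p x).
  move=> sw x; apply: cvgM; last exact: cp.
  by apply: cvgM; [exact: c_a|exact: smooth_continuous sw x].
have Yr : y r - y (- r) <= 1.
  have /andP[_ h1] := y01 r; have /andP[h2 _] := y01 (- r).
  by rewrite lerBlDr (le_trans h1)// lerDl.
have Yr0 : 0 <= y r - y (- r) by rewrite subr_ge0; exact: (profile_ndecr prof).
have I1le : itv_integral (- r) r (fun x => a x * w1 x * p x) <= aM.
  apply: (@le_trans _ _ (itv_integral (- r) r (fun x => aM * p x))).
    apply: itv_integral_le; first exact: cwp.
      by move=> x; apply: cvgM; [exact: cvg_cst|exact: cp].
    move=> x _; rewrite ler_pM2r// -[aM]mulr1.
    have /andP[h1 h2] := w1_01 x; have /andP[h3 h4] := a_b x.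
    by apply: ler_pM => //; exact: ltW.
  rewrite itv_integralZ// (itv_integral_p prof lr).
  by rewrite ler_piMr// ltW.
have I2ge : am * 4^-1 <= itv_integral (- r) r (fun x => a x * w2 x * p x).
  have c2 := cwp _ sw2.
  have pos x : 0 <= a x * w2 x * p x.
    have /andP[h _] := f2_01 (y x).
    by rewrite mulr_ge0 ?(ltW (p0 x))// mulr_ge0 ?(ltW (a_pos x))// w2E.
  have rc : - r <= xc by apply/ltW/(lt_trans rxa).
  have dr : xd <= r by apply/ltW/(lt_trans xdb).
  rewrite (itv_integral_split rc (le_trans (ltW xcd) dr) c2).
  rewrite ler_wpDl ?itv_integral_ge0//.
  rewrite (itv_integral_split (ltW xcd) dr c2) ler_wpDr ?itv_integral_ge0//.
  apply: (@le_trans _ _ (itv_integral xc xd (fun x => am * p x))).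
    rewrite itv_integralZ// (itv_integral_p prof (ltW xcd)) yxc yxd.
    by rewrite ler_pM2l.
  apply: itv_integral_le => //.
    by move=> x; apply: cvgM; [exact: cvg_cst|exact: cp].
  move=> x /andP[x1 x2]; rewrite ler_pM2r// w2E f2_1 ?mulr1.
    by have /andP[] := a_b x.
  by rewrite -yxc -yxd !(profile_ndecr prof).
have cE1 := energy_continuous prof c_a sw1.
have cE2 := energy_continuous prof c_a sw2.
have Q2 : - (aM * C2 * b) <= itv_integral (- r) r (energy b a beta beta1 w2).
  apply: (@le_trans _ _ (itv_integral (- r) r (fun x => - (aM * C2 * b) * p x))).
    rewrite itv_integralZ// (itv_integral_p prof lr) mulNr lerN2 ler_piMr//.
    by rewrite mulr_ge0 ?mulr_ge0// ltW.
  apply: itv_integral_le => //.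
  by move=> x; apply: cvgM; [exact: cvg_cst|exact: cp].
exists w1, w2, r, b; split=> //.
- move=> x rx; split.
    by apply: w1r; apply: le_trans rx.
  have [xp|xn] := leP 0 x.
    rewrite ger0_norm// in rx.
    have [] // := w2out x; right; rewrite -yxb; apply: (profile_ndecr prof).
    exact: le_trans (ltW rxb) rx.
  rewrite ltr0_norm// in rx.
  have [] // := w2out x; left; rewrite -yxa; apply: (profile_ndecr prof).
  by rewrite (le_trans _ (ltW rxa))// lerNr.
- apply/andP; split=> //.
  apply: (le_lt_trans I1le); apply: (@lt_le_trans _ _ (Lam * (am * 4^-1))).
    rewrite /Lam mulrDl mul1r mulrA divfK ?gt_eqF// mulrAC mulfV ?mul1r ?pnatr_eq0//.
    by rewrite ltrDl mulr_gt0.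
  by rewrite ler_pM2l.
- move=> lam /andP[lam0 lamL].
  (* the supports of w1 and w2 are disjoint, so there are no cross terms *)
  have split_energy x : energy b a beta beta1 (fun x => w1 x - lam * w2 x) x =
      energy b a beta beta1 w1 x + lam ^+ 2 * energy b a beta beta1 w2 x.
    have D1 : derive1 (fun x => w1 x - lam * w2 x) = fun x => derive1 w1 x - lam * derive1 w2 x.
      apply/funext => z; apply: dvE.
      have h1 := smooth_dv sw1 z; have h2 := smooth_dv sw2 z.
      by dv; move: (derive1 w1 z) (derive1 w2 z) => u v; ring.
    have D2 : derive1 (derive1 (fun x => w1 x - lam * w2 x)) x =
        derive1 (derive1 w1) x - lam * derive1 (derive1 w2) x.
      rewrite D1; apply: dvE.
      have h1 := smooth_dv (smooth_derive sw1) x; have h2 := smooth_dv (smooth_derive sw2) x.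
      by dv; move: (derive1 _ x) (derive1 (derive1 w2) x) => u v; ring.
    rewrite /energy D2 D1.
    have [yx|yx] := leP (y x) (1 - 2 * d).
      have [-> -> ->] := w1l x yx.
      by move: (derive1 _ x) (derive1 (derive1 w2) x) => u v; ring.
    have [|-> -> ->] := w2out x; first by right; exact: le_trans d58 (ltW yx).
    by move: (derive1 _ x) (derive1 (derive1 w1) x) => u v; ring.
  rewrite (eq_itv_integral (fun x _ => split_energy x)).
  rewrite itv_integralD//; last first.
    by move=> x; apply: cvgM; [exact: cvg_cst|exact: cE2].
  rewrite itv_integralZ//.
  have L2 : lam ^+ 2 * - (aM * C2 * b) >= - (Lam ^+ 2 * (aM * C2) * b).
    rewrite mulrN lerN2 -[leRHS]mulrA ler_wpM2r ?ler_pXn2r ?nnegrE//; [|exact: ltW..].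
    by rewrite !mulr_ge0// ltW.
  have L3 : lam ^+ 2 * - (aM * C2 * b) <= lam ^+ 2 * itv_integral (- r) r (energy b a beta
      beta1 w2).
    by rewrite ler_wpM2l ?sqr_ge0.
  apply: le_trans (lerD Q1 (le_trans L2 L3)).
  have h1 : (Z + 1) * b <= 5 / 16 * A1 * M.
    apply: (@le_trans _ _ (5 / 16 * A1 * N%:R * b)); first by rewrite ler_pM2r.
    by rewrite -mulrA ler_wpM2l// mulr_ge0 ?divr_ge0// ltW.
  rewrite [leRHS](_ : _ = 5 / 16 * A1 * M - (Z + 1) * b + b).
    by rewrite lerDr subr_ge0.
  by rewrite /Z; field; rewrite gt_eqF.
Qed.

End Positivity.

(** * Construction of the initial datum *)

Section ContinuousAlgebra.
Context {R : realType}.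
Implicit Types f g : R -> R.

Lemma continuous_mul f g : continuous f -> continuous g ->
  continuous (fun x => f x * g x).
Proof. by move=> cf cg x; apply: cvgM; [exact: cf|exact: cg]. Qed.

Lemma continuous_add f g : continuous f -> continuous g ->
  continuous (fun x => f x + g x).
Proof. by move=> cf cg x; apply: cvgD; [exact: cf|exact: cg]. Qed.

Lemma continuous_opp f : continuous f -> continuous (fun x => - f x).
Proof. by move=> cf x; apply: cvgN; exact: cf. Qed.

End ContinuousAlgebra.

Section ShockProfile.
Context {R : realType} (A : R -> R).
Context (A_smooth : smooth A) (A_convex : strictly_convex A).
Context (A'0 : derive1 A 0 = 0).
Context (K : R) (K0 : 0 < K) (S : R -> R) (S_shock : viscous_shock A 0 (- K) S).

(** All the bounds are convexity inequalities: p <= b y as A >= A(0), and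
    beta (1 - y) <= b by the tangent at S evaluated at -K. *)
Lemma shock_profile : wave_profile (leftward_speed A K) (- derive1 A (- K))
  (fun x => - S x / K) (fun x => - derive1 S x / K)
  (fun x => - derive1 A (S x)) (fun x => - (derive1 (derive1 A) (S x) * derive1 S x)).
Proof.
have sS := shock_smooth S_shock; have [_ Sm Sp _] := S_shock.
have S0 := shock_lt0 A_smooth A_convex A'0 K0 S_shock.
have SK := shock_gtNK A_smooth A_convex K0 S_shock.
have S1 := shock_derive_lt0 A_smooth A_convex A'0 K0 S_shock.
have ode := shock_ode A_smooth S_shock.
have sA1 := smooth_derive A_smooth.
have b0 := leftward_speed_gt0 A_smooth A_convex A'0 K0.
have K00 : K != 0 by rewrite gt_eqF.
have y01 x : 0 < - S x / K < 1.
  by rewrite divr_gt0 ?oppr_gt0//= ltr_pdivrMr// mul1r ltrNl.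
split.
- exact: b0.
- exact: smoothM (smoothN sS) (@smooth_cst R _).
- exact: y01.
- by move=> x; have h := smooth_dv sS x; dv; move: (derive1 S x) => d; ring.
- move=> x; have h := shock_derive2 A_smooth S_shock x.
  by dv; move: (derive1 S x) (derive1 A _) => d e; ring.
- by move=> x; exact: dvN (dv_comp (smooth_dv sA1 (S x)) (smooth_dv sS x)).
- move=> x; rewrite divr_gt0 ?oppr_gt0//=.
  apply: (@le_trans _ _ (leftward_speed A K * (- S x / K))).
    rewrite mulrA ler_pM2r ?invr_gt0// ode.
    have := convex_min A_smooth A_convex A'0 (S x).
    by move: (A _) (A 0) => p q; lra.
  by have /andP[_ /ltW h] := y01 x; rewrite ler_piMr// ltW.
- move=> x; rewrite oppr_ge0 lerN2; apply/andP; split.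
    by rewrite -A'0; apply: convex_derive_le => //; exact: ltW.
  by apply: convex_derive_le => //; exact: ltW.
- move=> x; rewrite oppr_ge0 mulr_ge0_le0 ?(ltW (S1 x))//.
  exact: convex_derive2_ge0.
- move=> x; apply: cvgN; apply: cvgM.
    apply: (@continuous_cvg _ _ _ _ _ _ (derive1 (derive1 A))).
      exact: smooth_continuous (smooth_derive sA1) _.
    exact: smooth_continuous sS _.
  exact: smooth_continuous (smooth_derive sS) _.
- move=> x; have := convex_tangent A_smooth A_convex (S x) (- K).
  have := convex_min A_smooth A_convex A'0 (S x).
  rewrite /leftward_speed ler_pdivlMr//.
  rewrite (_ : - derive1 A (S x) * (1 - - S x / K) * K = derive1 A (S x) * (- K - S x)).
    by move: (derive1 A _) (A _) (A (- K)) (A 0) => d p q r; lra.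
  by move: (derive1 A _) => d; field.
- rewrite [X in _ --> X](_ : _ = - 0 / K :> R); last by rewrite oppr0 mul0r.
  by apply: cvgM; [exact: cvgN|exact: cvg_cst].
- rewrite [X in _ --> X](_ : _ = - - K / K :> R); last by rewrite opprK divff.
  by apply: cvgM; [exact: cvgN|exact: cvg_cst].
- apply: cvgN; apply: (@continuous_cvg _ _ _ _ _ _ (derive1 A)) => //.
  exact: smooth_continuous sA1 _.
Qed.

Lemma small_factor (x c : R) : 0 <= x -> 0 < c ->
  exists2 e, 0 < e & forall e', 0 < e' <= e -> e' * x < c.
Proof.
move=> x0 c0; have x1 : 0 < x + 1 by lra.
exists (c / (x + 1)); first by rewrite divr_gt0.
move=> e' /andP[e0]; rewrite ler_pdivlMr// => h.
by apply: lt_le_trans h; rewrite ltr_pM2l//; lra.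
Qed.

Lemma compact_smooth_bounded (w : R -> R) (r : R) : smooth w ->
  (forall x, r <= `|x| -> w x = 0) ->
  exists2 W, 0 <= W & forall x, [/\ `|w x| <= W, `|derive1 w x| <= W &
    `|derive1 (derive1 w) x| <= W].
Proof.
move=> sw w0; have sw1 := smooth_derive sw; have sw2 := smooth_derive sw1.
have wr x : r <= x -> w x = 0 by move=> rx; apply: w0; apply: le_trans (ler_norm x).
have wl x : x <= - r -> w x = 0.
  by move=> rx; apply: w0; rewrite -normrN; apply: le_trans (ler_norm _); rewrite lerNr.
have wr1 := derive0_right (smooth_dv sw) wr; have wl1 := derive0_left (smooth_dv sw) wl.
have wr2 := derive0_right (smooth_dv sw1) wr1; have wl2 := derive0_left (smooth_dv sw1) wl1.
have bd f : smooth f -> (forall x, r <= x -> f x = 0) -> (forall x, x <= - r -> f x = 0) ->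
    exists2 W, 0 <= W & forall x, `|f x| <= W.
  move=> sf fr fl; have [W W0 hW] := continuous_itv_bounded (smooth_continuous sf) (- r) r.
  exists W => // x; have [rx|xr] := leP r x; first by rewrite fr// normr0.
  have [xr'|rx] := leP x (- r); first by rewrite fl// normr0.
  by apply: hW; rewrite !ltW.
have [W0 W00 h0] := bd _ sw wr wl; have [W1 W10 h1] := bd _ sw1 wr1 wl1.
have [W2 W20 h2] := bd _ sw2 wr2 wl2.
exists (W0 + W1 + W2); first by rewrite !addr_ge0.
move=> x; split.
- by apply: (le_trans (h0 x)); rewrite -addrA lerDl addr_ge0.
- by apply: (le_trans (h1 x)); rewrite addrAC lerDr addr_ge0.
- by apply: (le_trans (h2 x)); rewrite lerDr addr_ge0.
Qed.

Lemma itv_integral_norm_le (l r C : R) (f : R -> R) : l <= r -> continuous f ->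
  (forall x, `|f x| <= C) -> `|itv_integral l r f| <= C * (r - l).
Proof.
move=> lr cf fC; rewrite ler_norml -mulNr -!itv_integral_cst//.
apply/andP; split; apply: itv_integral_le => //; try exact: cst_continuous;
  by move=> x _; have := fC x; rewrite ler_norml => /andP[].
Qed.

Context (a : R -> R) (a_continuous : continuous a).
Context (w1 w2 : R -> R) (r Lam : R) (Lam_gt0 : 0 < Lam).
Context (w1_smooth : smooth w1) (w2_smooth : smooth w2).

Local Notation S1 := (derive1 S).
Local Notation wl lam := (fun x => w1 x - lam * w2 x).

Lemma wl_derive (lam x : R) : derive1 (wl lam) x = derive1 w1 x - lam * derive1 w2 x.
Proof.
apply: dvE; have h1 := smooth_dv w1_smooth x; have h2 := smooth_dv w2_smooth x.
by dv; move: (derive1 w1 x) (derive1 w2 x) => u v; ring.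
Qed.

(** For the datum S + e w, orthogonality involves w itself and so is quadratic
    in lambda. For small e the signs at 0 and Lam are those of the linear part,
    and the intermediate value theorem applies. *)
Lemma orthogonal_lambda (e D m : R) :
  (forall lam, 0 <= lam <= Lam ->
     `|itv_integral (- r) r (fun x => a x * wl lam x * derive1 (wl lam) x)| <= D) ->
  0 < e -> e * D < m ->
  itv_integral (- r) r (fun x => a x * wl 0 x * S1 x) <= - m ->
  m <= itv_integral (- r) r (fun x => a x * wl Lam x * S1 x) ->
  exists2 lam, 0 <= lam <= Lam &
    itv_integral (- r) r (fun x => a x * wl lam x * (S1 x + e * derive1 (wl lam) x)) = 0.
Proof.
move=> hD e0 eDm h0 hL.
have sS := shock_smooth S_shock.
have cS1 := smooth_continuous (smooth_derive sS).
have c1 := smooth_continuous w1_smooth; have c2 := smooth_continuous w2_smooth.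
have c1' := smooth_continuous (smooth_derive w1_smooth).
have c2' := smooth_continuous (smooth_derive w2_smooth).
have cC (c : R) : continuous (fun _ : R => c) by exact: cst_continuous.
pose f0 x := a x * w1 x * (S1 x + e * derive1 w1 x).
pose f1 x := a x * (- 1 * (w2 x * (S1 x + e * derive1 w1 x)) + - e * (w1 x * derive1 w2 x)).
pose f2 x := e * (a x * (w2 x * derive1 w2 x)).
have cf0 : continuous f0 := continuous_mul (continuous_mul a_continuous c1) (continuous_add cS1
    (continuous_mul (cC e) c1')).
have cf1 : continuous f1 := continuous_mul a_continuous (continuous_add (continuous_mul (cC _)
    (continuous_mul c2 (continuous_add cS1 (continuous_mul (cC e) c1')))) (continuous_mul (cC
    _) (continuous_mul c1 c2'))).
have cf2 : continuous f2 := continuous_mul (cC e) (continuous_mul a_continuous (continuous_mul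
    c2 c2')).
pose I lam := itv_integral (- r) r (fun x => a x * wl lam x * (S1 x + e * derive1 (wl lam) x)).
have IE lam : I lam = itv_integral (- r) r f0 + lam * itv_integral (- r) r f1 +
    lam ^+ 2 * itv_integral (- r) r f2.
  rewrite -!itv_integralZ// -itv_integralD//; last exact: continuous_mul (cC _) cf1.
  rewrite -itv_integralD; last 2 first.
  - exact: continuous_add cf0 (continuous_mul (cC _) cf1).
  - exact: continuous_mul (cC _) cf2.
  apply: eq_itv_integral => x _; rewrite wl_derive /f0 /f1 /f2.
  by move: (derive1 w1 x) (derive1 w2 x) (S1 x) => u v s; ring.
have cwl lam : continuous (wl lam) by exact: continuous_add c1 (continuous_opp (continuous_mul
    (cC _) c2)).
have cwl' lam : continuous (derive1 (wl lam)).
  rewrite (_ : derive1 (wl lam) = fun x => derive1 w1 x - lam * derive1 w2 x); last first.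
    by apply/funext => x; exact: wl_derive.
  exact: continuous_add c1' (continuous_opp (continuous_mul (cC _) c2')).
have Isplit lam : I lam = itv_integral (- r) r (fun x => a x * wl lam x * S1 x) +
   e * itv_integral (- r) r (fun x => a x * wl lam x * derive1 (wl lam) x).
  have ca := continuous_mul a_continuous (cwl lam).
  have cb := continuous_mul ca (cwl' lam).
  rewrite -itv_integralZ// -itv_integralD; last 2 first.
  - exact: continuous_mul ca cS1.
  - exact: continuous_mul (cC _) cb.
  apply: eq_itv_integral => x _.
  by move: (derive1 (wl lam) x) (S1 x) => u s; ring.
have L0 := Lam_gt0.
have eb lam : 0 <= lam <= Lam ->
    `|e * itv_integral (- r) r (fun x => a x * wl lam x * derive1 (wl lam) x)| < m.
  by move=> /hD h; apply: le_lt_trans eDm; rewrite normrM gtr0_norm// ler_pM2l.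
have I0 : I 0 < 0.
  have := eb 0; rewrite lexx (ltW L0) => /(_ isT); rewrite ltr_norml => /andP[_ h].
  rewrite Isplit; apply: (le_lt_trans (lerD h0 (lexx _))).
  by rewrite addrC subr_lt0.
have IL : 0 < I Lam.
  have := eb Lam; rewrite lexx (ltW L0) => /(_ isT); rewrite ltr_norml => /andP[h _].
  rewrite Isplit; apply: (lt_le_trans _ (lerD hL (lexx _))).
  by rewrite -ltrBlDl sub0r.
have [||lam lamL Ilam] := @IVT R I 0 Lam 0 (ltW L0).
- apply: continuous_subspaceT.
  rewrite (_ : I = fun lam => itv_integral (- r) r f0 + lam * itv_integral (- r) r f1 +
      lam ^+ 2 * itv_integral (- r) r f2); last by apply/funext => lam; exact: IE.
  move: (itv_integral _ _ f0) (itv_integral _ _ f1) (itv_integral _ _ f2) => z0 z1 z2.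
  apply: smooth_continuous; apply: smoothD; first apply: smoothD.
  + exact: smooth_cst.
  + exact: smoothM (@smooth_id R) (@smooth_cst R _).
  + exact: smoothM (smoothM (@smooth_id R) (@smooth_id R)) (@smooth_cst R _).
- by rewrite min_l ?max_r ?(ltW (lt_trans I0 IL))// !ltW.
- by exists lam => //; rewrite in_itv in lamL.
Qed.

End ShockProfile.

Section GoodDatum.
Context {R : realType} (A : R -> R).
Context (A_smooth : smooth A) (A_convex : strictly_convex A).
Context (A'0 : derive1 A 0 = 0).
Context (K : R) (K0 : 0 < K) (S : R -> R) (S_shock : viscous_shock A 0 (- K) S).
Context (a : R -> R) (aM : R) (a_continuous : continuous a).
Context (a_bounds : forall x, 0 <= a x <= aM).
Context (w1 w2 : R -> R) (r q0 Lam : R).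
Context (r_gt0 : 0 < r) (q0_gt0 : 0 < q0) (Lam_gt0 : 0 < Lam).
Context (w1_smooth : smooth w1) (w2_smooth : smooth w2).
Context (w12_out : forall x, r <= `|x| -> w1 x = 0 /\ w2 x = 0).

Local Notation S1 := (derive1 S).
Local Notation wl lam := (fun x => w1 x - lam * w2 x).
Local Notation b := (leftward_speed A K).
Local Notation beta := (fun x => - derive1 A (S x)).
Local Notation beta1 := (fun x => - (derive1 (derive1 A) (S x) * S1 x)).

Context (I1_gt0 : 0 < itv_integral (- r) r (fun x => a x * w1 x * (- S1 x / K))).
Context (I12 : itv_integral (- r) r (fun x => a x * w1 x * (- S1 x / K)) <
  Lam * itv_integral (- r) r (fun x => a x * w2 x * (- S1 x / K))).
Context (energy_ge : forall lam, 0 <= lam <= Lam ->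
  q0 <= itv_integral (- r) r (energy b a beta beta1 (wl lam))).

Lemma first_variation_algebra (L2 L3 CS V e c p q q' s v v' z al : R) :
  0 < e -> 0 <= V -> 0 <= al -> al <= aM -> 0 <= L2 -> 0 <= L3 ->
  `|e * z| <= e * V -> `|v| <= V -> `|s| <= CS ->
  `|p - q| <= L2 * `|e * z| -> `|p - q - q' * (e * z)| <= L3 * (e * z) ^+ 2 ->
  c * (al * (e * z) * (s + e * v)) +
    e ^+ 2 * (al * z * (v' + (- q - c) * v + - (q' * s) * z)) -
    e ^+ 3 * (aM * V * (L3 * V ^+ 2 * CS + L2 * V * V)) <=
  al * (e * z) * ((q + c) * s + e * v' - p * (s + e * v)).
Proof.
move=> e0 V0 a0 a1 L20 L30 ew vV sC h2 h3.
pose Rm := - (p - q - q' * (e * z)) * s - (p - q) * (e * v).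
rewrite [leRHS](_ : _ = c * (al * (e * z) * (s + e * v)) +
   e ^+ 2 * (al * z * (v' + (- q - c) * v + - (q' * s) * z)) + al * (e * z) * Rm); last first.
  by rewrite /Rm; ring.
rewrite lerD2l.
have hR : `|Rm| <= e ^+ 2 * (L3 * V ^+ 2 * CS + L2 * V * V).
  apply: (le_trans (ler_normB _ _)).
  rewrite mulrDr; apply: lerD.
    rewrite normrM normrN.
    rewrite [leRHS](_ : _ = L3 * (e * V) ^+ 2 * CS); last by ring.
    apply: ler_pM => //; apply: (le_trans h3); rewrite ler_wpM2l//.
    by rewrite -[(e * z) ^+ 2]real_normK ?num_real// ler_pXn2r ?nnegrE ?mulr_ge0 ?(ltW e0).
  rewrite normrM.
  rewrite [leRHS](_ : _ = L2 * (e * V) * (e * V)); last by ring.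
  apply: ler_pM => //.
    by apply: (le_trans h2); rewrite ler_wpM2l.
  by rewrite normrM gtr0_norm// ler_pM2l.
have : `|al * (e * z) * Rm| <= e ^+ 3 * (aM * V * (L3 * V ^+ 2 * CS + L2 * V * V)).
  rewrite [leRHS](_ : _ = aM * (e * V) * (e ^+ 2 * (L3 * V ^+ 2 * CS + L2 * V * V))); last by
      ring.
  rewrite normrM; apply: ler_pM => //.
  by rewrite normrM; apply: ler_pM => //; rewrite ger0_norm.
by rewrite ler_norml => /andP[].
Qed.

(** The term in b comes from the motion of the shock itself, since
    S'' - (A(S))' = b S'; its integral will vanish by orthogonality. *)
Lemma first_variation_expansion (L2 L3 CS V e : R) (w : R -> R) :
  (forall z, - (K + 1) <= z <= 1 -> `|derive1 (derive1 A) z| <= L2) ->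
  (forall z, - (K + 1) <= z <= 1 -> `|derive1 (derive1 (derive1 A)) z| <= L3) ->
  (forall x, `|S1 x| <= CS) -> smooth w -> 0 < e -> 0 <= V -> e * V <= 1 ->
  (forall x, `|w x| <= V) -> (forall x, `|derive1 w x| <= V) ->
  forall x, b * (a x * (e * w x) * (S1 x + e * derive1 w x)) +
     e ^+ 2 * energy b a beta beta1 w x - e ^+ 3 * (aM * V * (L3 * V ^+ 2 * CS + L2 * V * V)) <=
   a x * (e * w x) * (derive1 S1 x + e * derive1 (derive1 w) x -
      derive1 A (S x + e * w x) * (S1 x + e * derive1 w x)).
Proof.
move=> hL2 hL3 hCS sw e0 V0 eV wV w'V x.
have sA1 := smooth_derive A_smooth; have sA2 := smooth_derive sA1.
have Sin : - (K + 1) <= S x <= 1.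
  have := shock_lt0 A_smooth A_convex A'0 K0 S_shock x.
  by have := shock_gtNK A_smooth A_convex K0 S_shock x; move: (S x) => s; lra.
have ew : `|e * w x| <= e * V by rewrite normrM gtr0_norm// ler_pM2l.
have Swin : - (K + 1) <= S x + e * w x <= 1.
  have := shock_lt0 A_smooth A_convex A'0 K0 S_shock x.
  have := shock_gtNK A_smooth A_convex K0 S_shock x.
  have := le_trans ew eV; rewrite ler_norml; move: (S x) (e * w x) => s t.
  by move=> /andP[]; lra.
have h2 := derivative_lipschitz (smooth_dv sA1) hL2 Sin Swin.
have h3 := taylor1 (smooth_dv sA1) (smooth_dv sA2) hL3 Sin Swin.
have E2 : derive1 S1 x = (derive1 A (S x) + b) * S1 x.
  exact: dvE (shock_derive2 A_smooth S_shock x).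
rewrite /energy E2; move: h2 h3; rewrite [S x + _ - S x]addrAC subrr add0r.
have := hCS x; have := wV x; have := w'V x; have /andP[a0 a1] := a_bounds x.
have L20 : 0 <= L2 by apply: le_trans (hL2 _ Sin).
have L30 : 0 <= L3 by apply: le_trans (hL3 _ Sin).
move=> vV zV sC h2 h3.
exact: (@first_variation_algebra L2 L3 CS V e b _ _ _ _ _
  (derive1 (derive1 w) x) _ _ e0 V0 a0 a1 L20 L30 ew vV sC h2 h3).
Qed.

(** The two integral conditions say that the distance to the shock does not
    respond at first order to a translation and that it increases at first order
    in time. The datum is S + e (w1 - lam w2), where e is fixed first and
    lam is then given by [orthogonal_lambda]. *)
Lemma good_datum (eta : R) : 0 < eta -> exists w0 : R -> R,
  [/\ smooth w0, forall x, r <= `|x| -> w0 x = 0,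
      (forall x, `|w0 x| <= eta) /\ (forall x, `|derive1 (derive1 w0) x| <= eta),
      itv_integral (- r) r (fun x => a x * w0 x * (S1 x + derive1 w0 x)) = 0 &
      0 < itv_integral (- r) r (fun x => a x * w0 x *
        (derive1 S1 x + derive1 (derive1 w0) x -
         derive1 A (S x + w0 x) * (S1 x + derive1 w0 x)))].
Proof.
move=> eta0.
have sA1 := smooth_derive A_smooth; have sA2 := smooth_derive sA1; have sA3 := smooth_derive sA2.
have sS := shock_smooth S_shock.
have r0 := r_gt0; have L0 := Lam_gt0; have lr : - r <= r by lra.
have [CS [hCS _ _]] := shock_derivatives_bounded A_smooth A_convex A'0 K0 S_shock.
have [L2 L20 hL2] := continuous_itv_bounded (smooth_continuous sA2) (- (K + 1)) 1.
have [L3 L30 hL3] := continuous_itv_bounded (smooth_continuous sA3) (- (K + 1)) 1.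
have CS0 : 0 <= CS by apply: le_trans (hCS 0).
have [W1 W10 hW1] := compact_smooth_bounded w1_smooth (fun x rx => (w12_out rx).1).
have [W2 W20 hW2] := compact_smooth_bounded w2_smooth (fun x rx => (w12_out rx).2).
pose V := W1 + Lam * W2.
have V0 : 0 <= V by rewrite addr_ge0// mulr_ge0// ltW.
have swl lam : smooth (wl lam) by exact: smoothB w1_smooth (smoothM (@smooth_cst R lam)
    w2_smooth).
have wl1 lam x := wl_derive w1_smooth w2_smooth lam x.
have wl2 lam x : derive1 (derive1 (wl lam)) x = derive1 (derive1 w1) x - lam * derive1 (derive1
    w2) x.
  rewrite (_ : derive1 (wl lam) = fun x => derive1 w1 x - lam * derive1 w2 x).
    exact: wl_derive (smooth_derive w1_smooth) (smooth_derive w2_smooth) lam x.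
  by apply/funext => z; exact: wl1.
have hV lam : 0 <= lam <= Lam -> forall x, [/\ `|wl lam x| <= V, `|derive1 (wl lam) x| <= V &
    `|derive1 (derive1 (wl lam)) x| <= V].
  move=> /andP[l0 lL] x; have [a1 a2 a3] := hW1 x; have [b1 b2 b3] := hW2 x.
  have tri (u v : R) : `|u| <= W1 -> `|v| <= W2 -> `|u - lam * v| <= V.
    move=> hu hv; apply: (le_trans (ler_normB _ _)); apply: lerD => //.
    by rewrite normrM ger0_norm//; exact: ler_pM.
  by rewrite wl1 wl2; split; exact: tri.
pose D := aM * V * V * (r - - r).
have aM0 : 0 <= aM by have /andP[] := a_bounds 0; exact: le_trans.
have D0 : 0 <= D by apply: mulr_ge0; [rewrite !mulr_ge0|rewrite subr_ge0].
pose E := aM * V * (L3 * V ^+ 2 * CS + L2 * V * V).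
have E0 : 0 <= E.
  apply: mulr_ge0; first exact: mulr_ge0.
  by rewrite addr_ge0// ?mulr_ge0// exprn_ge0.
have I10 := I1_gt0; have I120 := I12.
set I1 := itv_integral (- r) r (fun x => a x * w1 x * (- S1 x / K)) in I10 I120.
set I2 := itv_integral (- r) r (fun x => a x * w2 x * (- S1 x / K)) in I120.
pose m := Num.min (K * I1) (K * (Lam * I2 - I1)).
have m0 : 0 < m by rewrite lt_min !mulr_gt0// subr_gt0.
have [e1 e10 he1] := small_factor V0 eta0.
have [e2 e20 he2] := small_factor V0 (@ltr01 R).
have [e3 e30 he3] := small_factor D0 m0.
have Er0 : 0 <= E * (r - - r) by rewrite mulr_ge0// subr_ge0.
have [e4 e40 he4] := small_factor Er0 q0_gt0.
have [e [e0 le1 le2 le3 le4]] : exists e, [/\ 0 < e, e <= e1, e <= e2, e <= e3 & e <= e4].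
  exists (Num.min (Num.min e1 e2) (Num.min e3 e4)).
  by rewrite !lt_min e10 e20 e30 e40 !ge_min !lexx !orbT.
have {}he1 : e * V < eta by apply: he1; rewrite e0.
have {}he2 : e * V < 1 by apply: he2; rewrite e0.
have {}he3 : e * D < m by apply: he3; rewrite e0.
have {}he4 : e * (E * (r - - r)) < q0 by apply: he4; rewrite e0.
have cC (c : R) : continuous (fun _ : R => c) by exact: cst_continuous.
have cS1 := smooth_continuous (smooth_derive sS).
have K00 : K != 0 by rewrite gt_eqF.
have cwS (w : R -> R) : smooth w -> continuous (fun x => a x * w x * (- S1 x / K)).
  move=> sw; apply: continuous_mul; first exact: continuous_mul a_continuous (smooth_continuous
      sw).
  by exact: continuous_mul (continuous_opp cS1) (cC _).
have wS lam : itv_integral (- r) r (fun x => a x * wl lam x * S1 x) = - K * I1 + K * lam * I2.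
  rewrite /I1 /I2 -!itv_integralZ; [|exact: cwS..].
  rewrite -itv_integralD; [|exact: continuous_mul (cC _) (cwS _ _)..].
  by apply: eq_itv_integral => x _; move: (S1 x) => s; field.
have [lam lamL orth] : exists2 lam, 0 <= lam <= Lam &
    itv_integral (- r) r (fun x => a x * wl lam x * (S1 x + e * derive1 (wl lam) x)) = 0.
  apply: (orthogonal_lambda S_shock a_continuous L0 w1_smooth w2_smooth (D := D) (m := m)) => //.
  - move=> lam lamL; apply: itv_integral_norm_le => //.
      apply: continuous_mul; last exact: smooth_continuous (smooth_derive (swl lam)).
      exact: continuous_mul a_continuous (smooth_continuous (swl lam)).
    move=> x; have [v1 v2 _] := hV lam lamL x; have /andP[a0 a1] := a_bounds x.
    rewrite normrM; apply: ler_pM => //.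
    by rewrite normrM; apply: ler_pM => //; rewrite ger0_norm.
  - rewrite wS mulr0 mul0r addr0 mulNr lerN2 /m ge_min lexx //.
  - rewrite wS /m ge_min; apply/orP; right.
    by rewrite le_eqVlt; apply/orP; left; apply/eqP; ring.
have prof := shock_profile A_smooth A_convex A'0 K0 S_shock.
have [w [[sw wout wV w'V] [w''V orthw Qw]]] : exists w,
  [/\ smooth w, forall x, r <= `|x| -> w x = 0, forall x, `|w x| <= V &
      forall x, `|derive1 w x| <= V] /\
  [/\ forall x, `|derive1 (derive1 w) x| <= V,
      itv_integral (- r) r (fun x => a x * w x * (S1 x + e * derive1 w x)) = 0 &
      q0 <= itv_integral (- r) r (energy b a beta beta1 w)].
  exists (wl lam); split; split.
  - exact: swl.
  - by move=> x /w12_out[-> ->]; rewrite mulr0 subrr.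
  - by move=> x; have [] := hV lam lamL x.
  - by move=> x; have [] := hV lam lamL x.
  - by move=> x; have [] := hV lam lamL x.
  - exact: orth.
  - exact: energy_ge lamL.
have cEn := energy_continuous prof a_continuous sw.
have dw0 : derive1 (fun x => e * w x) = fun x => e * derive1 w x.
  apply/funext => x; apply: dvE; have h := smooth_dv sw x.
  by dv; move: (derive1 w x) => u; ring.
have ddw0 : derive1 (derive1 (fun x => e * w x)) = fun x => e * derive1 (derive1 w) x.
  rewrite dw0; apply/funext => x; apply: dvE; have h := smooth_dv (smooth_derive sw) x.
  by dv; move: (derive1 (derive1 w) x) => u; ring.
have eVle (u : R) : `|u| <= V -> `|e * u| <= eta.
  move=> uV; apply: (le_trans _ (ltW he1)).
  by rewrite normrM gtr0_norm// ler_pM2l.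
exists (fun x => e * w x); split.
- exact: smoothM (@smooth_cst R e) sw.
- by move=> x /wout ->; rewrite mulr0.
- by split=> x; rewrite ?ddw0; exact: eVle.
- rewrite dw0 (@eq_itv_integral _ _ _ _ (fun x => e * (a x * w x * (S1 x + e * derive1 w x)))).
    rewrite itv_integralZ ?orthw ?mulr0//.
    apply: continuous_mul; first exact: continuous_mul a_continuous (smooth_continuous sw).
    exact: continuous_add cS1 (continuous_mul (cC e) (smooth_continuous (smooth_derive sw))).
  by move=> x _; move: (S1 x) (derive1 w x) => s v; ring.
- rewrite ddw0 dw0.
  pose T x := a x * w x * (S1 x + e * derive1 w x).
  have cT : continuous T.
    apply: continuous_mul; first exact: continuous_mul a_continuous (smooth_continuous sw).
    exact: continuous_add cS1 (continuous_mul (cC e) (smooth_continuous (smooth_derive sw))).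
  pose en := energy b a beta beta1 w.
  apply: (@lt_le_trans _ _ (itv_integral (- r) r (fun x => b * e * T x + (e ^+ 2 * en x + - (e
      ^+ 3 * E))))).
    have cE2 : continuous (fun x => e ^+ 2 * en x) by exact: continuous_mul (cC _) cEn.
    rewrite itv_integralD; [|exact: continuous_mul (cC _) cT|exact: continuous_add cE2 (cC _)].
    rewrite itv_integralD//.
    rewrite !itv_integralZ// itv_integral_cst// orthw mulr0 add0r.
    rewrite (_ : _ + _ = e ^+ 2 * (itv_integral (- r) r en - e * (E * (r - - r)))).
      by rewrite mulr_gt0 ?exprn_gt0// subr_gt0; exact: lt_le_trans Qw.
    by move: (itv_integral _ _ _) => i; ring.
  have cw := smooth_continuous sw.
  have cw' := smooth_continuous (smooth_derive sw).
  apply: itv_integral_le.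
  - exact: continuous_add (continuous_mul (cC _) cT) (continuous_add (continuous_mul (cC _)
      cEn) (cC _)).
  - apply: continuous_mul; first exact: continuous_mul a_continuous (continuous_mul (cC e) cw).
    apply: continuous_add; first exact: continuous_add (smooth_continuous (smooth_derive
        (smooth_derive sS))) (continuous_mul (cC e) (smooth_continuous (smooth_derive
        (smooth_derive sw)))).
    apply: continuous_opp; apply: continuous_mul; last exact: continuous_add cS1
        (continuous_mul (cC e) cw').
    move=> z; apply: (@continuous_cvg _ _ _ _ _ _ (derive1 A)); first exact: smooth_continuous
        sA1 _.
    exact: continuous_add (smooth_continuous sS) (continuous_mul (cC e) cw) z.
  move=> x _.
  apply: le_trans (first_variation_expansion hL2 hL3 hCS sw e0 V0 (ltW he2) wV w'V x).
  rewrite /T -/E -/(en x) le_eqVlt; apply/orP; left; apply/eqP.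
  by move: (en x) (S1 x) (derive1 w x) => n s v; ring.
Qed.

End GoodDatum.

(** * Growth of the distance to the shock *)

Section Increase.
Context {R : realType} (A : R -> R).
Context (A_smooth : smooth A) (A_convex : strictly_convex A).
Context (A'0 : derive1 A 0 = 0).
Context (K : R) (K0 : 0 < K) (S : R -> R) (S_shock : viscous_shock A 0 (- K) S).

Local Notation S1 := (derive1 S).

(** S' is bounded away from 0 on compact intervals, which gives the estimate for
    |X| <= 1; monotonicity extends it to larger X. *)
Lemma shock_translate (r : R) : exists2 c, 0 < c & forall x X,
  r + 1 <= x <= r + 2 -> c * Num.min `|X| 1 <= `|S (x + X) - S x|.
Proof.
have dS := shock_dv S_shock.
have S10 := shock_derive_lt0 A_smooth A_convex A'0 K0 S_shock.
have decr := shock_decr A_smooth A_convex A'0 K0 S_shock.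
have r3 : r <= r + 3 by lra.
have [|z _ zm] := @EVT_max R S1 r (r + 3) r3.
  apply: continuous_subspaceT.
  exact: smooth_continuous (smooth_derive (shock_smooth S_shock)).
exists (- S1 z); first by rewrite oppr_gt0.
move=> x X x12.
have small Y : `|Y| <= 1 -> - S1 z * `|Y| <= `|S (x + Y) - S x|.
  move=> Y1; have [Y0|Y0|->] := ltgtP Y 0; last by rewrite normr0 mulr0.
  - have xY : x + Y < x by lra.
    have [c /andP[c1 c2] E] := mean_value dS xY.
    rewrite distrC E normrM -[`|Y|]normrN; have -> : x - (x + Y) = - Y by ring.
    rewrite ler_wpM2r// ltr0_norm// lerN2; apply: zm.
    rewrite in_itv /=; move: Y1; rewrite ltr0_norm// => Y1.
    by clear - c1 c2 x12 Y1; lra.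
  - have xY : x < x + Y by lra.
    have [c /andP[c1 c2] E] := mean_value dS xY.
    rewrite E normrM; have -> : x + Y - x = Y by ring.
    rewrite ler_wpM2r// ltr0_norm// lerN2; apply: zm.
    rewrite in_itv /=; move: Y1; rewrite gtr0_norm// => Y1.
    by clear - c1 c2 x12 Y1; lra.
have [X1|X1] := leP `|X| 1; first exact: small.
rewrite mulr1; have [X0|X0] := ltP X 0.
- have := small (-1); rewrite normrN normr1 mulr1 => /(_ (lexx _)) h.
  apply: (le_trans h).
  have h1 : S x < S (x - 1) by apply: decr; lra.
  have h2 : S (x - 1) < S (x + X) by apply: decr; move: X1; rewrite ltr0_norm//; lra.
  by rewrite !gtr0_norm ?subr_gt0 ?lerD2r ?(ltW h2)//; exact: lt_trans h2.
- have := small 1; rewrite normr1 mulr1 => /(_ (lexx _)) h.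
  apply: (le_trans h).
  have h1 : S (x + 1) < S x by apply: decr; lra.
  have h2 : S (x + X) < S (x + 1) by apply: decr; move: X1; rewrite ger0_norm//; lra.
  by rewrite !ltr0_norm ?subr_lt0 ?lerN2 ?lerD2r ?(ltW h2)//; exact: lt_trans h1.
Qed.

Context (r : R) (w0 : R -> R) (w0_smooth : smooth w0).
Context (w0_out : forall x, r <= `|x| -> w0 x = 0) (w0_le1 : forall x, `|w0 x| <= 1).

Local Notation u0 := (fun x => S x + w0 x).
Local Notation g := (fun x => derive1 S1 x + derive1 (derive1 w0) x -
  derive1 A (S x + w0 x) * (S1 x + derive1 w0 x)).

Lemma datum_smooth : smooth u0.
Proof. exact: smoothD (shock_smooth S_shock) w0_smooth. Qed.

Lemma datum_derive : derive1 u0 = fun x => S1 x + derive1 w0 x.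
Proof.
apply/funext => x; apply: dvE.
exact: dvD (smooth_dv (shock_smooth S_shock) x) (smooth_dv w0_smooth x).
Qed.

Lemma datum_derive2 : derive1 (derive1 u0) = fun x => derive1 S1 x + derive1 (derive1 w0) x.
Proof.
rewrite datum_derive; apply/funext => x; apply: dvE.
exact: dvD (smooth_dv (smooth_derive (shock_smooth S_shock)) x)
  (smooth_dv (smooth_derive w0_smooth) x).
Qed.

Lemma datum_bound x : `|S x + w0 x| <= K + 1.
Proof.
have h1 := shock_lt0 A_smooth A_convex A'0 K0 S_shock x.
have h2 := shock_gtNK A_smooth A_convex K0 S_shock x.
apply: (le_trans (ler_normD _ _)); apply: lerD => //.
by rewrite ltr0_norm// lerNl ltW.
Qed.

Lemma datum_rate_smooth : smooth g.
Proof.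
have sS := shock_smooth S_shock.
apply: smoothB.
  exact: smoothD (smooth_derive (smooth_derive sS)) (smooth_derive (smooth_derive w0_smooth)).
exact: smoothM (smooth_comp (smooth_derive A_smooth) datum_smooth)
  (smoothD (smooth_derive sS) (smooth_derive w0_smooth)).
Qed.

(** Outside the support of the perturbation the initial rate of change is that
    of the translating shock, b S', which is bounded with its derivatives. *)
Lemma datum_expansion : exists C C4 G1, [/\ 0 <= C, 0 <= C4, 0 <= G1,
  forall x, `|derive1 g x| <= G1 &
  forall u, bounded_solution u A u0 -> forall x t, 0 <= t <= 1 ->
    [/\ `|u x t| <= K + 1, `|u x t - u0 x - t * g x| <= C * t ^+ 2 &
        `|u x t - u0 x| <= C4 * t]].
Proof.
have sS := shock_smooth S_shock.
have sg := datum_rate_smooth.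
have [CS [hC1 hC2 hC3]] := shock_derivatives_bounded A_smooth A_convex A'0 K0 S_shock.
have [W W0 hW] := compact_smooth_bounded w0_smooth w0_out.
pose h x := g x - leftward_speed A K * S1 x.
have sbS : smooth (fun x => leftward_speed A K * S1 x).
  exact: smoothM (@smooth_cst R (leftward_speed A K)) (smooth_derive sS).
have sh : smooth h by exact: smoothB sg sbS.
have h_out x : r <= `|x| -> h x = 0.
  move=> rx.
  have w0x : [/\ w0 x = 0, derive1 w0 x = 0 & derive1 (derive1 w0) x = 0].
    have d1 := smooth_dv w0_smooth; have d2 := smooth_dv (smooth_derive w0_smooth).
    have [x0|x0] := leP 0 x.
      have R0 y : r <= y -> w0 y = 0 by move=> ry; apply: w0_out; exact: le_trans (ler_norm y).
      have R1 := derive0_right d1 R0; have R2 := derive0_right d2 R1.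
      by rewrite ger0_norm// in rx; split; [exact: R0|exact: R1|exact: R2].
    have L0 y : y <= - r -> w0 y = 0.
      by move=> ry; apply: w0_out; rewrite -normrN; apply: le_trans (ler_norm _); rewrite lerNr.
    have L1 := derive0_left d1 L0; have L2 := derive0_left d2 L1.
    by rewrite ltr0_norm// lerNr in rx; split; [exact: L0|exact: L1|exact: L2].
  have [E0 E1 E2] := w0x.
  rewrite /h E0 E1 E2 !addr0 (dvE (shock_derive2 A_smooth S_shock x)).
  by move: (derive1 A _) (S1 x) (leftward_speed A K) => p q s; ring.
have [H H0 hH] := compact_smooth_bounded sh h_out.
pose b := `|leftward_speed A K|.
have b0 : 0 <= b by exact: normr_ge0.
have CS0 : 0 <= CS by apply: le_trans (hC1 0).
have gE : g = fun x => h x + leftward_speed A K * S1 x.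
  by apply/funext => x; rewrite /h subrK.
have g'E : derive1 g = fun x => derive1 h x + leftward_speed A K * derive1 S1 x.
  rewrite gE; apply/funext => x; apply: dvE.
  have d1 := smooth_dv sh x; have d2 := smooth_dv (smooth_derive sS) x.
  by dv; move: (derive1 h x) (derive1 S1 x) (leftward_speed A K) => p q s; ring.
have g''E : derive1 (derive1 g) = fun x => derive1 (derive1 h) x + leftward_speed A K * derive1
    (derive1 S1) x.
  rewrite g'E; apply/funext => x; apply: dvE.
  have d1 := smooth_dv (smooth_derive sh) x.
  have d2 := smooth_dv (smooth_derive (smooth_derive sS)) x.
  by dv; move: (derive1 (derive1 h) x) (derive1 (derive1 S1) x) (leftward_speed A K) => p q s;
      ring.
have bd (p q : R) : `|p| <= H -> `|q| <= CS -> `|p + leftward_speed A K * q| <= H + b * CS.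
  move=> hp hq; apply: (le_trans (ler_normD _ _)); apply: lerD => //.
  by rewrite normrM ler_wpM2l.
pose G := H + b * CS.
have G0 : 0 <= G by rewrite addr_ge0// mulr_ge0.
have gEx x : g x = h x + leftward_speed A K * S1 x by rewrite /h subrK.
have gG x : `|g x| <= G by rewrite gEx; apply: bd => //; have [] := hH x.
have g1G x : `|derive1 g x| <= G by rewrite g'E; apply: bd => //; have [] := hH x.
have g2G x : `|derive1 (derive1 g) x| <= G by rewrite g''E; apply: bd => //; have [] := hH x.
have u1 x : `|derive1 u0 x| <= CS + W.
  by rewrite datum_derive; apply: (le_trans (ler_normD _ _)); apply: lerD => //; have [] := hW x.
have u2 x : `|derive1 (derive1 u0) x| <= CS + W.
  by rewrite datum_derive2; apply: (le_trans (ler_normD _ _)); apply: lerD => //; have [] := hW x.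
have gu x : g x = derive1 (derive1 u0) x - derive1 A (u0 x) * derive1 u0 x.
  by rewrite datum_derive2 datum_derive.
have [C C0 hC] := short_time_expansion A_smooth datum_smooth sg gu datum_bound u1 u2 gG g1G g2G.
exists C, (C + G), G; split=> //; first by rewrite addr_ge0.
move=> u su x t t01; have [h1 h2] := hC u su x t t01; split=> //.
have /andP[t0 t1] := t01.
have -> : u x t - u0 x = (u x t - u0 x - t * g x) + t * g x by rewrite subrK.
rewrite mulrDl; apply: (le_trans (ler_normD _ _)); apply: lerD.
  apply: (le_trans h2); rewrite ler_wpM2l// expr2 -[leRHS]mulr1.
  by rewrite ler_wpM2l.
by rewrite normrM ger0_norm// mulrC ler_wpM2r.
Qed.

End Increase.

Section Elementary.
Context {R : realType}.

Lemma sqr_lower (q s z : R) : 0 <= q -> 0 <= s -> q - s <= `|z| ->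
  q ^+ 2 / 2 - s ^+ 2 <= z ^+ 2.
Proof.
move=> q0 s0; rewrite -(real_normK (num_real z)) => h.
have := normr_ge0 z; move: `|z| h => n h n0.
have [qs|sq] := leP q s; first by nra.
have h1 : (q - s) ^+ 2 <= n ^+ 2 by rewrite ler_pXn2r ?nnegrE//; lra.
have h2 : 0 <= (q - 2 * s) ^+ 2 by exact: sqr_ge0.
by nra.
Qed.

(** Completing the square in x. *)
Lemma quadratic_gain (gam G P Q t x : R) : 0 < gam -> 0 < t ->
  t * (P ^+ 2 / (2 * gam) + Q) < 2 * G ->
  0 < 2 * t * G + gam / 2 * x ^+ 2 - P * t * x - Q * t ^+ 2.
Proof.
move=> g0 t0 h.
rewrite (_ : _ - _ = (gam * x - P * t) ^+ 2 / (2 * gam) +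
    t * (2 * G - t * (P ^+ 2 / (2 * gam) + Q))).
  rewrite ltr_wpDl ?mulr_gt0 ?subr_gt0//; apply: divr_ge0; first exact: sqr_ge0.
  by apply: mulr_ge0 => //; exact: ltW.
by field; rewrite gt_eqF.
Qed.

Lemma triangle_lower (c m s n1 n2 n3 : R) :
  c * m <= n1 -> n2 <= c / 2 * m + s -> n1 - n2 <= n3 -> c / 2 * m - s <= n3.
Proof. by lra. Qed.

Lemma small_shift_arith (gam G Le CS G1 C z t x i : R) :
  2 * Le * CS * x ^+ 2 <= gam / 2 * x ^+ 2 ->
  t * G - Le * (CS * x ^+ 2 + G1 * t * x + C * t ^+ 2) <= i ->
  2 * t * G + gam / 2 * x ^+ 2 - 2 * Le * G1 * t * x - (2 * Le * C + z) * t ^+ 2 <=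
  2 * i + (gam * x ^+ 2 - z * t ^+ 2).
Proof. by lra. Qed.

Lemma large_shift_arith (gam Le z s i : R) :
  - (Le * s) <= i -> z < gam / 2 -> 2 * Le * s <= gam / 2 ->
  0 < 2 * i + (gam - z).
Proof. by lra. Qed.

End Elementary.

Lemma bounded_solution_continuous (R : realType) (A u0 : R -> R) (u : R -> R -> R)
    (X t : R) : bounded_solution u A u0 -> 0 < t -> continuous (fun x => u (x + X) t).
Proof.
move=> [_ _ _ du _] t0 x.
have [_ dux _ _ _] := du (x + X) t t0.
have cv : {for x + X, continuous (u ^~ t)}.
  by apply: differentiable_continuous; apply/derivable1_diffP.
apply: (@continuous_cvg _ _ _ _ _ _ (u ^~ t)); first exact: cv.
by apply: cvgD; [exact: cvg_id|exact: cvg_cst].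
Qed.

Section Gain.
Context {R : realType} (A : R -> R).
Context (A_smooth : smooth A) (A_convex : strictly_convex A).
Context (A'0 : derive1 A 0 = 0).
Context (K : R) (K0 : 0 < K) (S : R -> R) (S_shock : viscous_shock A 0 (- K) S).
Context (a : R -> R) (am aM : R) (a_continuous : continuous a) (am_gt0 : 0 < am).
Context (a_bounds : forall x, am <= a x <= aM).
Context (r : R) (r_gt0 : 0 < r).

Local Notation S1 := (derive1 S).

(** The difference |w0 + delta|^2 - w0^2 splits into a term linear
    in delta, localized on the support of w0, and delta^2, of which only the
    contribution of an interval away from that support is kept. *)
Lemma functional_gain (w0 delta : R -> R) (rho c : R) :
  r + 2 <= rho -> continuous w0 -> continuous delta ->
  (forall x, r + 1 <= x <= r + 2 -> c <= delta x ^+ 2) ->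
  itv_integral (- rho) rho (fun x => a x * w0 x ^+ 2) +
    (2 * itv_integral (- rho) rho (fun x => a x * w0 x * delta x) +
     itv_integral (r + 1) (r + 2) (fun x => a x * c)) <=
  itv_integral (- rho) rho (fun x => a x * (w0 x + delta x) ^+ 2).
Proof.
move=> rrho cw cd dc; have r0 := r_gt0.
have l1 : - rho <= r + 1 by lra.
have l2 : r + 1 <= r + 2 by lra.
have cM := @continuous_mul R; have cC (k : R) : continuous (fun _ : R => k) by exact:
    cst_continuous.
have c1 : continuous (fun x => a x * w0 x ^+ 2) := cM _ _ a_continuous (cM _ _ cw cw).
have c2 : continuous (fun x => a x * w0 x * delta x) := cM _ _ (cM _ _ a_continuous cw) cd.
have c3 : continuous (fun x => a x * delta x ^+ 2) := cM _ _ a_continuous (cM _ _ cd cd).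
have a0 x : 0 <= a x by have /andP[h _] := a_bounds x; exact: le_trans (ltW am_gt0) h.
rewrite (@eq_itv_integral _ _ _ (fun x => a x * (w0 x + delta x) ^+ 2)
  (fun x => a x * w0 x ^+ 2 + (2 * (a x * w0 x * delta x) + a x * delta x ^+ 2))); last first.
  by move=> x _; ring.
have c2' := cM _ _ (cC 2) c2.
rewrite itv_integralD//; last exact: continuous_add c2' c3.
rewrite itv_integralD// itv_integralZ//.
rewrite lerD2l lerD2l.
have d0 x : 0 <= a x * delta x ^+ 2 by rewrite mulr_ge0// sqr_ge0.
rewrite (itv_integral_split l1 (le_trans l2 rrho) c3) (itv_integral_split l2 rrho c3).
rewrite ler_wpDl ?itv_integral_ge0// ler_wpDr ?itv_integral_ge0//.
apply: itv_integral_le => //; first exact: cM _ _ a_continuous (cC c).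
by move=> x x12; rewrite ler_wpM2l// dc.
Qed.

Context (data : forall eta : R, 0 < eta -> exists w0 : R -> R,
  [/\ smooth w0, forall x, r <= `|x| -> w0 x = 0,
      (forall x, `|w0 x| <= eta) /\ (forall x, `|derive1 (derive1 w0) x| <= eta),
      itv_integral (- r) r (fun x => a x * w0 x * (S1 x + derive1 w0 x)) = 0 &
      0 < itv_integral (- r) r (fun x => a x * w0 x *
        (derive1 S1 x + derive1 (derive1 w0) x -
         derive1 A (S x + w0 x) * (S1 x + derive1 w0 x)))]).

(** For a small translation X the linear term is 2 t G up to quadratic errors,
    because the first-order response to X vanishes, and the X^2 error is
    absorbed by the quadratic gain away from the support; for a large X that
    gain alone suffices, the perturbation being small. *)
Lemma datum_increases : exists w0 rho, [/\ smooth w0,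
  forall x, r <= `|x| -> w0 x = 0, r <= rho &
  exists2 T, 0 < T & forall u, bounded_solution u A (fun x => S x + w0 x) ->
    forall t X, 0 < t < T ->
    itv_integral (- rho) rho (fun x => a x * w0 x ^+ 2) <
    itv_integral (- rho) rho (fun x => a x * (u (x + X) t - S x) ^+ 2)].
Proof.
have r0 := r_gt0.
pose rho := r + 3.
have rho0 : 0 < rho by rewrite /rho; lra.
have lrho : - rho <= rho by lra.
have rrho : r <= rho by rewrite /rho; lra.
have rrho2 : r + 2 <= rho by rewrite /rho; lra.
have sS := shock_smooth S_shock.
have aM0 : 0 < aM.
  by have /andP[h1 h2] := a_bounds 0; exact: lt_le_trans am_gt0 (le_trans h1 h2).
have a0 x : 0 < a x by have /andP[h _] := a_bounds x; exact: lt_le_trans am_gt0 h.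
have ale x : a x <= aM by have /andP[] := a_bounds x.
have [CS [hC1 hC2 _]] := shock_derivatives_bounded A_smooth A_convex A'0 K0 S_shock.
have CS0 : 0 <= CS by apply: le_trans (hC1 0).
have [c c0 transl] := shock_translate A_smooth A_convex A'0 K0 S_shock r.
pose gam := am * (c ^+ 2 / 8).
have gam0 : 0 < gam by rewrite mulr_gt0// divr_gt0// exprn_gt0.
pose L := aM * (rho - - rho).
have L0 : 0 <= L by rewrite mulr_ge0 ?(ltW aM0)// subr_ge0.
have KK0 : 0 <= 2 * K + 2 by apply: addr_ge0 => //; apply: mulr_ge0 => //; exact: ltW.
have Z0 : 0 <= 4 * L * (CS + 1 + (2 * K + 2)).
  apply: mulr_ge0; first by apply: mulr_ge0.
  by apply: addr_ge0 => //; apply: addr_ge0.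
have [e1 e10 he1] := small_factor Z0 gam0.
pose eta := Num.min (Num.min 1 (c / 2)) e1.
have eta0 : 0 < eta by rewrite !lt_min ltr01 divr_gt0.
have eta1 : eta <= 1 by rewrite !ge_min lexx.
have etac : eta <= c / 2 by rewrite !ge_min lexx orbT.
have {}he1 : eta * (4 * L * (CS + 1 + (2 * K + 2))) < gam.
  by apply: he1; rewrite eta0 ge_min lexx orbT.
have Leta0 : 0 <= L * eta by rewrite mulr_ge0// ltW.
have hsmall : 2 * (L * eta) * (CS + 1) <= gam / 2.
  rewrite ler_pdivlMr//; apply: le_trans (ltW he1).
  rewrite [leRHS](_ : _ = 2 * (L * eta) * (CS + 1) * 2 + 4 * (L * eta) * (2 * K + 2)); last by
      ring.
  by rewrite lerDl; apply: mulr_ge0 => //; exact: mulr_ge0.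
have hlarge : 2 * (L * eta) * (2 * K + 2) <= gam / 2.
  rewrite ler_pdivlMr//; apply: le_trans (ltW he1).
  rewrite [leRHS](_ : _ = 4 * (L * eta) * (CS + 1) + 2 * (L * eta) * (2 * K + 2) * 2); last by
      ring.
  by rewrite lerDr; apply: mulr_ge0; [exact: mulr_ge0|exact: addr_ge0].
have [w0 [sw w_out [w_eta w''_eta] orth Gpos]] := data eta0.
have w_1 x : `|w0 x| <= 1 by exact: le_trans eta1.
have [C [C4 [G1 [C_0 C40 G10 g'G hexp]]]] :=
  datum_expansion A_smooth A_convex A'0 K0 S_shock sw w_out w_1.
have sg := datum_rate_smooth A_smooth S_shock sw.
have su0 := datum_smooth S_shock sw.
have u0'E := datum_derive S_shock sw.
have u0''E := datum_derive2 S_shock sw.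
have u0K := datum_bound A_smooth A_convex A'0 K0 S_shock w_1.
have [g gE] : exists g : R -> R, g = fun x => derive1 S1 x + derive1 (derive1 w0) x -
  derive1 A (S x + w0 x) * (S1 x + derive1 w0 x) by eexists.
have [u0 u0E] : exists u0 : R -> R, u0 = fun x => S x + w0 x by eexists.
rewrite -gE in g'G sg; rewrite -u0E in su0 u0'E u0''E.
have u0x x : S x + w0 x = u0 x by rewrite u0E.
have gx x : derive1 S1 x + derive1 (derive1 w0) x -
  derive1 A (S x + w0 x) * (S1 x + derive1 w0 x) = g x by rewrite gE.
have {}hexp u : bounded_solution u A u0 -> forall x t, 0 <= t <= 1 ->
    [/\ `|u x t| <= K + 1, `|u x t - u0 x - t * g x| <= C * t ^+ 2 &
        `|u x t - u0 x| <= C4 * t].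
  by rewrite u0E gE; exact: hexp.
have {}u0K x : `|u0 x| <= K + 1 by rewrite u0E; exact: u0K.
have cw := smooth_continuous sw; have cg := smooth_continuous sg.
have cu0 := smooth_continuous su0; have cu0' := smooth_continuous (smooth_derive su0).
have cM := @continuous_mul R; have cD := @continuous_add R.
have cC (k : R) : continuous (fun _ : R => k) by exact: cst_continuous.
have caw := cM _ _ a_continuous cw.
pose G := itv_integral (- rho) rho (fun x => a x * w0 x * g x).
have w_left x : x <= - r -> w0 x = 0.
  by move=> xr; apply: w_out; rewrite -normrN; apply: le_trans (ler_norm _); rewrite lerNr.
have w_right x : r <= x -> w0 x = 0.
  by move=> xr; apply: w_out; exact: le_trans (ler_norm _).
have ext (f : R -> R) : continuous f -> itv_integral (- rho) rho (fun x => a x * w0 x * f x) =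
    itv_integral (- r) r (fun x => a x * w0 x * f x).
  move=> cf; apply: itv_integral_outside.
  - by rewrite lerN2.
  - by lra.
  - exact: rrho.
  - exact: cM _ _ caw cf.
  - by move=> x /w_left ->; rewrite mulr0 mul0r.
  - by move=> x /w_right ->; rewrite mulr0 mul0r.
have orth' : itv_integral (- rho) rho (fun x => a x * w0 x * derive1 u0 x) = 0.
  by rewrite ext// u0'E.
have G0 : 0 < G by rewrite /G ext// gE.
clear orth Gpos.
pose P := 2 * (L * eta) * G1.
pose Q := 2 * (L * eta) * C + aM * C4 ^+ 2.
have Leta2 : 0 <= 2 * (L * eta) by rewrite mulr_ge0.
have aC0 : 0 <= aM * C4 ^+ 2 by apply: mulr_ge0; [exact: ltW|exact: sqr_ge0].
have Q0 : 0 <= Q by apply: addr_ge0 => //; exact: mulr_ge0.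
have G20 : 0 < 2 * G by rewrite mulr_gt0.
have PQ0 : 0 <= P ^+ 2 / (2 * gam) + Q.
  apply: addr_ge0 => //; apply: divr_ge0; first exact: sqr_ge0.
  by apply: mulr_ge0 => //; exact: ltW.
have [T1 T10 hT1] := small_factor PQ0 G20.
have gam20 : 0 < gam / 2 by rewrite divr_gt0.
have [T2 T20 hT2] := small_factor aC0 gam20.
exists w0, rho; split=> //.
exists (Num.min 1 (Num.min T1 T2)); first by rewrite !lt_min ltr01 T10.
move=> u; rewrite -u0E => su t X /andP[t0].
rewrite !lt_min => /and3P[t1 tT1 tT2].
have t01 : 0 <= t <= 1 by rewrite !ltW.
have {}hT1 : t * (P ^+ 2 / (2 * gam) + Q) < 2 * G by apply: hT1; rewrite t0 ltW.
have {}hT2 : t * (aM * C4 ^+ 2) < gam / 2 by apply: hT2; rewrite t0 ltW.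
have {}hexp x := hexp u su x t t01.
have cu := bounded_solution_continuous (X := X) su t0.
pose delta x := u (x + X) t - u0 x.
have cdelta : continuous delta by exact: cD _ _ cu (continuous_opp cu0).
pose m := Num.min `|X| 1.
have m0 : 0 <= m by rewrite le_min normr_ge0 ler01.
(* away from the support, u0 is the shock, up to eta if the translation is
   large enough to bring the perturbation back *)
have away x : r + 1 <= x <= r + 2 -> c / 2 * m - C4 * t <= `|delta x|.
  move=> x12; have xr : r <= x by case/andP: x12 => h _; apply: le_trans h; rewrite lerDl.
  have u0S : u0 x = S x by rewrite u0E w_right// addr0.
  have h1 := transl x X x12; rewrite -/m in h1.
  have wX : `|w0 (x + X)| <= c / 2 * m.
    have [X1|X1] := leP `|X| 1.
      have xXr : r <= x + X.
        move: X1; rewrite ler_norml => /andP[X1 _]; case/andP: x12 => h _.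
        by have := lerD h X1; rewrite addrK.
      by rewrite w_right// normr0 mulr_ge0// divr_ge0// ltW.
    rewrite /m min_r ?(ltW X1)// mulr1.
    exact: le_trans (w_eta _) etac.
  have [_ _ h3] := hexp (x + X).
  have E : delta x = (S (x + X) - S x) + (w0 (x + X) + (u (x + X) t - u0 (x + X))).
    by rewrite /delta u0S -(u0x (x + X)); ring.
  have h4 : `|w0 (x + X) + (u (x + X) t - u0 (x + X))| <= c / 2 * m + C4 * t.
    by apply: (le_trans (ler_normD _ _)); exact: lerD.
  have h5 := lerB_normD (S (x + X) - S x) (w0 (x + X) + (u (x + X) t - u0 (x + X))).
  rewrite -E in h5.
  exact: triangle_lower h1 h4 h5.
have sq x : r + 1 <= x <= r + 2 -> c ^+ 2 / 8 * m ^+ 2 - (C4 * t) ^+ 2 <= delta x ^+ 2.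
  move=> /away h.
  have h' := sqr_lower (mulr_ge0 (divr_ge0 (ltW c0) (ler0n R 2)) m0) (mulr_ge0 C40 (ltW t0)) h.
  rewrite (_ : c ^+ 2 / 8 * m ^+ 2 = (c / 2 * m) ^+ 2 / 2)//.
  by field.
have gain := functional_gain rrho2 cw cdelta sq.
rewrite (@eq_itv_integral _ _ _ (fun x => a x * (u (x + X) t - S x) ^+ 2)
   (fun x => a x * (w0 x + delta x) ^+ 2)); last first.
  by move=> x _; rewrite /delta -(u0x x); congr (_ * _ ^+ _); ring.
apply: (lt_le_trans _ gain); rewrite ltrDl.
have J : gam * m ^+ 2 - aM * C4 ^+ 2 * t ^+ 2 <=
    itv_integral (r + 1) (r + 2) (fun x => a x * (c ^+ 2 / 8 * m ^+ 2 - (C4 * t) ^+ 2)).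
  have l12 : r + 1 <= r + 2 by rewrite lerD2l ler1n.
  rewrite (_ : gam * m ^+ 2 - aM * C4 ^+ 2 * t ^+ 2 =
      itv_integral (r + 1) (r + 2) (fun=> gam * m ^+ 2 - aM * C4 ^+ 2 * t ^+ 2)); last first.
    by rewrite itv_integral_cst//; ring.
  apply: itv_integral_le; [exact: cC|exact: cM _ _ a_continuous (cC _)|].
  move=> x _; rewrite mulrBr; apply: lerB.
    rewrite /gam -mulrA ler_wpM2r//; last by have /andP[] := a_bounds x.
    by apply: mulr_ge0; [apply: divr_ge0 => //; exact: sqr_ge0|exact: sqr_ge0].
  by rewrite exprMn -mulrA ler_wpM2r//; apply: mulr_ge0; exact: sqr_ge0.
apply: (lt_le_trans _ (lerD (lexx _) J)).
have [X1|X1] := leP `|X| 1.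
  have mX : m = `|X| by rewrite /m min_l.
  have err x : `|delta x - X * derive1 u0 x - t * g x| <=
      (CS + 1) * X ^+ 2 + G1 * t * `|X| + C * t ^+ 2.
    have [_ h1 _] := hexp (x + X).
    have inI : x - 1 <= x <= x + 1 by rewrite lerBlDr !lerDl ler01.
    have inIX : x - 1 <= x + X <= x + 1.
      by move: X1; rewrite ler_norml => /andP[X1 X2]; rewrite !lerD2l X1.
    have h2 : `|u0 (x + X) - u0 x - derive1 u0 x * X| <= (CS + 1) * X ^+ 2.
      have := @taylor1 _ _ _ _ (x - 1) (x + 1) (CS + 1) (smooth_dv su0)
        (smooth_dv (smooth_derive su0)) _ x (x + X) inI inIX.
      rewrite [x + X - x]addrAC subrr add0r; apply => z _.
      rewrite u0''E; apply: (le_trans (ler_normD _ _)); apply: lerD => //.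
      exact: le_trans (w''_eta z) eta1.
    have h3 : `|g (x + X) - g x| <= G1 * `|X|.
      have := derivative_lipschitz (smooth_dv sg) (fun z _ => g'G z) inI inIX.
      by rewrite [x + X - x]addrAC subrr add0r.
    have -> : delta x - X * derive1 u0 x - t * g x =
       (u0 (x + X) - u0 x - derive1 u0 x * X) + t * (g (x + X) - g x) +
       (u (x + X) t - u0 (x + X) - t * g (x + X)).
      by rewrite /delta; move: (derive1 u0 x) => d; ring.
    apply: (le_trans (ler_normD _ _)); apply: lerD => //.
    apply: (le_trans (ler_normD _ _)); apply: lerD => //.
    rewrite normrM gtr0_norm// [G1 * t]mulrC -mulrA.
    by rewrite ler_pM2l.
  pose e := (CS + 1) * X ^+ 2 + G1 * t * `|X| + C * t ^+ 2.
  have e0 : 0 <= e by apply: le_trans (err 0).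
  have lin : t * G - L * eta * e <= itv_integral (- rho) rho (fun x => a x * w0 x * delta x).
    apply: (@le_trans _ _ (itv_integral (- rho) rho
      (fun x => X * (a x * w0 x * derive1 u0 x) + (t * (a x * w0 x * g x) + - (aM * eta * e))))).
      have k1 := cM _ _ caw cu0'; have k2 := cM _ _ caw cg.
      rewrite itv_integralD; [|exact: cM _ _ (cC _) k1|exact: cD _ _ (cM _ _ (cC _) k2) (cC _)].
      rewrite itv_integralD; [|exact: cM _ _ (cC _) k2|exact: cC].
      rewrite !itv_integralZ// orth' mulr0 add0r itv_integral_cst// -/G.
      by rewrite lerD2l /L mulNr lerN2 le_eqVlt; apply/orP; left; apply/eqP; ring.
    apply: itv_integral_le.
    - exact: cD _ _ (cM _ _ (cC _) (cM _ _ caw cu0')) (cD _ _ (cM _ _ (cC _) (cM _ _ caw cg))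
        (cC _)).
    - exact: cM _ _ caw cdelta.
    move=> x _.
    rewrite -subr_ge0 (_ : _ - _ = aM * eta * e + a x * w0 x * (delta x - X * derive1 u0 x - t
        * g x)).
      have : `|a x * w0 x * (delta x - X * derive1 u0 x - t * g x)| <= aM * eta * e.
        rewrite normrM; apply: ler_pM => //; rewrite normrM; apply: ler_pM => //.
        by rewrite gtr0_norm.
      by rewrite ler_norml => /andP[h _]; rewrite -lerBlDl sub0r.
    by move: (derive1 u0 x) => d; ring.
  have := @quadratic_gain R gam G P Q t `|X| gam0 t0 hT1 => pos.
  apply: (lt_le_trans pos).
  have XX : X ^+ 2 = `|X| ^+ 2 by rewrite real_normK ?num_real.
  have hs : 2 * (L * eta) * (CS + 1) * `|X| ^+ 2 <= gam / 2 * `|X| ^+ 2.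
    by rewrite ler_wpM2r// exprn_ge0.
  rewrite mX /P /Q; apply: small_shift_arith hs _.
  by rewrite -XX.
have mX : m = 1 by rewrite /m min_r// ltW.
have lin : - (L * eta * (2 * K + 2)) <= itv_integral (- rho) rho (fun x => a x * w0 x * delta x).
  have -> : - (L * eta * (2 * K + 2)) = itv_integral (- rho) rho (fun=> - (aM * eta * (2 * K +
      2))).
    by rewrite itv_integral_cst// /L; ring.
  apply: itv_integral_le; [exact: cC|exact: cM _ _ caw cdelta|] => x _.
  have [h1 _ _] := hexp (x + X).
  have h2 : `|delta x| <= 2 * K + 2.
    rewrite (_ : 2 * K + 2 = (K + 1) + (K + 1)); last by ring.
    by apply: (le_trans (ler_normB _ _)); exact: lerD.
  have : `|a x * w0 x * delta x| <= aM * eta * (2 * K + 2).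
    rewrite normrM; apply: ler_pM => //; rewrite normrM; apply: ler_pM => //.
    by rewrite gtr0_norm.
  by rewrite ler_norml => /andP[].
rewrite mX expr1n mulr1.
have tt : aM * C4 ^+ 2 * t ^+ 2 < gam / 2.
  apply: le_lt_trans hT2.
  rewrite (_ : aM * C4 ^+ 2 * t ^+ 2 = t * (aM * C4 ^+ 2) * t); last by ring.
  by rewrite ler_piMr ?(ltW t1)//; apply: mulr_ge0 => //; exact: ltW.
exact: large_shift_arith lin tt hlarge.
Qed.

End Gain.

Lemma compact_support (R : realType) (w : R -> R) (r : R) :
  (forall x, r <= `|x| -> w x = 0) -> compact (tsupport w).
Proof.
move=> w_out; apply: (@subclosed_compact _ _ `[- r, r]%classic).
- exact: closed_closure.
- exact: segment_compact.
- rewrite [X in _ `<=` X](closure_id _).1; last exact: interval_closed.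
  apply: closure_subset => x /= wx; rewrite in_itv /= -ler_norml.
  by rewrite leNgt; apply/negP => /ltW /w_out; exact/eqP.
Qed.

Theorem theorem1p1 (R : realType) (A : R -> R)
  (A_smooth : smooth A) (A_convex : strictly_convex A)
  (A'0 : derive1 A 0 = 0)
  (A'_superpoly : forall P : {poly R}, exists x : R,
    x <= 0 /\ P.[x] > derive1 A x)
  (atilde : R -> R) (atilde_W2 : W2infty01 atilde)
  (atilde_gt0 : forall x : R, 0 <= x <= 1 -> 0 < atilde x) :
  exists K : nat -> R,
    [/\ forall n : nat, 0 < K n,
        K n @[n --> \oo] --> +oo &
        forall (n : nat) (S : R -> R), viscous_shock A 0 (- K n) S ->
          let a := weight atilde 0 (- K n) S in
          exists u0 : R -> R,
            [/\ smooth u0, test_function setT (fun x => u0 x - S x) &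
            exists Tstar : R -> R, forall X : R -> R,
              [lipschitz X t | t in `[0, +oo[] -> X 0 = 0 ->
              0 < Tstar (speed_norm X) /\
              forall u : R -> R -> R, bounded_solution u A u0 ->
              forall t : R, 0 < t < Tstar (speed_norm X) ->
              (\int[lebesgue_measure]_x
                 (a x * `|u (x + X t) t - S x| ^+ 2)%:E >
               \int[lebesgue_measure]_x
                 (a x * `|u0 x - S x| ^+ 2)%:E)%E]].
Proof.
have ca : {within `[0, 1], continuous atilde} by case: atilde_W2.
have [N [Lam [Lam0 perturb]]] := positive_perturbation ca atilde_gt0.
have [am [aM [am0 aB]]] := weight_bounds ca atilde_gt0.
have /choice[K hK] : forall n : nat, exists K : R, [/\ 0 < K, n%:R <= K &
    N%:R * leftward_speed A K <= - derive1 A (- K)].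
  move=> n; exact: (derive_dominates_speed A_smooth A_convex A'0 A'_superpoly).
exists K; split.
- by move=> n; have [] := hK n.
- apply/cvgryPge => M.
  have : \forall n \near \oo, M <= n%:R by exact: nbhs_infty_ger.
  by apply: filterS => n Mn; have [_ h _] := hK n; exact: le_trans h.
move=> n S S_shock a.
have [K0 _ hN] := hK n; move: (K n) K0 hN S_shock @a => {hK}K K0 hN S_shock a.
have prof := shock_profile A_smooth A_convex A'0 K0 S_shock.
have [w1 [w2 [r [q0 [[r0 q00] [sw1 sw2] w_out /andP[I1 I12] energy_ge]]]]] :=
  perturb _ _ _ _ _ _ prof hN.
have aE : a = fun x => atilde (- S x / K).
  by apply/funext => x; rewrite /a /weight sub0r opprK add0r.
have c_a : continuous a.
  rewrite aE; apply: (@weight_comp_continuous _ atilde (fun x => - S x / K)) => //.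
    exact: profile_y01 prof.
  exact: smooth_continuous (profile_smooth prof).
have a_b x : am <= a x <= aM.
  by rewrite aE; apply: aB; have /andP[/ltW -> /ltW ->] := profile_y01 prof x.
have a_b0 x : 0 <= a x <= aM.
  by have /andP[h ->] := a_b x; rewrite andbT; exact: le_trans (ltW am0) h.
rewrite /= in energy_ge I1 I12; rewrite -aE in energy_ge.
have I1' : 0 < itv_integral (- r) r (fun x => a x * w1 x * (- derive1 S x / K)).
  by rewrite aE.
have I12' : itv_integral (- r) r (fun x => a x * w1 x * (- derive1 S x / K)) <
    Lam * itv_integral (- r) r (fun x => a x * w2 x * (- derive1 S x / K)).
  by rewrite aE.
have data := good_datum A_smooth A_convex A'0 K0 S_shock c_a a_b0 r0 q00 Lam0
  sw1 sw2 w_out I1' I12' energy_ge.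
have [w0 [rho [sw0 w0_out rrho [T T0 incr]]]] :=
  datum_increases A_smooth A_convex A'0 K0 S_shock c_a am0 a_b r0 data.
have sS := shock_smooth S_shock.
have w0E : (fun x => S x + w0 x - S x) = w0.
  by apply/funext => x; rewrite addrAC subrr add0r.
exists (fun x => S x + w0 x); split.
- exact: smoothD sS sw0.
- rewrite w0E; split=> //; exact: compact_support w0_out.
exists (fun=> T) => X _ _; split=> // u su t tT.
have t0 : 0 < t by case/andP: tT.
have gain := incr u su t (X t) tT.
have cu := bounded_solution_continuous (X := X t) su t0.
have cw := smooth_continuous sw0; have cS := smooth_continuous sS.
have normsq (z : R) : `|z| ^+ 2 = z ^+ 2 by rewrite real_normK ?num_real.
have -> : (fun x => (a x * `|S x + w0 x - S x| ^+ 2)%:E) = (fun x => (a x * w0 x ^+ 2)%:E).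
  by apply/funext => x; rewrite addrAC subrr add0r normsq.
have -> : (fun x => (a x * `|u (x + X t) t - S x| ^+ 2)%:E) =
    (fun x => (a x * (u (x + X t) t - S x) ^+ 2)%:E).
  by apply/funext => x; rewrite normsq.
have cd := continuous_add cu (continuous_opp cS).
rewrite (@line_integral_compact _ (- rho) rho).
- apply: (@lt_le_trans _ _ (itv_integral (- rho) rho
    (fun x => a x * (u (x + X t) t - S x) ^+ 2))%:E); first by rewrite lte_fin.
  apply: line_integral_ge; first exact: continuous_mul c_a (continuous_mul cd cd).
  by move=> x; rewrite mulr_ge0 ?sqr_ge0//; have /andP[] := a_b0 x.
- exact: continuous_mul c_a (continuous_mul cw cw).
- move=> x; rewrite -ler_norml -ltNge => /ltW rx.
  by rewrite w0_out ?expr0n ?mulr0//; exact: le_trans rx.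
Qed.
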